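(* Let $d\ge1$ and let $G_t$ be the fundamental solution of the heat equation or of the wave equation on $\mathbb R^d$. Then for any $(t,x)\in\mathbb R_+\times\mathbb R^d$, $n\ge1$ and $\mathbf t=(t_1,\ldots,t_n)\in T_n(t)$, $$f_n(t_1,\cdot,\ldots,t_n,\cdot,t,x)\in\mathcal O_C'(\mathbb R^{nd}).$$
   Context: $\mathcal F$ is the Fourier transform, $\mathcal F\varphi(\xi)=\int e^{-i\xi\cdot x}\varphi(x)dx$ on integrable functions, extended to tempered distributions. Fundamental solutions ($t>0$): heat ($\frac{\partial}{\partial t}-\frac12\Delta$): $G_t(x)=(2\pi t)^{-d/2}e^{-|x|^2/(2t)}$, $\mathcal FG_t(\xi)=e^{-t|\xi|^2/2}$; wave ($\frac{\partial^2}{\partial t^2}-\Delta$): $G_t$ is the compactly supported distribution on $\mathbb R^d$ with $\mathcal FG_t(\xi)=\sin(t|\xi|)/|\xi|$. $T_n(t)=\{\mathbf t\in[0,t]^n:0<t_1<\ldots<t_n<t\}$. For $\mathbf t\in T_n(t)$, $f_n(t_1,\cdot,\ldots,t_n,\cdot,t,x)$ is the distribution in $\mathcal S'(\mathbb R^{nd})$ with Fourier transform $$\mathcal Ff_n(t_1,\cdot,\ldots,t_n,\cdot,t,x)(\xi_1,\ldots,\xi_n)=e^{-i(\xi_1+\ldots+\xi_n)\cdot x}\prod_{j=1}^n\overline{\mathcal FG_{t_{j+1}-t_j}(\xi_1+\ldots+\xi_j)},\quad t_{n+1}=t.$$ (When $G_t$ is a function, $f_n(t_1,x_1,\ldots,t_n,x_n,t,x)=\prod_{j=1}^nG_{t_{j+1}-t_j}(x_{j+1}-x_j)$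 with $x_{n+1}=x$.) $\mathcal O_C'(\mathbb R^m)$ is Schwartz's space of distributions with rapid decrease: those $F$ such that $(1+|x|^2)^{k/2}F$ belongs to the dual of $\mathcal D_{L^1}=\{\varphi\in C^\infty(\mathbb R^m):D^\alpha\varphi\in L^1\ \forall\alpha\}$ for every $k\in\mathbb N$. *)

(* Defs.v *)
From HB Require Import structures.
From mathcomp Require Import all_boot all_order all_algebra.
From mathcomp Require Import all_classical all_reals all_analysis.
From mathcomp Require Import complex.
Set Implicit Arguments.
Unset Strict Implicit.
Unset Printing Implicit Defensive.
Import Order.TTheory GRing.Theory Num.Theory.
Import numFieldNormedType.Exports.
Local Open Scope classical_set_scope.
Local Open Scope ring_scope.

Section tuple_measure.
Context d (T : measurableType d) (R : realType).
Variable lam : {sigma_finite_measure set T -> \bar R}.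
Local Open Scope ereal_scope.

Definition tuple_cons m (p : T * m.-tuple T) : m.+1.-tuple T :=
  [the m.+1.-tuple T of p.1 :: p.2].

Lemma measurable_tuple_cons m : measurable_fun setT (@tuple_cons m).
Proof.
by apply: measurable_cons; [exact: measurable_fst|exact: measurable_snd].
Qed.

Section step.
Context (m : nat) (mu : {sigma_finite_measure set (m.-tuple T) -> \bar R}).

Definition cons_measure : set (m.+1.-tuple T) -> \bar R :=
  pushforward (lam \x mu) (@tuple_cons m).

Let cons_measure0 : cons_measure set0 = 0.
Proof. by rewrite /cons_measure /pushforward preimage_set0 measure0. Qed.

Let cons_measure_ge0 A : 0 <= cons_measure A.
Proof. by rewrite /cons_measure /pushforward; apply: measure_ge0. Qed.

Let cons_measure_sigma_additive : semi_sigma_additive cons_measure.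
Proof.
move=> F mF tF mUF; rewrite /cons_measure /pushforward preimage_bigcup.
apply: measure_semi_sigma_additive.
- by move=> n; rewrite -[X in measurable X]setTI; exact: measurable_tuple_cons.
- apply/trivIsetP => /= i j _ _ ij; rewrite -preimage_setI.
  by move/trivIsetP : tF => /(_ _ _ _ _ ij) ->//; rewrite preimage_set0.
- rewrite -preimage_bigcup -[X in measurable X]setTI.
  exact: measurable_tuple_cons.
Qed.

HB.instance Definition _ := isMeasure.Build _ _ _ cons_measure
  cons_measure0 cons_measure_ge0 cons_measure_sigma_additive.

Let cons_measure_sigma_finite : sigma_finite setT cons_measure.
Proof.
have /sigma_finiteP[F [TF ndF Foo]] := sigma_finiteT lam.
have /sigma_finiteP[G [TG ndG Goo]] := sigma_finiteT mu.
pose u (t : m.+1.-tuple T) : T * m.-tuple T := (thead t, [tuple of behead t]).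
have uK : cancel u (@tuple_cons m) by move=> t; apply: val_inj; case/tupleP: t.
have consK : cancel (@tuple_cons m) u.
  by move=> [a t]; rewrite /u /tuple_cons/=; congr pair; exact: val_inj.
have mu_ : measurable_fun setT u.
  apply/measurable_fun_pairP; split; first exact: measurable_tnth.
  exact: measurable_behead.
exists (fun n => u @^-1` (F n `*` G n)).
  rewrite -preimage_bigcup -[LHS](preimage_setT u); congr (_ @^-1` _).
  rewrite -setXTT TF TG predeqE => -[x y]; split.
    move=> [/= [i _ Fix] [j _ Gjy]]; exists (maxn i j) => //; split.
    - by move: x Fix; exact/subsetPset/ndF/leq_maxl.
    - by move: y Gjy; exact/subsetPset/ndG/leq_maxr.
  by move=> [i _ []/= ? ?]; split; exists i.
move=> k; have [mFk Fky] := Foo k; have [mGk Gky] := Goo k; split.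
  by rewrite -[X in measurable X]setTI; apply: mu_ => //; exact: measurableX.
rewrite /cons_measure /pushforward -comp_preimage.
rewrite (_ : u \o _ = id) ?preimage_id; last by apply/funext => p; exact: consK.
by rewrite product_measure1E// lte_mul_pinfty// ge0_fin_numE.
Qed.

HB.instance Definition _ := Measure_isSigmaFinite.Build _ _ _ cons_measure
  cons_measure_sigma_finite.

End step.

Fixpoint tuple_measure m : {sigma_finite_measure set (m.-tuple T) -> \bar R} :=
  match m with
  | 0%N => \d_([tuple] : 0.-tuple T)
  | m'.+1 => cons_measure (tuple_measure m')
  end.

Lemma tuple_measure_box m (A : 'I_m -> set T) :
  (forall i, measurable (A i)) ->
  tuple_measure m [set u | forall i, A i (tnth u i)] = \prod_(i < m) lam (A i).
Proof.
elim: m A => [|m IH] A mA.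
  rewrite big_ord0 /= diracE mem_set//= => -[].
  by [].
rewrite big_ord_recl -IH// /= /cons_measure /pushforward.
rewrite -product_measure1E//; last first.
  rewrite (_ : [set _ | _] =
      \bigcap_(i in [set: 'I_m]) ((fun u => tnth u i) @^-1` A (lift ord0 i))).
    apply: fin_bigcap_measurable => // i _; rewrite -[X in measurable X]setTI.
    exact: measurable_tnth.
  by apply/seteqP; split=> u //= + i => /(_ i) //; apply.
congr (_ _); apply/seteqP; split=> [[a u] /= Au|[a u] /= [Aa Au] i].
  split; first exact: (Au ord0).
  by move=> i; have := Au (lift ord0 i); rewrite tnthS.
by case: (unliftP ord0 i) => [j ->|->//]; rewrite tnthS.
Qed.

End tuple_measure.

Local Open Scope complex_scope.

Section euclidean.
Context {R : realType}.

Definition lebesgue_tuple m :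
    {sigma_finite_measure set (m.-tuple (measurableTypeR R)) -> \bar R} :=
  @tuple_measure _ (measurableTypeR R) R (@lebesgue_measure R) m.

(* Functions live on ['rV[R]_m] (which carries the normed structure), the
   measure on [m.-tuple R] (which carries the measurable structure). *)
Definition row_of_tuple m (u : m.-tuple (measurableTypeR R)) : 'rV[R]_m :=
  \row_i (tnth u i : R).

Definition dot m (x y : 'rV[R]_m) : R := \sum_i x 0 i * y 0 i.

(* [`|x|] on ['rV[R]_m] is the sup norm. *)
Definition enorm m (x : 'rV[R]_m) : R := Num.sqrt (dot x x).

Definition cintegrable m (f : 'rV[R]_m -> R[i]) : Prop :=
  (lebesgue_tuple m).-integrable setT
    (fun u => (complex.Re (f (row_of_tuple u)))%:E) /\
  (lebesgue_tuple m).-integrable setT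
    (fun u => (complex.Im (f (row_of_tuple u)))%:E).

Definition cintegral m (f : 'rV[R]_m -> R[i]) : R[i] :=
  (\int[lebesgue_tuple m]_u complex.Re (f (row_of_tuple u))) +i*
  (\int[lebesgue_tuple m]_u complex.Im (f (row_of_tuple u))).

Definition cexpi (a : R) : R[i] := cos a +i* sin a.

Definition fourier m (f : 'rV[R]_m -> R[i]) (xi : 'rV[R]_m) : R[i] :=
  cintegral (fun x => cexpi (- dot xi x) * f x).

(* [derivs s f] is the iterated partial derivative along the directions listed
   in [s]; for smooth [f] it is [D^alpha f], where [alpha i] counts the
   occurrences of [i] in [s], and [size s] is the order of [alpha]. *)
Definition derivs m (s : seq 'I_m) (f : 'rV[R]_m -> R) : 'rV[R]_m -> R :=
  foldr (fun i g x => 'D_(delta_mx 0 i) g x) f s.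

Definition smooth m (f : 'rV[R]_m -> R) : Prop :=
  forall s : seq 'I_m, continuous (derivs s f) /\
    forall i x, derivable (derivs s f) x (delta_mx 0 i).

Definition cderivs m (s : seq 'I_m) (f : 'rV[R]_m -> R[i]) (x : 'rV[R]_m) :
    R[i] :=
  derivs s (fun y => complex.Re (f y)) x +i*
  derivs s (fun y => complex.Im (f y)) x.

Definition csmooth m (f : 'rV[R]_m -> R[i]) : Prop :=
  smooth (fun y => complex.Re (f y)) /\ smooth (fun y => complex.Im (f y)).

Definition schwartz m (phi : 'rV[R]_m -> R[i]) : Prop :=
  csmooth phi /\
  forall (N : nat) (s : seq 'I_m), exists B : R, forall x,
    (1 + dot x x) ^+ N * Normc.normc (cderivs s phi x) <= B.

Definition schwartz_norm m (N : nat) (phi : 'rV[R]_m -> R[i]) : R :=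
  \sum_(k < N.+1) \sum_(s : k.-tuple 'I_m)
    sup [set (1 + dot x x) ^+ N * Normc.normc (cderivs s phi x)
        | x in [set: 'rV[R]_m]].

(* Functionals on test functions; only the values on the relevant test space
   (selected by the predicates below) are meaningful. *)
Definition distr m : Type := ('rV[R]_m -> R[i]) -> R[i].

Definition linear_on m (E : set ('rV[R]_m -> R[i])) (T : distr m) : Prop :=
  forall (a : R[i]) phi psi, E phi -> E psi ->
    T (fun x => a * phi x + psi x) = a * T phi + T psi.

Definition tempered m (T : distr m) : Prop :=
  linear_on (@schwartz m) T /\
  exists (N : nat) (B : R), forall phi, schwartz phi ->
    Normc.normc (T phi) <= B * schwartz_norm N phi.

(* Equality in [S'(R^m)]. *)
Definition distr_eq m (T U : distr m) : Prop :=
  forall phi, schwartz phi -> T phi = U phi.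

Definition distr_of_fun m (f : 'rV[R]_m -> R[i]) : distr m :=
  fun phi => cintegral (fun x => f x * phi x).

Definition distr_fourier m (T : distr m) : distr m :=
  fun phi => T (fourier phi).

Definition distr_mul m (w : 'rV[R]_m -> R) (T : distr m) : distr m :=
  fun phi => T (fun x => (w x)%:C * phi x).

Definition compactly_supported m (T : distr m) : Prop :=
  exists2 K : set 'rV[R]_m, compact K &
    forall phi, schwartz phi ->
      closure [set x | phi x != 0] `&` K = set0 -> T phi = 0.

Definition DL1 m (phi : 'rV[R]_m -> R[i]) : Prop :=
  csmooth phi /\ forall s : seq 'I_m, cintegrable (cderivs s phi).

Definition DL1_norm m (N : nat) (phi : 'rV[R]_m -> R[i]) : R :=
  \sum_(k < N.+1) \sum_(s : k.-tuple 'I_m)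
    \int[lebesgue_tuple m]_u
      Normc.normc (cderivs s phi (row_of_tuple u)).

Definition DL1_continuous_linear m (L : distr m) : Prop :=
  linear_on (@DL1 m) L /\
  exists (N : nat) (B : R), forall phi, DL1 phi ->
    Normc.normc (L phi) <= B * DL1_norm N phi.

(* A distribution belongs to the dual of [D_{L^1}] when it is the restriction
   of a continuous linear functional on [D_{L^1}]. *)
Definition dual_DL1 m (T : distr m) : Prop :=
  exists2 L : distr m, DL1_continuous_linear L & distr_eq T L.

Definition OC' m (T : distr m) : Prop :=
  tempered T /\
  forall k : nat,
    dual_DL1 (distr_mul (fun x => (1 + enorm x ^+ 2) `^ (k%:R / 2)) T).

Definition heat_kernel d (t : R) (x : 'rV[R]_d) : R :=
  (2 * pi * t) `^ (- (d%:R / 2)) * expR (- (enorm x ^+ 2 / (2 * t))).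

(* [sin (t r) / r], extended by continuity at [r = 0]. *)
Definition wave_symbol (t r : R) : R :=
  if r == 0 then t else sin (t * r) / r.

(* [G] is the family of fundamental solutions of the heat equation and [FG]
   the family of their Fourier transforms (as functions). *)
Definition heat_solution d (G : R -> distr d)
    (FG : R -> 'rV[R]_d -> R[i]) : Prop :=
  forall t, 0 < t ->
    distr_eq (G t) (distr_of_fun (fun x => (heat_kernel t x)%:C)) /\
    forall xi, FG t xi = fourier (fun x => (heat_kernel t x)%:C) xi.

Definition wave_solution d (G : R -> distr d)
    (FG : R -> 'rV[R]_d -> R[i]) : Prop :=
  forall t, 0 < t ->
    [/\ tempered (G t), compactly_supported (G t),
        distr_eq (distr_fourier (G t)) (distr_of_fun (FG t)) &
        forall xi, FG t xi = (wave_symbol t (enorm xi))%:C].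

(* [T_n(t)]: the tuples with [0 < t_1 < ... < t_n < t]. *)
Definition simplex n (t : R) (ts : n.-tuple R) : Prop :=
  path <%R 0 (rcons ts t).

(* [R^{nd}] is ['rV_(n * d)]; [block xi j] is the [j]-th vector of [R^d]. *)
Definition block n d (xi : 'rV[R]_(n * d)) (j : 'I_n) : 'rV[R]_d :=
  row j (vec_mx xi).

(* The default value [t] of [nth] encodes the convention [t_{n+1} = t]. *)
Definition fn_symbol n d (FG : R -> 'rV[R]_d -> R[i]) (ts : n.-tuple R)
    (t : R) (x : 'rV[R]_d) (xi : 'rV[R]_(n * d)) : R[i] :=
  cexpi (- dot (\sum_(j < n) block xi j) x) *
  \prod_(j < n)
    (FG (nth t ts j.+1 - nth t ts j) (\sum_(i < n | (i <= j)%N) block xi i))^*.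

Definition is_fn n d (FG : R -> 'rV[R]_d -> R[i]) (ts : n.-tuple R)
    (t : R) (x : 'rV[R]_d) (f : distr (n * d)) : Prop :=
  tempered f /\
  distr_eq (distr_fourier f) (distr_of_fun (fn_symbol FG ts t x)).

End euclidean.

(* Main.v *)
From HB Require Import structures.
Require Import Defs.
From mathcomp Require Import all_boot all_order all_algebra.
From mathcomp Require Import all_classical all_reals all_analysis.
From mathcomp Require Import complex.
From mathcomp Require Import measurable_realfun ring lra.

(** If [mu] denotes the symbol of [f_n], smooth with all derivatives of
    polynomial growth, then [f psi] is, up to the constant of Fourier inversion,
    the integral of [mu] against the inverse transform of [psi]. A factor
    [(1 + |x|^2)^k] on [psi] turns into [k] applications of [1 - Delta], which
    integration by parts moves onto [mu]; the new symbol still grows polynomially.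
    Since the transform of a function of [D_{L^1}] decays faster than any power,
    such an integral is a continuous functional on [D_{L^1}]. The remaining factor
    [(1 + |x|^2)^(-k/2)] of the weight has bounded derivatives and so multiplies
    [D_{L^1}] continuously. For the wave equation [mu] is smooth at the origin
    because [sin (t r) / r] is an entire function of [r^2]; the second-order
    equations satisfied by its derivatives bound them on [r^2 >= 0]. *)

Set Implicit Arguments.
Unset Strict Implicit.
Unset Printing Implicit Defensive.
Import Order.TTheory GRing.Theory Num.Theory.
Import numFieldNormedType.Exports.
Local Open Scope classical_set_scope.
Local Open Scope ring_scope.

(** * Iterated partial derivatives *)

(** Functions of $D_{L^1}$ have no prescribed rate of decay, so the functional extended to them may
    contain only bounded multipliers. The weight is therefore removed while the test function is
    still in $S$, where integration by parts is legitimate, and the formula that results is then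
    read on $D_{L^1}$. One application of 1 - Delta absorbs a whole power of [w] = 1 + |x|^2,
    whereas k/2 may be half an odd integer; this is why the weight is split as [w ^+ k] times
    [rho ^+ k] with [rho] = w^(-1/2). Fourier inversion on $S$ is used in both orders: one order
    shows that the functional built from the symbol has the right transform, the other that every
    [f] with this transform coincides with it. All calculus concerns real-valued functions, the
    complex transform being a pair of a cosine and a sine transform. Smoothness is obtained by
    enclosing a function in a class stable under partial derivatives, on which one bound serves for
    all orders. *)

Section partial_derivatives.
Context {R : realType} {m : nat}.
Local Notation V := 'rV[R]_m.
Local Notation e i := (delta_mx 0 i : V).
Implicit Types (f g : V -> R) (s : seq 'I_m) (i j : 'I_m).

(** Passage to one variable: the chain rule, the mean value theorem and the fundamental theorem of
    calculus are applied to the restriction of [f] to a line and read back as statements on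
    directional derivatives. *)
Lemma is_derive_line f (x v : V) (a l : R) :
  is_derive a 1 (fun h : R => f (h *: v + x)) l <->
  is_derive (a *: v + x) v f l.
Proof.
have E : (fun h : R => h^-1 *: (((fun h : R => f (h *: v + x)) \o shift a)
      (h *: 1) - f (a *: v + x))) =
    (fun h => h^-1 *: ((f \o shift (a *: v + x)) (h *: v) - f (a *: v + x))).
  apply/funext => h /=; congr (_ *: (f _ - _)).
  by rewrite scalerDl addrA /GRing.scale /= mulr1.
split=> -[]; rewrite /derivable /derive => D1 D2; split; rewrite /derivable /derive.
- by move: D1; rewrite E.
- by move: D2; rewrite E.
- by rewrite E.
- by rewrite E.
Qed.

Lemma is_derive_chain f (x v : V) (H : R -> R) (l dH : R) :
  is_derive x v f l -> is_derive (f x) 1 H dH ->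
  is_derive x v (fun y => H (f y)) (dH * l).
Proof.
move=> df dHf; rewrite -[x]add0r -(scale0r v); apply/is_derive_line.
apply: (@is_derive1_comp _ H (fun h => f (h *: v + x))).
  by rewrite scale0r add0r.
by apply/is_derive_line; rewrite scale0r add0r.
Qed.

Lemma is_derive_affine (a c d : R) : is_derive a 1 (fun h : R => h * c + d) c.
Proof.
by apply: is_derive_eq; rewrite scaler0 add0r addr0 /GRing.scale/= mulr1.
Qed.

Definition pd i f : V -> R := fun x => 'D_(e i) f x.

(** Existence of the partial derivatives is recorded, not their continuity: this is one layer of
    [smooth], so that [smooth f] says exactly that every [derivs s f] is [C1]. *)
Definition C1 f : Prop := continuous f /\ forall i x, derivable f x (e i).

Lemma pdP f i x : C1 f -> is_derive x (e i) f (pd i f x).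
Proof. by case=> _ d; apply/derivableP/d. Qed.

Lemma C1_pdI f (df : 'I_m -> V -> R) : continuous f ->
  (forall i x, is_derive x (e i) f (df i x)) -> C1 f /\ forall i, pd i f = df i.
Proof.
move=> cf Hd; split.
  by split=> // i x; case: (Hd i x).
by move=> i; apply/funext => x; case: (Hd i x).
Qed.

Lemma C1_cst (c : R) : C1 (fun=> c).
Proof. by split=> [x|i x]; [exact: cst_continuous | exact: derivable_cst]. Qed.

Lemma pd_cst i (c : R) : pd i (fun=> c) = fun=> 0.
Proof. by apply/funext => x; exact: derive_cst. Qed.

Lemma C1D f g : C1 f -> C1 g -> C1 (fun x => f x + g x).
Proof.
move=> [cf df] [cg dg]; split=> [x|i x]; first exact: cvgD (cf x) (cg x).
exact: derivableD.
Qed.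

Lemma pdD i f g : C1 f -> C1 g ->
  pd i (fun x => f x + g x) = fun x => pd i f x + pd i g x.
Proof. by move=> [_ df] [_ dg]; apply/funext => x; exact: deriveD. Qed.

Lemma C1M f g : C1 f -> C1 g -> C1 (fun x => f x * g x).
Proof.
move=> [cf df] [cg dg]; split=> [x|i x]; first exact: cvgM (cf x) (cg x).
exact: derivableM.
Qed.

Lemma pdM i f g : C1 f -> C1 g ->
  pd i (fun x => f x * g x) = fun x => pd i f x * g x + f x * pd i g x.
Proof.
move=> [_ df] [_ dg]; apply/funext => x; rewrite /pd deriveM//.
by rewrite addrC /GRing.scale /= mulrC.
Qed.

Lemma C1_pd_coord j :
  C1 (fun x : V => x 0 j) /\ forall i, pd i (fun x : V => x 0 j) = fun=> (i == j)%:R.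
Proof.
apply: C1_pdI => [x|i x]; first exact: coord_continuous.
rewrite -[x]add0r -(scale0r (e i)); apply/is_derive_line.
rewrite (_ : (fun _ => _) = (fun h : R => h * (i == j)%:R + x 0 j)).
  exact: is_derive_affine.
by apply/funext => h; rewrite !mxE eqxx/= eq_sym.
Qed.

Lemma C1_coord j : C1 (fun x : V => x 0 j).
Proof. exact: (C1_pd_coord j).1. Qed.

Lemma pd_coord i j : pd i (fun x : V => x 0 j) = fun=> (i == j)%:R.
Proof. exact: (C1_pd_coord j).2. Qed.

Lemma C1_comp f (H H' : R -> R) : C1 f ->
  (forall x, is_derive (f x) 1 H (H' (f x))) ->
  C1 (fun x => H (f x)) /\
  forall i, pd i (fun x => H (f x)) = fun x => H' (f x) * pd i f x.
Proof.
move=> Cf dH; apply: C1_pdI => [x|i x].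
  apply: continuous_comp; first exact: Cf.1.
  by have [/derivable1_diffP/differentiable_continuous] := dH x.
exact: (is_derive_chain (pdP i x Cf) (dH x)).
Qed.

Lemma derivs_cons i s f : derivs (i :: s) f = pd i (derivs s f).
Proof. by []. Qed.

Lemma derivs_cat s t f : derivs (s ++ t) f = derivs s (derivs t f).
Proof. by rewrite /derivs foldr_cat. Qed.

Lemma derivs_rcons s i f : derivs (rcons s i) f = derivs s (pd i f).
Proof. by rewrite -cats1 derivs_cat. Qed.

Lemma smooth_C1 f : smooth f -> C1 f.
Proof. by move=> /(_ [::]). Qed.

Lemma smooth_pd f i : smooth f -> smooth (pd i f).
Proof. by move=> sf s; rewrite -derivs_rcons; exact: sf. Qed.

(** Replaces the computation of higher derivatives: a bound valid throughout a class [P] that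
    partial derivatives preserve holds for every [derivs s f]. *)
Lemma smooth_ind (P : (V -> R) -> Prop) :
  (forall f, P f -> C1 f /\ forall i, P (pd i f)) ->
  forall f, P f -> smooth f /\ forall s, P (derivs s f).
Proof.
move=> HP f Pf.
have H s : P (derivs s f) by elim: s => //= i s IH; exact: (HP _ IH).2.
by split=> // s; exact: (HP _ (H s)).1.
Qed.

Lemma derivsD s f g : smooth f -> smooth g ->
  derivs s (fun x => f x + g x) = fun x => derivs s f x + derivs s g x.
Proof.
move=> sf sg; elim: s => // i s IH.
by rewrite derivs_cons IH (pdD i (sf s) (sg s)).
Qed.

Lemma smoothD f g : smooth f -> smooth g -> smooth (fun x => f x + g x).
Proof. by move=> sf sg s; rewrite derivsD//; exact: (C1D (sf s) (sg s)). Qed.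

Lemma derivs_cst s (c : R) : exists c', derivs s (fun=> c) = fun=> c'.
Proof.
elim: s => [|i s [c' IH]]; first by exists c.
by exists 0; rewrite derivs_cons IH pd_cst.
Qed.

Lemma smooth_cst (c : R) : smooth (fun _ : V => c).
Proof. by move=> s; have [c' ->] := derivs_cst s c; exact: C1_cst. Qed.

(* The ways to distribute a list of derivations over the two factors in the
   Leibniz rule. *)
Fixpoint splits (T : Type) (s : seq T) : seq (seq T * seq T) :=
  if s is i :: s' then
    [seq (i :: p.1, p.2) | p <- splits s'] ++
    [seq (p.1, i :: p.2) | p <- splits s']
  else [:: ([::], [::])].

Lemma splits_size (s : seq 'I_m) p :
  p \in splits s -> (size p.1 + size p.2 = size s)%N.
Proof.
elim: s p => [|i s IH] p /=; first by rewrite inE => /eqP ->.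
rewrite mem_cat => /orP[] /mapP[q qs ->] /=.
  by rewrite addSn IH.
by rewrite addnS IH.
Qed.

Lemma C1_sum (I : Type) (r : seq I) (F : I -> V -> R) :
  (forall k, C1 (F k)) -> C1 (fun x => \sum_(k <- r) F k x).
Proof.
move=> CF; elim: r => [|k r IH].
  under eq_fun do rewrite big_nil; exact: C1_cst.
under eq_fun do rewrite big_cons; exact: C1D.
Qed.

Lemma pd_sum i (I : Type) (r : seq I) (F : I -> V -> R) :
  (forall k, C1 (F k)) ->
  pd i (fun x => \sum_(k <- r) F k x) = fun x => \sum_(k <- r) pd i (F k) x.
Proof.
move=> CF; elim: r => [|k r IH].
  under eq_fun do rewrite big_nil; rewrite pd_cst.
  by apply/funext => x; rewrite big_nil.
under eq_fun do rewrite big_cons.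
rewrite pdD//; last exact: C1_sum.
by rewrite IH; apply/funext => x; rewrite big_cons.
Qed.

Lemma derivsM s f g : smooth f -> smooth g ->
  derivs s (fun x => f x * g x) =
  fun x => \sum_(p <- splits s) derivs p.1 f x * derivs p.2 g x.
Proof.
move=> sf sg; elim: s => [|i s IH].
  by apply/funext => x; rewrite big_seq1.
rewrite derivs_cons IH pd_sum; last first.
  by move=> p; exact: (C1M (sf p.1) (sg p.2)).
apply/funext => x; rewrite /= big_cat/= !big_map/= -big_split/=.
by apply: eq_bigr => p _; rewrite (pdM i (sf p.1) (sg p.2)).
Qed.

Lemma smoothM f g : smooth f -> smooth g -> smooth (fun x => f x * g x).
Proof.
move=> sf sg s; rewrite derivsM//; apply: C1_sum => p.
exact: (C1M (sf p.1) (sg p.2)).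
Qed.

Lemma smooth_coord j : smooth (fun x : V => x 0 j).
Proof.
move=> s; case/lastP: s => [|s i]; first exact: C1_coord.
by rewrite derivs_rcons pd_coord; exact: smooth_cst.
Qed.

End partial_derivatives.

(** * Lebesgue integration on row vectors *)

Section tuple_integration.
Context {R : realType}.
Local Notation mR := (measurableTypeR R).
Local Notation lam := (@lebesgue_measure R).
Local Notation lamt := (@lebesgue_tuple R).
Local Open Scope ereal_scope.

(** Lebesgue measure is determined by its values on the intervals []a, b]], whose length a
    translation preserves. *)
Lemma lebesgue_measure_shift (c : R) (A : set R) : measurable A ->
  pushforward lam (fun x : mR => (x + c)%R : mR) A = lam A.
Proof.
move=> mA.
have mphi : measurable_fun setT (fun x : mR => (x + c)%R : mR).
  by apply: measurable_funD.
pose phi_mixin := isMeasurableFun.Build _ _ _ _ _ mphi.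
pose phi : {mfun mR >-> mR} := HB.pack (fun x : mR => (x + c)%R : mR) phi_mixin.
rewrite -[LHS]/(pushforward lam phi A).
apply/esym/lebesgue_measure_unique => //= _ [[a b]] _ <-.
rewrite /pushforward (_ : _ @^-1` _ = `](a - c)%R, (b - c)%R]%classic).
  rewrite !lebesgue_measure_itv/= !lte_fin ltrD2r; case: ifP => // _.
  by rewrite -!EFinB; congr (_%:E); ring.
apply/seteqP; split => x /=; rewrite !in_itv/= ltrBlDr lerBrDr//.
Qed.

Lemma ge0_integral_lebesgue_shift (c : R) (g : mR -> \bar R) :
  measurable_fun setT g -> (forall x, 0 <= g x) ->
  \int[lam]_x g (x + c)%R = \int[lam]_x g x.
Proof.
move=> mg g0.
have mc : measurable_fun setT (fun x : mR => (x + c)%R : mR).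
  by apply: measurable_funD.
rewrite -[LHS](@ge0_integral_pushforward _ _ _ _ _ _ mc lam setT g)//.
by apply: eq_measure_integral => A mA _; exact: lebesgue_measure_shift.
Qed.

Lemma ge0_integral_tuple_cons m (F : m.+1.-tuple mR -> \bar R) :
  measurable_fun setT F -> (forall u, 0 <= F u) ->
  \int[lamt m.+1]_u F u =
  \int[lam]_a \int[lamt m]_u F (tuple_cons (a, u)).
Proof.
move=> mF F0; rewrite /lebesgue_tuple /= /cons_measure.
rewrite ge0_integral_pushforward//; last exact: measurable_tuple_cons.
rewrite preimage_setT fubini_tonelli1//; last by move=> x; exact: F0.
by apply: measurableT_comp => //; exact: measurable_tuple_cons.
Qed.

Definition tuple_shift m (v : 'I_m -> R) (u : m.-tuple mR) : m.-tuple mR :=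
  [tuple (tnth u i + v i)%R | i < m].

Lemma measurable_tuple_shift m (v : 'I_m -> R) :
  measurable_fun setT (tuple_shift v).
Proof.
apply/measurable_fun_tnthP => i.
rewrite (_ : _ \o _ = (fun u : m.-tuple mR => (tnth u i + v i)%R)); last first.
  by apply/funext => u /=; rewrite tnth_mktuple.
by apply: measurable_funD => //; exact: measurable_tnth.
Qed.

(** Tonelli splits off the head coordinate; the tail is shifted by induction, the head by invariance
    in dimension one. *)
Lemma ge0_integral_tuple_shift m (v : 'I_m -> R) (F : m.-tuple mR -> \bar R) :
  measurable_fun setT F -> (forall u, 0 <= F u) ->
  \int[lamt m]_u F (tuple_shift v u) = \int[lamt m]_u F u.
Proof.
elim: m v F => [|m IH] v F mF F0.
  by apply: eq_integral => u _; congr F; rewrite tuple0 [u]tuple0.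
rewrite ge0_integral_tuple_cons//; last first.
  by apply: measurableT_comp => //; exact: measurable_tuple_shift.
rewrite ge0_integral_tuple_cons//.
have mFc a : measurable_fun setT (fun u : m.-tuple mR => F (tuple_cons (a, u))).
  apply: measurableT_comp => //.
  by apply: (measurableT_comp (@measurable_tuple_cons _ _ m)).
transitivity (\int[lam]_a \int[lamt m]_u F (tuple_cons ((a + v ord0)%R, u))).
  apply: eq_integral => a _.
  rewrite -(IH (fun i => v (lift ord0 i))
    (fun u => F (tuple_cons ((a + v ord0)%R, u))))//; last exact: mFc.
  apply: eq_integral => u _; congr F; apply: eq_from_tnth => i.
  rewrite tnth_mktuple /tuple_cons/=.
  by case: (unliftP ord0 i) => [j|] ->; rewrite ?tnthS ?tnth0// tnth_mktuple.
rewrite (@ge0_integral_lebesgue_shift (v ord0)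
  (fun a : mR => \int[lamt m]_u F (tuple_cons (a, u))))//.
- have := @measurable_fun_fubini_tonelli_F _ _ _ _ R (lamt m) (F \o @tuple_cons _ mR m).
  apply; last by move=> x; exact: F0.
  by apply: measurableT_comp => //; exact: measurable_tuple_cons.
- by move=> a; apply: integral_ge0.
Qed.

Lemma integral_tuple_shift m (v : 'I_m -> R) (F : m.-tuple mR -> \bar R) :
  measurable_fun setT F ->
  \int[lamt m]_u F (tuple_shift v u) = \int[lamt m]_u F u.
Proof.
move=> mF; rewrite integralE [RHS]integralE; congr (_ - _).
- rewrite -[RHS](@ge0_integral_tuple_shift _ v _ (measurable_funepos mF)).
    by apply: eq_integral => u _; rewrite !funeposE.
  by move=> u; exact: funepos_ge0.
- rewrite -[RHS](@ge0_integral_tuple_shift _ v _ (measurable_funeneg mF)).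
    by apply: eq_integral => u _; rewrite !funenegE.
  by move=> u; exact: funeneg_ge0.
Qed.

End tuple_integration.

(** * Borel measurability on row vectors *)

Section rv_measurable.
Context {R : realType} {m : nat}.
Local Notation V := 'rV[R]_m.
Local Notation mR := (measurableTypeR R).

(** The topology comes from row vectors, the measurable sets from tuples. An open set is a countable
    union of balls with rational centre and radius 1/(k+1), and a ball of the sup norm is a box. *)
Lemma row_of_tuple_open_measurable (U : set V) : open U ->
  measurable ((@row_of_tuple R m) @^-1` U).
Proof.
move=> oU.
pose c (q : 'rV[rat]_m) : V := \row_i ratr (q 0 i).
have -> : (@row_of_tuple R m) @^-1` U =
  \bigcup_(p in [set p : 'rV[rat]_m * nat | ball (c p.1) (p.2.+1%:R^-1) `<=` U])
    ((@row_of_tuple R m) @^-1` ball (c p.1) (p.2.+1%:R^-1)).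
  apply/seteqP; split=> [u /= Uu|u [[q k] /= qU] Bu]; last exact: qU.
  have [r /= r0 rU] : exists2 r : R, 0 < r & ball (row_of_tuple u) r `<=` U.
    by have /nbhs_ballP[r r0 rU] := open_nbhs_nbhs (conj oU Uu); exists r.
  (* With 1/(k+1) < r/2, the ball of radius 1/(k+1) around a rational centre closer than 1/(k+1) to
     the point contains the point and stays inside the ball of radius r. *)
  pose k := Num.truncn (r / 2)^-1.
  have kr : k.+1%:R^-1 < r / 2.
    by rewrite invf_plt ?posrE ?divr_gt0//; exact: truncnS_gt.
  have H i : exists q : rat, ball (row_of_tuple u 0 i) (k.+1%:R^-1) (ratr q : R).
    have : row_of_tuple u 0 i - k.+1%:R^-1 < row_of_tuple u 0 i + k.+1%:R^-1.
      by rewrite ltrD2l gtrN.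
    move=> /rat_in_itvoo[q]; rewrite in_itv/= => qi; exists q.
    by rewrite -ball_normE /= ltr_distlC.
  have [q Hq] := choice H.
  exists (\row_i q i, k) => /=.
    apply: subset_trans rU => y By; have -> : r = r / 2 + r / 2 by lra.
    apply: (@ball_triangle _ _ (c (\row_i q i))).
      split=> [|i j]; first by rewrite divr_gt0.
      by rewrite ord1 !mxE; apply: (le_ball (ltW kr)); have := Hq j; rewrite mxE.
    by apply: (le_ball (ltW kr)).
  split=> // i j.
  by rewrite ord1 !mxE; apply: ball_sym; have := Hq j; rewrite mxE.
rewrite bigcup_mkcond; apply: countable_bigcupT_measurable => //.
move=> [q k]; case: ifPn => // _.
rewrite (_ : _ @^-1` _ = \bigcap_(i in [set: 'I_m])
    ((fun u : m.-tuple mR => tnth u i) @^-1` ball (c q 0 i) k.+1%:R^-1)).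
  apply: fin_bigcap_measurable => // i _; rewrite -[X in measurable X]setTI.
  by apply: measurable_tnth => //; exact: measurable_ball.
apply/seteqP; split => [u /= [_ Bu] i _|u Bu].
  by have := Bu 0 i; rewrite !mxE.
split=> // i j; by have := Bu j I; rewrite ord1 !mxE.
Qed.

Lemma continuous_rv_measurable (f : V -> R) : continuous f ->
  measurable_fun setT (fun u : m.-tuple mR => f (row_of_tuple u)).
Proof.
move=> cf; apply: (measurability _ (RGenOpens.measurableE R)) => //.
move=> _ [_ [a [b ->]] <-]; rewrite setTI.
apply: (@row_of_tuple_open_measurable (f @^-1` `]a, b[)).
by apply: open_comp; [move=> x _; exact: cf | exact: interval_open].
Qed.

End rv_measurable.

(** * The integral on row vectors and the weight 1 + |x|^2 *)

Section rv_integral.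
Context {R : realType} {m : nat}.
Local Notation V := 'rV[R]_m.
Local Notation mR := (measurableTypeR R).
Local Notation lamt := (lebesgue_tuple m).
Implicit Types f g p q : V -> R.

Definition Int f : R := \int[lamt]_u f (row_of_tuple u).
Definition Intble f : Prop :=
  lamt.-integrable setT (fun u => (f (row_of_tuple u))%:E).
Definition mble f : Prop :=
  measurable_fun setT (fun u : m.-tuple mR => f (row_of_tuple u)).

Lemma Intble_mble f : Intble f -> mble f.
Proof. by move=> /integrableP[/measurable_EFinP]. Qed.

Lemma mbleM f g : mble f -> mble g -> mble (fun x => f x * g x).
Proof. exact: measurable_funM. Qed.

Lemma mble_continuous f : continuous f -> mble f.
Proof. exact: continuous_rv_measurable. Qed.

Lemma Intble_dom f g : mble f -> Intble g -> (forall x, `|f x| <= g x) ->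
  Intble f.
Proof.
move=> mf ig fg; apply: le_integrable ig => //.
  exact/measurable_EFinP.
by move=> u _ /=; rewrite lee_fin (le_trans (fg _))// ler_norm.
Qed.

Lemma IntbleD f g : Intble f -> Intble g -> Intble (fun x => f x + g x).
Proof. exact: integrableD. Qed.

Lemma IntbleZ (c : R) f : Intble f -> Intble (fun x => c * f x).
Proof. exact: integrableZl. Qed.

Lemma Intble0 : Intble (fun=> 0).
Proof. exact: integrable0. Qed.

Lemma Intble_norm f : Intble f -> Intble (fun x => `|f x|).
Proof. exact: integrable_norm. Qed.

Lemma IntD f g : Intble f -> Intble g ->
  Int (fun x => f x + g x) = Int f + Int g.
Proof. exact: RintegralD. Qed.

Lemma IntZ (c : R) f : Intble f -> Int (fun x => c * f x) = c * Int f.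
Proof. exact: RintegralZl. Qed.

Lemma Int0 : Int (fun=> 0) = 0.
Proof. by rewrite /Int Rintegral_cst// mul0r. Qed.

Lemma Intble_sum (I : Type) (r : seq I) (F : I -> V -> R) :
  (forall k, Intble (F k)) -> Intble (fun x => \sum_(k <- r) F k x).
Proof.
move=> HF; elim: r => [|k r IH].
  by under eq_fun do rewrite big_nil; exact: Intble0.
by under eq_fun do rewrite big_cons; exact: IntbleD.
Qed.

Lemma Int_sum (I : Type) (r : seq I) (F : I -> V -> R) :
  (forall k, Intble (F k)) ->
  Int (fun x => \sum_(k <- r) F k x) = \sum_(k <- r) Int (F k).
Proof.
move=> HF; elim: r => [|k r IH].
  by under eq_fun do rewrite big_nil; rewrite Int0 big_nil.
under eq_fun do rewrite big_cons.
by rewrite IntD//; [rewrite IH big_cons|exact: Intble_sum].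
Qed.

Lemma Int_ge0 f : (forall x, 0 <= f x) -> 0 <= Int f.
Proof. by move=> f0; apply: Rintegral_ge0. Qed.

Lemma le_Int f g : Intble f -> Intble g -> (forall x, f x <= g x) ->
  Int f <= Int g.
Proof. by move=> fi gi fg; apply: le_Rintegral. Qed.

Lemma ler_norm_Int f : Intble f -> `|Int f| <= Int (fun x => `|f x|).
Proof. exact: le_normr_Rintegral. Qed.

Lemma norm_Int_le f g : Intble f -> Intble g -> (forall x, `|f x| <= g x) ->
  `|Int f| <= Int g.
Proof.
move=> fi gi fg; apply: (le_trans (ler_norm_Int fi)).
by apply: le_Int => //; exact: Intble_norm.
Qed.

Lemma row_of_tuple_shift (v : V) (u : m.-tuple mR) :
  row_of_tuple (tuple_shift (fun i => v 0 i) u) = row_of_tuple u + v.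
Proof. by apply/rowP => i; rewrite !mxE tnth_mktuple. Qed.

Lemma mble_shift (v : V) f : mble f -> mble (fun x => f (x + v)).
Proof.
move=> mf; rewrite /mble.
under eq_fun do rewrite -row_of_tuple_shift.
exact: (measurableT_comp mf (measurable_tuple_shift _)).
Qed.

Lemma Intble_shift (v : V) f : Intble f -> Intble (fun x => f (x + v)).
Proof.
move=> fi; have /measurable_EFinP mf := Intble_mble fi.
move/integrableP : (fi) => [_ foo].
apply/integrableP; split.
  by apply/measurable_EFinP; exact: (mble_shift v (Intble_mble fi)).
under eq_integral do rewrite -row_of_tuple_shift.
rewrite (@ge0_integral_tuple_shift _ _ _
  (fun u : m.-tuple mR => `|(f (row_of_tuple u))%:E|%E))//.
by apply: measurableT_comp.
Qed.

Lemma Int_shift (v : V) f : Intble f -> Int (fun x => f (x + v)) = Int f.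
Proof.
move=> fi; have /measurable_EFinP mf := Intble_mble fi.
rewrite /Int /Rintegral; congr fine.
under eq_integral do rewrite -row_of_tuple_shift.
exact: (integral_tuple_shift _ mf).
Qed.

Definition w (x : V) : R := 1 + dot x x.

Lemma dot_ge0 (x : V) : 0 <= dot x x.
Proof. by apply: sumr_ge0 => i _; rewrite -expr2 sqr_ge0. Qed.

Lemma w_ge1 x : 1 <= w x.
Proof. by rewrite lerDl dot_ge0. Qed.

Lemma w_gt0 x : 0 < w x.
Proof. exact: lt_le_trans ltr01 (w_ge1 x). Qed.

Lemma sqr_coord_le_dot (x : V) i : x 0 i ^+ 2 <= dot x x.
Proof.
rewrite /dot (bigD1 i)//= -expr2 lerDl; apply: sumr_ge0 => j _.
by rewrite -expr2 sqr_ge0.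
Qed.

Lemma norm_coord_le_w (x : V) i : `|x 0 i| <= w x.
Proof.
have := sqr_coord_le_dot x i; rewrite -(real_normK (num_real (x 0 i))) /w => H.
have : 0 <= (`|x 0 i| - 1) ^+ 2 by rewrite sqr_ge0.
have := normr_ge0 (x 0 i); nra.
Qed.

Lemma C1_dot : C1 (fun x : V => dot x x).
Proof. by apply: C1_sum => i; exact: (C1M (C1_coord i) (C1_coord i)). Qed.

Lemma C1_w : C1 w.
Proof. exact: (C1D (C1_cst 1) C1_dot). Qed.

Lemma continuous_w : continuous w.
Proof. exact: C1_w.1. Qed.

Lemma integral_oneDsqr_lty :
  (\int[@lebesgue_measure R]_x ((oneDsqr x)^-1)%:E < +oo)%E.
Proof.
have mfT : measurable_fun setT (fun x : mR => ((oneDsqr x)^-1)%:E).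
  apply/measurable_EFinP.
  exact: (continuous_measurable_fun (@continuous_oneDsqrV R)).
have mf D : measurable_fun D (fun x : mR => ((oneDsqr x)^-1)%:E).
  exact: measurable_funTS.
have f0 (x : mR) : (0 <= ((oneDsqr x)^-1)%:E)%E.
  by rewrite lee_fin invr_ge0 (le_trans ler01 (oneDsqr_ge1 x)).
have H : (\int[@lebesgue_measure R]_(x in `]-oo, 0%R])
    ((oneDsqr x)^-1)%:E)%E = (pi / 2)%:E.
  rewrite -integral0y_oneDsqr ge0_integration_by_substitution0//.
  by apply: eq_integral => x _; rewrite /oneDsqr sqrrN.
have -> : [set: mR] = `]-oo, 0%R]%classic `|` `]0%R, +oo[%classic.
  apply/esym; rewrite -subTset => x _ /=; rewrite !in_itv/= andbT.
  by case: (leP x 0) => _; [left|right].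
rewrite ge0_integral_setU//=; last first.
  rewrite disj_set2E; apply/eqP; rewrite -subset0 => x [] /=.
  by rewrite !in_itv/= andbT => /le_lt_trans H0 /H0; rewrite ltxx.
apply: (@le_lt_trans _ _ ((pi / 2)%:E + (pi / 2)%:E)%E); last by rewrite ltry.
rewrite -{1}H -integral0y_oneDsqr; apply: leeD => //.
apply: ge0_subset_integral => //.
by move=> x /=; rewrite !in_itv/= !andbT => /ltW.
Qed.

Lemma ge0_integral_prod_oneDsqr_lty n :
  (\int[@lebesgue_tuple R n]_u (\prod_(i < n) (oneDsqr (tnth u i))^-1)%:E < +oo)%E.
Proof.
have mprod k : measurable_fun setT (fun u : k.-tuple mR =>
    (\prod_(i < k) (oneDsqr (tnth u i))^-1)%:E).
  apply/measurable_EFinP; apply: measurable_prod => i _.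
  apply: (@measurableT_comp _ _ _ _ _ _ (fun x : mR => (oneDsqr x)^-1)).
    exact: (continuous_measurable_fun (@continuous_oneDsqrV R)).
  exact: measurable_tnth.
have p0 k (u : k.-tuple mR) : 0 <= \prod_(i < k) (oneDsqr (tnth u i))^-1.
  by apply: prodr_ge0 => i _; rewrite invr_ge0 (le_trans ler01 (oneDsqr_ge1 _)).
elim: n => [|n IH].
  under eq_integral do rewrite big_ord0.
  by rewrite integral_cst//= diracE mem_set// mule1 ltry.
rewrite ge0_integral_tuple_cons//; last by move=> u; rewrite lee_fin.
pose c : \bar R := (\int[@lebesgue_tuple R n]_u (\prod_(i < n) (oneDsqr (tnth u i))^-1)%:E)%E.
have c0 : (0 <= c)%E by apply: integral_ge0 => u _; rewrite lee_fin.
rewrite (eq_integral (fun a : mR => (c * (oneDsqr a)^-1%:E)%E)); last first.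
  move=> a _; rewrite muleC -ge0_integralZl//.
  - apply: eq_integral => u _; rewrite big_ord_recl -EFinM.
    by congr (_ * _)%:E; apply: eq_bigr => i _; rewrite /tuple_cons tnthS.
  - exact: mprod.
  - by move=> u _; rewrite lee_fin.
rewrite ge0_integralZl//; last first.
  apply/measurable_EFinP.
  exact: (continuous_measurable_fun (@continuous_oneDsqrV R)).
apply: lte_mul_pinfty => //; first by rewrite ge0_fin_numE.
exact: integral_oneDsqr_lty.
Qed.

Lemma wV_gt0 N x : 0 < (w x ^+ N)^-1.
Proof. by rewrite invr_gt0 exprn_gt0// w_gt0. Qed.

Lemma continuous_wX N : continuous (fun x => w x ^+ N).
Proof.
move=> x; apply: (@continuous_comp _ _ _ w (fun y => y ^+ N)).
  exact: continuous_w.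
exact: exprn_continuous.
Qed.

Lemma continuous_wV N : continuous (fun x => (w x ^+ N)^-1).
Proof.
move=> x; apply: (@continuousV _ _ (fun x => w x ^+ N)).
  by rewrite expf_neq0// gt_eqF// w_gt0.
exact: continuous_wX.
Qed.

(** Each 1 + x_i^2 is at most [w x], so one power of [w] per coordinate puts the function below a
    product of integrable functions of one variable. *)
Lemma Intble_wV : Intble (fun x => (w x ^+ m)^-1).
Proof.
have mwV := mble_continuous (@continuous_wV m).
apply: (@le_integrable _ _ _ _ _ measurableT _
  (fun u : m.-tuple mR => (\prod_(i < m) (oneDsqr (tnth u i))^-1)%:E)).
- by apply/measurable_EFinP; exact: mwV.
- move=> u _ /=; rewrite lee_fin (ger0_norm (ltW (wV_gt0 _ _))) ger0_norm; last first.
    by apply: prodr_ge0 => i _; rewrite invr_ge0 (le_trans ler01 (oneDsqr_ge1 _)).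
  rewrite -exprVn -[X in _ ^+ X]card_ord -prodr_const.
  apply: ler_prod => i _; rewrite invr_ge0 (ltW (w_gt0 _))/=.
  rewrite lef_pV2 ?posrE ?w_gt0 ?(lt_le_trans ltr01 (oneDsqr_ge1 _))//.
  by rewrite lerD2l; have := sqr_coord_le_dot (row_of_tuple u) i; rewrite mxE.
- apply/integrableP; split.
    apply/measurable_EFinP; apply: measurable_prod => i _.
    apply: (@measurableT_comp _ _ _ _ _ _ (fun x : mR => (oneDsqr x)^-1)).
      exact: (continuous_measurable_fun (@continuous_oneDsqrV R)).
    exact: measurable_tnth.
  under eq_integral do rewrite gee0_abs ?lee_fin ?prodr_ge0 //.
  exact: ge0_integral_prod_oneDsqr_lty.
Qed.

End rv_integral.

(** * Fubini for bounded kernels; cosine and sine transforms *)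

Section fubini_rv.
Context {R : realType} {m : nat}.
Local Notation V := 'rV[R]_m.
Local Notation mR := (measurableTypeR R).
Local Notation lamt := (lebesgue_tuple m).
Implicit Types (f g p q : V -> R).

Lemma EFin_Int f : Intble f ->
  (\int[lamt]_u (f (row_of_tuple u))%:E)%E = (Int f)%:E.
Proof. by move=> fi; rewrite fineK//; exact: integrable_fin_num. Qed.

Section kernel.
Variable k : V -> V -> R.
Hypothesis mk : measurable_fun setT (fun z : m.-tuple mR * m.-tuple mR =>
  k (row_of_tuple z.1) (row_of_tuple z.2)).
Hypothesis k1 : forall x y, `|k x y| <= 1.

Lemma Intble_kernelr x p : Intble p -> Intble (fun y => k (row_of_tuple x) y * p y).
Proof.
move=> ip; apply: (Intble_dom _ (Intble_norm ip)).
  apply: mbleM; last exact: Intble_mble.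
  exact: (measurableT_comp mk (pair1_measurable x)).
by move=> y; rewrite normrM ler_piMl.
Qed.

Lemma Intble_kernell y q : Intble q -> Intble (fun x => k x (row_of_tuple y) * q x).
Proof.
move=> iq; apply: (Intble_dom _ (Intble_norm iq)).
  apply: mbleM; last exact: Intble_mble.
  exact: (measurableT_comp mk (pair2_measurable y)).
by move=> x; rewrite normrM ler_piMl.
Qed.

Let F p q (z : m.-tuple mR * m.-tuple mR) : \bar R :=
  (q (row_of_tuple z.1) * (k (row_of_tuple z.1) (row_of_tuple z.2) *
    p (row_of_tuple z.2)))%:E.

(** By Tonelli: since |k| <= 1, the inner integral of the absolute value is at most |q(x)| times the
    L^1 norm of [p]. *)
Let integrable_F p q : Intble p -> Intble q ->
  (lamt \x lamt)%E.-integrable setT (F p q).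
Proof.
move=> ip iq.
have mF : measurable_fun setT (F p q).
  apply/measurable_EFinP; apply: measurable_funM.
    exact: (measurableT_comp (Intble_mble iq) measurable_fst).
  apply: measurable_funM => //.
  exact: (measurableT_comp (Intble_mble ip) measurable_snd).
apply/(integrable12ltyP lamt lamt mF).
have /integrableP[mq qoo] := Intble_norm iq.
have /integrableP[mp poo] := Intble_norm ip.
apply: (@le_lt_trans _ _ (\int[lamt]_u ((Int (fun y => `|p y|))%:E *
    `|(`|q (row_of_tuple u)|)%:E|))%E).
  apply: ge0_le_integral => //.
  - by move=> u _; apply: integral_ge0.
  - apply: (measurable_fun_fubini_tonelli_F (abse \o F p q)) => //=.
    by apply: measurableT_comp.
  - by apply: measurable_funeM; exact: measurableT_comp.
  move=> u _; rewrite -EFin_Int; last exact: Intble_norm.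
  rewrite muleC -ge0_integralZl//.
  apply: ge0_le_integral => //.
  - apply: measurableT_comp => //.
    exact: (measurableT_comp mF (pair1_measurable u)).
  - by apply: measurable_funeM.
  move=> v _; rewrite /F /= lee_fin !normrM normr_id ler_wpM2l// ler_piMl//.
rewrite ge0_integralZl//; last 2 first.
- by apply: measurableT_comp.
- by rewrite lee_fin; apply: Int_ge0 => x.
by apply: lte_mul_pinfty => //; rewrite lee_fin; apply: Int_ge0 => x.
Qed.

Lemma fubini_kernel p q : Intble p -> Intble q ->
  Intble (fun x => q x * Int (fun y => k x y * p y)) /\
  Int (fun x => q x * Int (fun y => k x y * p y)) =
  Int (fun y => p y * Int (fun x => k x y * q x)).
Proof.
move=> ip iq; have iF := integrable_F ip iq.
have E1 u : (\int[lamt]_v F p q (u, v))%E =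
    (q (row_of_tuple u) * Int (fun y => k (row_of_tuple u) y * p y))%:E.
  rewrite -IntZ; last exact: Intble_kernelr.
  by rewrite -EFin_Int//; apply: IntbleZ; exact: Intble_kernelr.
have E2 v : (\int[lamt]_u F p q (u, v))%E =
    (p (row_of_tuple v) * Int (fun x => k x (row_of_tuple v) * q x))%:E.
  rewrite -IntZ; last exact: Intble_kernell.
  rewrite -EFin_Int//; last by apply: IntbleZ; exact: Intble_kernell.
  by apply: eq_integral => u _; rewrite /F /=; congr EFin; ring.
split.
  have := integrable_fubini_F iF; rewrite /fubini_F.
  by under eq_fun do rewrite E1.
rewrite {1}/Int {2}/Int /Rintegral; congr fine.
transitivity (\int[lamt]_u \int[lamt]_v F p q (u, v))%E.
  by apply: eq_integral => u _; rewrite E1.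
rewrite (Fubini iF).
by apply: eq_integral => u _; rewrite E2.
Qed.

(** Fubini gives measurability of the transform multiplied by an integrable function; the choice
    [(w x ^+ m)^-1] never vanishes and can be divided out. *)
Lemma mble_kernel p : Intble p -> mble (fun x => Int (fun y => k x y * p y)).
Proof.
move=> ip; have [/Intble_mble H _] := fubini_kernel ip (Intble_wV (m := m)).
have := mbleM (mble_continuous (@continuous_wX R m m)) H.
under eq_fun do rewrite mulrA divff ?mul1r ?expf_neq0 ?gt_eqF ?w_gt0//.
by [].
Qed.

End kernel.

Lemma measurable_dot2 : measurable_fun setT
  (fun z : m.-tuple mR * m.-tuple mR =>
    dot (row_of_tuple z.1) (row_of_tuple z.2) : R).
Proof.
rewrite /dot; apply: measurable_sum => i.
under eq_fun do rewrite !mxE.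
apply: measurable_funM.
  exact: (measurableT_comp (measurable_tnth i) measurable_fst).
exact: (measurableT_comp (measurable_tnth i) measurable_snd).
Qed.

Lemma measurable_cos_dot : measurable_fun setT
  (fun z : m.-tuple mR * m.-tuple mR =>
    cos (dot (row_of_tuple z.1) (row_of_tuple z.2)) : R).
Proof.
apply: (measurableT_comp _ measurable_dot2).
exact: (continuous_measurable_fun (@continuous_cos R)).
Qed.

Lemma measurable_sin_dot : measurable_fun setT
  (fun z : m.-tuple mR * m.-tuple mR =>
    sin (dot (row_of_tuple z.1) (row_of_tuple z.2)) : R).
Proof.
apply: (measurableT_comp _ measurable_dot2).
exact: (continuous_measurable_fun (@continuous_sin R)).
Qed.

Lemma norm_cos_le1 (a : R) : `|cos a| <= 1.
Proof. by rewrite ler_norml cos_geN1 cos_le1. Qed.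

Lemma norm_sin_le1 (a : R) : `|sin a| <= 1.
Proof. by rewrite ler_norml sin_geN1 sin_le1. Qed.

(* The Fourier transform of a real-valued [f] is [cosT f - i sinT f]. *)
Definition cosT f (xi : V) : R := Int (fun x => cos (dot xi x) * f x).
Definition sinT f (xi : V) : R := Int (fun x => sin (dot xi x) * f x).

Lemma C1_dotl (xi : V) : C1 (fun x => dot xi x) /\
  forall i, pd i (fun x => dot xi x) = fun=> xi 0 i.
Proof.
have H j : C1 (fun x : V => xi 0 j * x 0 j) by apply: C1M; [exact: C1_cst|exact: C1_coord].
split; first exact: C1_sum.
move=> i; rewrite /dot pd_sum//; apply/funext => x.
rewrite (bigD1 i)//= big1 ?addr0.
  by rewrite pdM ?pd_coord ?pd_cst ?eqxx ?mul0r ?add0r ?mulr1//;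
    [exact: C1_cst|exact: C1_coord].
move=> j ji; rewrite pdM ?pd_coord ?pd_cst; [|exact: C1_cst|exact: C1_coord].
by rewrite mul0r add0r eq_sym (negbTE ji) mulr0.
Qed.

Lemma C1_cos (xi : V) : C1 (fun x => cos (dot xi x)) /\
  forall i, pd i (fun x => cos (dot xi x)) = fun x => - sin (dot xi x) * xi 0 i.
Proof.
have [H1 H2] := C1_dotl xi.
have [H3 H4] := C1_comp (H := cos) (H' := fun a => - sin a) H1 (fun x => is_derive_cos _).
by split=> // i; rewrite H4 H2.
Qed.

Lemma C1_sin (xi : V) : C1 (fun x => sin (dot xi x)) /\
  forall i, pd i (fun x => sin (dot xi x)) = fun x => cos (dot xi x) * xi 0 i.
Proof.
have [H1 H2] := C1_dotl xi.
have [H3 H4] := C1_comp (H := sin) (H' := cos) H1 (fun x => is_derive_sin _).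
by split=> // i; rewrite H4 H2.
Qed.

Lemma dotC (x y : V) : dot x y = dot y x.
Proof. by apply: eq_bigr => i _; rewrite mulrC. Qed.

Lemma Intble_cos (xi : V) f : Intble f -> Intble (fun x => cos (dot xi x) * f x).
Proof.
move=> fi; apply: (Intble_dom _ (Intble_norm fi)).
  by apply: mbleM; [exact: (mble_continuous (C1_cos xi).1.1)|exact: Intble_mble].
by move=> x; rewrite normrM ler_piMl// norm_cos_le1.
Qed.

Lemma Intble_sin (xi : V) f : Intble f -> Intble (fun x => sin (dot xi x) * f x).
Proof.
move=> fi; apply: (Intble_dom _ (Intble_norm fi)).
  by apply: mbleM; [exact: (mble_continuous (C1_sin xi).1.1)|exact: Intble_mble].
by move=> x; rewrite normrM ler_piMl// norm_sin_le1.
Qed.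

Lemma mble_cosT f : Intble f -> mble (cosT f).
Proof.
exact: (mble_kernel measurable_cos_dot (fun x y => norm_cos_le1 (dot x y))).
Qed.

Lemma mble_sinT f : Intble f -> mble (sinT f).
Proof.
exact: (mble_kernel measurable_sin_dot (fun x y => norm_sin_le1 (dot x y))).
Qed.

(** The multiplication formula: the kernel is symmetric, so the transform moves from one factor to
    the other. *)
Lemma cosT_mul p q : Intble p -> Intble q ->
  Int (fun x => q x * cosT p x) = Int (fun y => p y * cosT q y).
Proof.
move=> ip iq.
rewrite /cosT (fubini_kernel measurable_cos_dot (fun x y => norm_cos_le1 (dot x y)) ip iq).2.
by congr Int; apply/funext => y; congr (_ * Int _); apply/funext => x; rewrite dotC.
Qed.

Lemma sinT_mul p q : Intble p -> Intble q ->
  Int (fun x => q x * sinT p x) = Int (fun y => p y * sinT q y).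
Proof.
move=> ip iq.
rewrite /sinT (fubini_kernel measurable_sin_dot (fun x y => norm_sin_le1 (dot x y)) ip iq).2.
by congr Int; apply/funext => y; congr (_ * Int _); apply/funext => x; rewrite dotC.
Qed.

Lemma norm_cosT f xi : Intble f -> `|cosT f xi| <= Int (fun x => `|f x|).
Proof.
move=> fi; apply: norm_Int_le; [exact: Intble_cos|exact: Intble_norm|].
by move=> x; rewrite normrM ler_piMl// norm_cos_le1.
Qed.

Lemma norm_sinT f xi : Intble f -> `|sinT f xi| <= Int (fun x => `|f x|).
Proof.
move=> fi; apply: norm_Int_le; [exact: Intble_sin|exact: Intble_norm|].
by move=> x; rewrite normrM ler_piMl// norm_sin_le1.
Qed.

Lemma cosTD f g xi : Intble f -> Intble g ->
  cosT (fun x => f x + g x) xi = cosT f xi + cosT g xi.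
Proof.
move=> fi gi; rewrite /cosT -IntD; [|exact: Intble_cos..].
by congr Int; apply/funext => x; rewrite mulrDr.
Qed.

Lemma sinTD f g xi : Intble f -> Intble g ->
  sinT (fun x => f x + g x) xi = sinT f xi + sinT g xi.
Proof.
move=> fi gi; rewrite /sinT -IntD; [|exact: Intble_sin..].
by congr Int; apply/funext => x; rewrite mulrDr.
Qed.

Lemma cosTZ c f xi : Intble f -> cosT (fun x => c * f x) xi = c * cosT f xi.
Proof.
move=> fi; rewrite /cosT -IntZ; [|exact: Intble_cos].
by congr Int; apply/funext => x; rewrite mulrCA.
Qed.

Lemma sinTZ c f xi : Intble f -> sinT (fun x => c * f x) xi = c * sinT f xi.
Proof.
move=> fi; rewrite /sinT -IntZ; [|exact: Intble_sin].
by congr Int; apply/funext => x; rewrite mulrCA.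
Qed.

End fubini_rv.

(** * Vanishing of the integral of a partial derivative *)

Section integral_of_partial_derivative.
Context {R : realType} {m : nat}.
Local Notation V := 'rV[R]_m.
Local Notation mR := (measurableTypeR R).
Local Notation lamt := (lebesgue_tuple m).
Local Notation lam := (@lebesgue_measure R).
Local Notation e i := (delta_mx 0 i : V).
Implicit Types (f g : V -> R).

Lemma line_FTC f i (x : V) : C1 f -> continuous (pd i f) ->
  (\int[lam]_(s in `[0%R, 1%R]) (pd i f (s *: e i + x))%:E)%E =
  (f (x + e i) - f x)%:E.
Proof.
move=> [cf df] cg.
have dF (a : R) : is_derive a 1 (fun s : R => f (s *: e i + x)) (pd i f (a *: e i + x)).
  by apply/is_derive_line/derivableP.
have cF : continuous (fun s : R => f (s *: e i + x)).
  by move=> a; have [/derivable1_diffP/differentiable_continuous] := dF a.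
have cl : continuous (fun s : R => s *: e i + x).
  move=> s; apply: cvgD; last exact: cvg_cst.
  exact: scalel_continuous.
rewrite (@continuous_FTC2 _ _ (fun s : R => f (s *: e i + x)) 0 1)//.
- by rewrite scale1r scale0r add0r [x + _]addrC.
- apply: continuous_subspaceT => s.
  apply: (@continuous_comp _ _ _ (fun s : R => s *: e i + x)); first exact: cl.
  exact: cg.
- split.
  + by move=> s _; case: (dF s).
  + exact/cvg_at_right_filter/cF.
  + exact/cvg_at_left_filter/cF.
- by move=> s _; rewrite derive1E; case: (dF s).
Qed.

Let chi (s : mR) : R := \1_(`[0%R, 1%R]%classic : set mR) s.

Let chi_ge0 s : 0 <= chi s.
Proof. by rewrite /chi indicE ler0n. Qed.

Let integral_chi (h : mR -> R) :
  (\int[lam]_s (chi s * h s)%:E = \int[lam]_(s in `[0%R, 1%R]) (h s)%:E)%E.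
Proof.
rewrite [RHS]integral_mkcond; apply: eq_integral => s _.
by rewrite patchE /chi indicE; case: ifPn => _; rewrite ?mul1r ?mul0r.
Qed.

Let mchi : measurable_fun setT chi.
Proof. by apply: measurable_indic. Qed.

(* By translation invariance [Int (pd i f)] is the mean over [0 <= s <= 1] of the
   integrals of [pd i f (s e_i + x)]; exchanging the integrals gives
   [Int (f (x + e_i) - f x)], which vanishes by translation invariance again. *)
Lemma Int_pd f i : C1 f -> continuous (pd i f) -> Intble f -> Intble (pd i f) ->
  Int (pd i f) = 0.
Proof.
move=> Cf cg fi gi; set g := pd i f in cg gi *.
pose F (z : mR * m.-tuple mR) : \bar R :=
  (chi z.1 * g ((z.1 : R) *: e i + row_of_tuple z.2))%:E.
have mg : measurable_fun setT (fun z : mR * m.-tuple mR =>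
    g ((z.1 : R) *: e i + row_of_tuple z.2)).
  pose phi (z : mR * m.-tuple mR) : m.-tuple mR :=
    [tuple ((z.1 : R) * e i 0 j + tnth z.2 j : mR) | j < m].
  have mphi : measurable_fun setT phi.
    apply/measurable_fun_tnthP => j; rewrite /comp.
    under eq_fun do rewrite tnth_mktuple.
    apply: measurable_funD; first exact: measurable_funM.
    exact: (measurableT_comp (measurable_tnth j) measurable_snd).
  have := measurableT_comp (mble_continuous cg) mphi.
  congr (measurable_fun _ _); apply/funext => z /=; congr g.
  by apply/rowP => j; rewrite !mxE tnth_mktuple mxE.
have mF : measurable_fun setT F.
  apply/measurable_EFinP; apply: measurable_funM => //.
  exact: (measurableT_comp mchi measurable_fst).
have ichi : (\int[lam]_s (chi s)%:E = 1)%E.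
  transitivity (\int[lam]_s (chi s * 1)%:E)%E.
    by under [RHS]eq_integral do rewrite mulr1.
  by rewrite integral_chi integral_cst//= mul1e lebesgue_measure_itv/= lte_fin ltr01 sube0.
(* By translation invariance the slice at [s] integrates to the integral of [h]. This serves for
   |g|, to get integrability on the product, and then for [g]. *)
have Eu (h : V -> R) (s : mR) : Intble h ->
    (\int[lamt]_u (chi s * h ((s : R) *: e i + row_of_tuple u))%:E)%E =
    (Int h * chi s)%:E.
  move=> ih; rewrite -(Int_shift ((s : R) *: e i) ih) mulrC -IntZ; last exact: Intble_shift.
  rewrite -EFin_Int; last by apply: IntbleZ; exact: Intble_shift.
  by apply: eq_integral => u _; rewrite [_ *: _ + _]addrC.
have iF : (lam \x lamt)%E.-integrable setT F.
  apply/(integrable12ltyP _ _ mF).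
  rewrite (eq_integral (fun s : mR => (Int (fun x => `|g x|))%:E * (chi s)%:E)%E).
    rewrite ge0_integralZl//; last 3 first.
    - exact/measurable_EFinP.
    - by move=> s _; rewrite lee_fin.
    - by rewrite lee_fin; apply: Int_ge0 => x.
    by rewrite ichi mule1 ltry.
  move=> s _; rewrite -EFinM -Eu; last exact: Intble_norm.
  by apply: eq_integral => u _; rewrite /F /= normrM ger0_norm.
have := Fubini iF.
rewrite (eq_integral (fun s : mR => (Int g)%:E * (chi s)%:E)%E); last first.
  by move=> s _; rewrite -EFinM -Eu.
rewrite integralZl//; last first.
  apply/integrableP; split; first exact/measurable_EFinP.
  under eq_integral do rewrite gee0_abs ?lee_fin//.
  by rewrite ichi ltry.
rewrite ichi mule1 => E.
suff : (Int g)%:E = 0%E by case.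
rewrite E (eq_integral (fun u : m.-tuple mR =>
    (f (row_of_tuple u + e i) + -1 * f (row_of_tuple u))%:E)); last first.
  by move=> u _; rewrite mulN1r -line_FTC//; exact: integral_chi.
have fi' := Intble_shift (e i) fi.
rewrite (EFin_Int (f := fun x => f (x + e i) + -1 * f x)); last first.
  by apply: IntbleD => //; exact: IntbleZ.
by rewrite IntD ?IntZ ?Int_shift//; [congr EFin; ring | exact: IntbleZ].
Qed.

End integral_of_partial_derivative.

(** * Spaces of smooth functions *)

Section function_classes.
Context {R : realType} {m : nat}.
Local Notation V := 'rV[R]_m.
Implicit Types (f g : V -> R) (s : seq 'I_m) (i : 'I_m).

Definition rapid f : Prop := forall N, exists B : R, forall x, w x ^+ N * `|f x| <= B.
Definition slow f : Prop := exists N (B : R), forall x, `|f x| <= B * w x ^+ N.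

(* Real-valued functions in [S], [D_{L^1}] and [O_M]. *)
Definition rS f : Prop := smooth f /\ forall s, rapid (derivs s f).
Definition rD f : Prop := smooth f /\ forall s, Intble (derivs s f).
Definition OM f : Prop := smooth f /\ forall s, slow (derivs s f).

Lemma wX_ge1 N (x : V) : 1 <= w x ^+ N.
Proof. by rewrite exprn_ege1// w_ge1. Qed.

Lemma wX_ge0 N (x : V) : 0 <= w x ^+ N.
Proof. exact: le_trans ler01 (wX_ge1 N x). Qed.

Lemma rapidD f g : rapid f -> rapid g -> rapid (fun x => f x + g x).
Proof.
move=> rf rg N; have [B HB] := rf N; have [B' HB'] := rg N.
exists (B + B') => x; apply: le_trans (lerD (HB x) (HB' x)).
by rewrite -mulrDr ler_wpM2l ?wX_ge0// ler_normD.
Qed.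

Lemma slow_rapid f g : slow f -> rapid g -> rapid (fun x => f x * g x).
Proof.
move=> [M [C HC]] rg N; have [B HB] := rg (M + N)%N.
exists (C * B) => x; rewrite normrM.
have C0 : 0 <= C.
  by have := le_trans (normr_ge0 _) (HC x); rewrite pmulr_lge0// (lt_le_trans ltr01 (wX_ge1 M x)).
apply: (@le_trans _ _ (w x ^+ N * (C * w x ^+ M * `|g x|))).
  by apply: ler_wpM2l; [exact: wX_ge0|apply: ler_wpM2r].
rewrite (_ : _ * _ = C * (w x ^+ (M + N) * `|g x|)); first exact: ler_wpM2l.
by rewrite exprD; ring.
Qed.

Lemma rapid0 : rapid (fun=> 0).
Proof. by move=> N; exists 0 => x; rewrite normr0 mulr0. Qed.

Lemma rapid_sum (I : Type) (r : seq I) (F : I -> V -> R) :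
  (forall k, rapid (F k)) -> rapid (fun x => \sum_(k <- r) F k x).
Proof.
move=> CF; elim: r => [|k r IH].
  under eq_fun do rewrite big_nil; exact: rapid0.
by under eq_fun do rewrite big_cons; exact: rapidD.
Qed.

Lemma slow_le f : slow f -> exists N (B : R), 0 <= B /\ forall x, `|f x| <= B * w x ^+ N.
Proof.
move=> [N [B HB]]; exists N, B; split=> //.
by have := le_trans (normr_ge0 _) (HB 0); rewrite pmulr_lge0// (lt_le_trans ltr01 (wX_ge1 N 0)).
Qed.

Lemma slow_cst (c : R) : slow (fun=> c).
Proof. by exists 0, `|c| => x; rewrite expr0 mulr1. Qed.

Lemma slowM f g : slow f -> slow g -> slow (fun x => f x * g x).
Proof.
move=> /slow_le[N [B [B0 HB]]] /slow_le[N' [B' [B0' HB']]].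
exists (N + N')%N, (B * B') => x; rewrite normrM exprD mulrACA.
exact: ler_pM.
Qed.

Lemma slowD f g : slow f -> slow g -> slow (fun x => f x + g x).
Proof.
move=> /slow_le[N [B [B0 HB]]] /slow_le[N' [B' [B0' HB']]].
exists (N + N')%N, (B + B') => x; apply: (le_trans (ler_normD _ _)).
rewrite mulrDl exprD; apply: lerD.
  apply: (le_trans (HB x)); apply: ler_wpM2l => //.
  by rewrite ler_peMr ?wX_ge1 ?wX_ge0.
apply: (le_trans (HB' x)); apply: ler_wpM2l => //.
by rewrite ler_peMl ?wX_ge1 ?wX_ge0.
Qed.

Lemma slow_sum (I : Type) (r : seq I) (F : I -> V -> R) :
  (forall k, slow (F k)) -> slow (fun x => \sum_(k <- r) F k x).
Proof.
move=> CF; elim: r => [|k r IH].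
  under eq_fun do rewrite big_nil; exact: slow_cst.
by under eq_fun do rewrite big_cons; exact: slowD.
Qed.

Lemma slow_coord i : slow (fun x : V => x 0 i).
Proof. by exists 1, 1 => x; rewrite mul1r expr1 norm_coord_le_w. Qed.

Lemma OM_pd f i : OM f -> OM (pd i f).
Proof.
move=> [sf bf]; split; first exact: smooth_pd.
by move=> s; rewrite -derivs_rcons.
Qed.

Lemma OMD f g : OM f -> OM g -> OM (fun x => f x + g x).
Proof.
move=> [sf bf] [sg bg]; split; first exact: smoothD.
by move=> s; rewrite derivsD//; exact: slowD.
Qed.

Lemma OMM f g : OM f -> OM g -> OM (fun x => f x * g x).
Proof.
move=> [sf bf] [sg bg]; split; first exact: smoothM.
by move=> s; rewrite derivsM//; apply: slow_sum => p; exact: slowM.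
Qed.

Lemma OM_cst (c : R) : OM (fun=> c).
Proof.
split; first exact: smooth_cst.
by move=> s; have [c' ->] := derivs_cst s c; exact: slow_cst.
Qed.

Lemma OM_coord i : OM (fun x : V => x 0 i).
Proof.
split; first exact: smooth_coord.
move=> s; case/lastP: s => [|s j]; first exact: slow_coord.
rewrite derivs_rcons pd_coord.
by have [c' ->] := derivs_cst s ((j == i)%:R : R); exact: slow_cst.
Qed.

Lemma OM_sum (I : Type) (r : seq I) (F : I -> V -> R) :
  (forall k, OM (F k)) -> OM (fun x => \sum_(k <- r) F k x).
Proof.
move=> CF; elim: r => [|k r IH].
  under eq_fun do rewrite big_nil; exact: OM_cst.
by under eq_fun do rewrite big_cons; exact: OMD.
Qed.

Lemma OM_dot : OM (fun x : V => dot x x).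
Proof. by apply: OM_sum => i; apply: OMM; exact: OM_coord. Qed.

Lemma OM_w : OM w.
Proof. exact: OMD (OM_cst 1) OM_dot. Qed.

Lemma OM_wX N : OM (fun x => w x ^+ N).
Proof.
elim: N => [|N IH]; first exact: OM_cst.
by under eq_fun do rewrite exprS; exact: OMM OM_w IH.
Qed.

Lemma OM_rS f g : OM f -> rS g -> rS (fun x => f x * g x).
Proof.
move=> [sf bf] [sg bg]; split; first exact: smoothM.
by move=> s; rewrite derivsM//; apply: rapid_sum => p; exact: slow_rapid.
Qed.

Lemma rSZ (c : R) f : rS f -> rS (fun x => c * f x).
Proof. exact: OM_rS (OM_cst c). Qed.

Lemma rSD f g : rS f -> rS g -> rS (fun x => f x + g x).
Proof.
move=> [sf bf] [sg bg]; split; first exact: smoothD.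
by move=> s; rewrite derivsD//; exact: rapidD.
Qed.

Lemma rS_pd f i : rS f -> rS (pd i f).
Proof.
move=> [sf bf]; split; first exact: smooth_pd.
by move=> s; rewrite -derivs_rcons.
Qed.

Lemma rapid_bound f N (B : R) : (forall x, w x ^+ N * `|f x| <= B) ->
  forall x, `|f x| <= B * (w x ^+ N)^-1.
Proof.
move=> HB x; rewrite ler_pdivlMr ?(lt_le_trans ltr01 (wX_ge1 N x))//.
by rewrite mulrC.
Qed.

Lemma rapid_Intble f : continuous f -> rapid f -> Intble f.
Proof.
move=> cf /(_ m)[B /rapid_bound HB].
exact: (Intble_dom (mble_continuous cf) (IntbleZ B Intble_wV) HB).
Qed.

Lemma rS_rD f : rS f -> rD f.
Proof.
move=> [sf bf]; split=> // s; apply: rapid_Intble => //.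
exact: (sf s).1.
Qed.

Lemma rS_Intble f : rS f -> Intble f.
Proof. by move=> /rS_rD[_ /(_ [::])]. Qed.

Lemma rD_Intble f : rD f -> Intble f.
Proof. by move=> [_ /(_ [::])]. Qed.

Lemma rD_pd f i : rD f -> rD (pd i f).
Proof.
move=> [sf bf]; split; first exact: smooth_pd.
by move=> s; rewrite -derivs_rcons.
Qed.

Lemma Int_pd_rD f i : rD f -> Int (pd i f) = 0.
Proof.
move=> [sf bf]; apply: Int_pd; first exact: smooth_C1.
- exact: (sf [:: i]).1.
- exact: (bf [::]).
- exact: (bf [:: i]).
Qed.

Lemma Int_by_parts f g i : OM f -> rS g ->
  Int (fun x => f x * pd i g x) = - Int (fun x => pd i f x * g x).
Proof.
move=> Of Sg; have Sfg := OM_rS Of Sg.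
have := Int_pd_rD i (rS_rD Sfg).
rewrite pdM; [|exact: smooth_C1 Of.1|exact: smooth_C1 Sg.1].
rewrite IntD; last 2 first.
- exact: rS_Intble (OM_rS (OM_pd i Of) Sg).
- exact: rS_Intble (OM_rS Of (rS_pd i Sg)).
by move/eqP; rewrite addrC addr_eq0 => /eqP.
Qed.

(** The integral of the partial derivative of x |-> cos(xi . x) f(x) vanishes, and the product rule
    splits it into the two transforms. *)
Lemma cosT_pd f i (xi : V) : rD f -> cosT (pd i f) xi = xi 0 i * sinT f xi.
Proof.
move=> Df; have [C1c pdc] := C1_cos xi.
have C1f := smooth_C1 Df.1; have fi := rD_Intble Df.
have E : pd i (fun x => cos (dot xi x) * f x) =
  fun x => - xi 0 i * (sin (dot xi x) * f x) + cos (dot xi x) * pd i f x.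
  by rewrite pdM// pdc; apply/funext => x; ring.
have := @Int_pd _ _ (fun x => cos (dot xi x) * f x) i.
rewrite E IntD ?IntZ; [|exact: Intble_sin|exact/IntbleZ/Intble_sin|].
  move=> H; apply/eqP; rewrite -subr_eq0; apply/eqP.
  rewrite -[RHS]H; first by rewrite /cosT /sinT; ring.
  - exact: C1M.
  - exact: (C1D (C1M (C1_cst _) (C1M (C1_sin xi).1 C1f))
      (C1M C1c (smooth_C1 (smooth_pd i Df.1)))).1.
  - exact: Intble_cos.
  - apply: IntbleD; first exact/IntbleZ/Intble_sin.
    exact: Intble_cos (rD_Intble (rD_pd i Df)).
exact: Intble_cos (rD_Intble (rD_pd i Df)).
Qed.

Lemma sinT_pd f i (xi : V) : rD f -> sinT (pd i f) xi = - xi 0 i * cosT f xi.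
Proof.
move=> Df; have [C1c pdc] := C1_sin xi.
have C1f := smooth_C1 Df.1; have fi := rD_Intble Df.
have E : pd i (fun x => sin (dot xi x) * f x) =
  fun x => xi 0 i * (cos (dot xi x) * f x) + sin (dot xi x) * pd i f x.
  by rewrite pdM// pdc; apply/funext => x; ring.
have := @Int_pd _ _ (fun x => sin (dot xi x) * f x) i.
rewrite E IntD ?IntZ; [|exact: Intble_cos|exact/IntbleZ/Intble_cos|].
  move=> H; apply/eqP; rewrite -subr_eq0; apply/eqP.
  rewrite -[RHS]H; first by rewrite /cosT /sinT; ring.
  - exact: C1M.
  - exact: (C1D (C1M (C1_cst _) (C1M (C1_cos xi).1 C1f))
      (C1M C1c (smooth_C1 (smooth_pd i Df.1)))).1.
  - exact: Intble_sin.
  - apply: IntbleD; first exact/IntbleZ/Intble_cos.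
    exact: Intble_sin (rD_Intble (rD_pd i Df)).
exact: Intble_sin (rD_Intble (rD_pd i Df)).
Qed.

(** One induction treats both transforms, because each integration by parts exchanges [cosT] and
    [sinT]. *)
Lemma coordX_cosT_sinT k f i (xi : V) : rD f ->
  `|xi 0 i| ^+ k * `|cosT f xi| <= Int (fun x => `|derivs (nseq k i) f x|) /\
  `|xi 0 i| ^+ k * `|sinT f xi| <= Int (fun x => `|derivs (nseq k i) f x|).
Proof.
elim: k f => [|k IH] f Df.
  rewrite expr0 !mul1r; split; [apply: norm_cosT|apply: norm_sinT]; exact: rD_Intble.
have -> : derivs (nseq k.+1 i) f = derivs (nseq k i) (pd i f).
  by rewrite -derivs_rcons; congr (derivs _ f); elim: (k) => //= n ->.
have [H1 H2] := IH _ (rD_pd i Df).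
rewrite exprSr -!mulrA -!normrM -cosT_pd//.
by rewrite -[xi 0 i * cosT f xi]opprK -mulNr -sinT_pd// normrN.
Qed.

Definition nrm N f : R :=
  \sum_(k < N.+1) \sum_(s : k.-tuple 'I_m) Int (fun x => `|derivs s f x|).

Lemma Int_derivs_le_nrm N s f : (size s <= N)%N ->
  Int (fun x => `|derivs s f x|) <= nrm N f.
Proof.
move=> sN; have Hk : (size s < N.+1)%N by [].
rewrite /nrm (bigD1 (Ordinal Hk))//= (bigD1 (in_tuple s))//= -addrA lerDl.
by rewrite addr_ge0// ?sumr_ge0// => *; rewrite ?sumr_ge0// => *; apply: Int_ge0.
Qed.

Lemma w_le_sqr (x : V) (c : R) : 1 <= c -> (forall j, `|x 0 j| ^+ 2 <= c) ->
  w x <= m.+1%:R * c.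
Proof.
move=> c1 Hc; rewrite /w -natr1 mulrDl mul1r addrC lerD//.
have -> : m%:R * c = \sum_(i < m) c by rewrite sumr_const card_ord mulr_natl.
by apply: ler_sum => i _; rewrite -expr2 -[_ ^+ 2]ger0_norm ?sqr_ge0// normrX.
Qed.

(** Comparison with the largest coordinate: a power of [w] is dominated by a power of a single
    coordinate, so repeated derivatives in one direction control the decay of a transform. *)
Lemma w_le_coord (x : V) :
  w x <= m.+1%:R \/ exists i, w x <= m.+1%:R * `|x 0 i| ^+ 2.
Proof.
case: (pselect (exists i : 'I_m, 1 < `|x 0 i|)) => [[i0 H0]|H]; [right|left].
  have [i Hi] : exists i : 'I_m, forall j, `|x 0 j| <= `|x 0 i|.
    case: (@arg_maxP _ _ _ i0 xpredT (fun j => `|x 0 j|)) => // i _ Hi.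
    by exists i => j; exact: Hi.
  exists i; apply: w_le_sqr => [|j]; last by rewrite lerXn2r ?nnegrE.
  by rewrite exprn_ege1// (le_trans (ltW H0)).
rewrite -[leRHS]mulr1; apply: w_le_sqr => // j.
rewrite expr_le1//; case: leP => // H1; exfalso; apply: H; by exists j.
Qed.

(** [T] stands for the absolute value of either transform at [xi]. Since [w] has degree two,
    [w ^+ N] costs 2N derivatives. *)
Lemma wX_le_nrm N f (xi : V) (T : R) : 0 <= T ->
  (forall k i, `|xi 0 i| ^+ k * T <= Int (fun x => `|derivs (nseq k i) f x|)) ->
  T <= Int (fun x => `|f x|) ->
  w xi ^+ N * T <= m.+1%:R ^+ N * nrm (2 * N) f.
Proof.
move=> T0 HT H0; have w0 := ltW (w_gt0 xi).
case: (w_le_coord xi) => [H|[i H]].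
  apply: ler_pM => //; first exact: wX_ge0.
    by rewrite lerXn2r ?nnegrE.
  by apply: (le_trans H0); exact: (@Int_derivs_le_nrm _ [::]).
apply: (@le_trans _ _ ((m.+1%:R * `|xi 0 i| ^+ 2) ^+ N * T)).
  by rewrite ler_wpM2r// lerXn2r ?nnegrE// mulr_ge0// sqr_ge0.
rewrite exprMn -exprM -mulrA ler_wpM2l ?exprn_ge0//.
apply: (le_trans (HT _ _)); apply: Int_derivs_le_nrm.
by rewrite size_nseq.
Qed.

Lemma wX_cosT N f (xi : V) : rD f ->
  w xi ^+ N * `|cosT f xi| <= m.+1%:R ^+ N * nrm (2 * N) f.
Proof.
move=> Df; apply: wX_le_nrm => // [k i|]; first exact: (coordX_cosT_sinT k i xi Df).1.
exact/norm_cosT/rD_Intble.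
Qed.

Lemma wX_sinT N f (xi : V) : rD f ->
  w xi ^+ N * `|sinT f xi| <= m.+1%:R ^+ N * nrm (2 * N) f.
Proof.
move=> Df; apply: wX_le_nrm => // [k i|]; first exact: (coordX_cosT_sinT k i xi Df).2.
exact/norm_sinT/rD_Intble.
Qed.

Lemma rapid_cosT f : rD f -> rapid (cosT f).
Proof. by move=> Df N; eexists => x; exact: wX_cosT. Qed.

Lemma rapid_sinT f : rD f -> rapid (sinT f).
Proof. by move=> Df N; eexists => x; exact: wX_sinT. Qed.

End function_classes.

(** * Mean value and Taylor estimates in one variable *)

Section one_variable_estimates.
Context {R : realType}.

Lemma MVT_norm (F dF : R -> R) (a b K : R) :
  (forall x : R, is_derive x 1 F (dF x)) ->
  (forall c, `|c - a| <= `|b - a| -> `|dF c| <= K) ->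
  `|F b - F a| <= K * `|b - a|.
Proof.
move=> HF HK.
have cF : continuous F.
  by move=> x; have [/derivable1_diffP/differentiable_continuous] := HF x.
have [ab|/ltW ba] := leP a b.
  have [c] := MVT_segment ab (fun x _ => HF x) (continuous_subspaceT cF).
  rewrite in_itv/= => /andP[ac cb] ->; rewrite normrM ler_wpM2r//.
  by apply: HK; rewrite !ger0_norm ?subr_ge0// lerD2r.
have [c] := MVT_segment ba (fun x _ => HF x) (continuous_subspaceT cF).
rewrite in_itv/= => /andP[bc ca] E.
rewrite distrC E normrM [`|b - a|]distrC ler_wpM2r//.
by apply: HK; rewrite [leLHS]distrC [leRHS]distrC !ger0_norm ?subr_ge0// lerD2l lerN2.
Qed.

(** Mean value theorem for x |-> F x - dF a x, whose derivative dF x - dF a is at most |u| in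
    absolute value within distance |u| of a. *)
Lemma taylor1_norm (F dF : R -> R) (a u : R) :
  (forall x : R, is_derive x 1 F (dF x)) ->
  (forall x y, `|dF x - dF y| <= `|x - y|) ->
  `|F (a + u) - F a - u * dF a| <= u ^+ 2.
Proof.
move=> HF HL.
pose H x := F x + (- dF a) * x.
have dH (x : R) : is_derive x 1 H (dF x - dF a).
  have := is_deriveD (HF x) (is_deriveM (is_derive_cst (- dF a) x 1) (is_derive_id x 1)).
  move=> H0; apply: (is_derive_eq H0).
  by rewrite scaler0 addr0 /GRing.scale/= mulr1.
have := @MVT_norm H _ a (a + u) `|u| dH.
have -> : a + u - a = u by ring.
have -> : H (a + u) - H a = F (a + u) - F a - u * dF a by rewrite /H; ring.
rewrite -normrM -expr2 ger0_norm ?sqr_ge0//; apply => c Hc.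
exact: le_trans (HL _ _) Hc.
Qed.

Lemma lipschitz_sin (x y : R) : `|sin x - sin y| <= `|x - y|.
Proof.
rewrite -[leRHS]mul1r; apply: MVT_norm => // c _.
by rewrite ler_norml cos_geN1 cos_le1.
Qed.

Lemma lipschitz_cos (x y : R) : `|cos x - cos y| <= `|x - y|.
Proof.
rewrite -[leRHS]mul1r; apply: MVT_norm => // c _.
by rewrite normrN ler_norml sin_geN1 sin_le1.
Qed.

End one_variable_estimates.

(** * Differentiation of the transforms *)

Section transform_derivatives.
Context {R : realType} {m : nat}.
Local Notation V := 'rV[R]_m.
Local Notation e i := (delta_mx 0 i : V).
Implicit Types (f g : V -> R) (i : 'I_m).

Lemma dotDl (x y z : V) : dot (x + y) z = dot x z + dot y z.
Proof. by rewrite /dot -big_split/=; apply: eq_bigr => i _; rewrite mxE mulrDl. Qed.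

Lemma dotZl (a : R) (x z : V) : dot (a *: x) z = a * dot x z.
Proof. by rewrite /dot mulr_sumr; apply: eq_bigr => i _; rewrite mxE mulrA. Qed.

Lemma dot_delta i (z : V) : dot (e i) z = z 0 i.
Proof.
rewrite /dot (bigD1 i)//= mxE !eqxx mul1r big1 ?addr0// => j ji.
by rewrite mxE (negbTE ji) andbF mul0r.
Qed.

Lemma dot0l (z : V) : dot 0 z = 0.
Proof. by rewrite /dot big1// => i _; rewrite mxE mul0r. Qed.

Lemma IntbleB f g : Intble f -> Intble g -> Intble (fun x => f x - g x).
Proof. exact: integrableB. Qed.

Lemma IntB f g : Intble f -> Intble g ->
  Int (fun x => f x - g x) = Int f - Int g.
Proof. exact: RintegralB. Qed.

Lemma norm_coord_le_norm (x y : V) i : `|x 0 i - y 0 i| <= `|x - y|.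
Proof.
rewrite [leRHS]mx_normrE.
have := @le_bigmax _ _ _ 0 (fun ij : 'I_1 * 'I_m => `|(x - y) ij.1 ij.2|) (0, i).
by rewrite /= !mxE.
Qed.

Section kernel_transform.
Variables (phi dphi : R -> R).
Hypothesis dphiP : forall a : R, is_derive a 1 phi (dphi a).
Hypothesis phi1 : forall a, `|phi a| <= 1.
Hypothesis dphi1 : forall a, `|dphi a| <= 1.
Hypothesis lip : forall a b, `|dphi a - dphi b| <= `|a - b|.

Let T (psi : R -> R) f (xi : V) : R := Int (fun x => psi (dot xi x) * f x).

Let lip_phi a b : `|phi a - phi b| <= `|a - b|.
Proof. by rewrite -[leRHS]mul1r; apply: (MVT_norm dphiP). Qed.

Let continuous_bounded_Intble (psi : R -> R) f xi : continuous psi ->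
  (forall a, `|psi a| <= 1) -> Intble f -> Intble (fun x => psi (dot xi x) * f x).
Proof.
move=> cpsi psi1 fi; apply: (Intble_dom _ (Intble_norm fi)).
  apply: mbleM; last exact: Intble_mble.
  apply: mble_continuous => x; apply: continuous_comp; last exact: cpsi.
  exact: (C1_dotl xi).1.1.
by move=> x; rewrite normrM ler_piMl.
Qed.

Let cphi : continuous phi.
Proof. by move=> a; have [/derivable1_diffP/differentiable_continuous] := dphiP a. Qed.

Let cdphi : continuous dphi.
Proof.
move=> a; apply/cvgrPdist_lt => ep ep0; near=> b.
apply: (le_lt_trans (lip _ _)); near: b.
exact: cvgr_dist_lt.
Unshelve. all: by end_near. Qed.

(** Differentiation under the integral with an explicit rate: the Taylor estimate for [phi] bounds
    the error of the difference quotient by |h| times the integral of x_i^2 |f|. Continuity comes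
    likewise from the Lipschitz bound on [phi] and the first moments. *)
Lemma C1_kernel_transform f : Intble f ->
  (forall i, Intble (fun x => x 0 i * f x)) ->
  (forall i, Intble (fun x => x 0 i * (x 0 i * f x))) ->
  C1 (T phi f) /\ forall i, pd i (T phi f) = T dphi (fun x => x 0 i * f x).
Proof.
move=> fi f1 f2; apply: C1_pdI => [xi|i xi].
  pose K := \sum_(i < m) Int (fun x => `|x 0 i * f x|).
  have K0 : 0 <= K by apply: sumr_ge0 => i _; exact: Int_ge0.
  apply/(@cvgrPdist_lt _ _ _ (nbhs xi)) => ep ep0.
  (* [K + 1] instead of [K] avoids a zero denominator when the first moments vanish. *)
  have epK : 0 < ep / (K + 1) by rewrite divr_gt0// ltr_wpDl.
  near=> eta.
  have H : `|T phi f xi - T phi f eta| <=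
      \sum_(i < m) `|xi 0 i - eta 0 i| * Int (fun x => `|x 0 i * f x|).
    have i1 i : Intble (fun x => `|xi 0 i - eta 0 i| * `|x 0 i * f x|).
      exact/IntbleZ/Intble_norm.
    rewrite [leRHS](_ : _ = Int (fun x => \sum_(i < m) `|xi 0 i - eta 0 i| * `|x 0 i * f x|)).
      have j1 := continuous_bounded_Intble xi cphi phi1 fi.
      have j2 := continuous_bounded_Intble eta cphi phi1 fi.
      rewrite /T -IntB//; apply: norm_Int_le => [| |x].
      - exact: IntbleB.
      - exact: Intble_sum.
      rewrite -mulrBl normrM.
      under eq_bigr do rewrite normrM mulrA.
      rewrite -mulr_suml ler_wpM2r//.
      apply: (le_trans (lip_phi _ _)).
      rewrite /dot -sumrB; apply: (le_trans (ler_norm_sum _ _ _)).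
      by apply: ler_sum => i _; rewrite -mulrBl normrM.
    rewrite Int_sum//; apply: eq_bigr => i _; rewrite IntZ//.
    exact: Intble_norm.
  apply: (le_lt_trans H); apply: (@le_lt_trans _ _ (`|xi - eta| * (K + 1))).
    apply: (@le_trans _ _ (`|xi - eta| * K)); last by rewrite ler_wpM2l// lerDl.
    rewrite mulr_sumr; apply: ler_sum => i _; rewrite ler_wpM2r ?Int_ge0//.
    exact: norm_coord_le_norm.
  rewrite -ltr_pdivlMr ?ltr_wpDl//; near: eta.
set L := T dphi _ xi.
have H : (fun h : R => h^-1 *: ((T phi f \o shift xi) (h *: e i) - T phi f xi))
    @ 0^' --> L.
  pose K := Int (fun x => `|x 0 i * (x 0 i * f x)|).
  have K0 : 0 <= K by apply: Int_ge0.
  apply/cvgrPdist_le => ep ep0; near=> h.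
  have h0 : h != 0 by near: h; exact: nbhs_dnbhs_neq.
  apply: (@le_trans _ _ (`|h| * K)).
    have j1 := continuous_bounded_Intble xi cphi phi1 fi.
    have j2 := continuous_bounded_Intble (h *: e i + xi) cphi phi1 fi.
    have j3 := continuous_bounded_Intble xi cdphi dphi1 (f1 i).
    have j4 := IntbleB j2 j1.
    have j5 := IntbleB j4 (IntbleZ h j3).
    have -> : L - h^-1 *: (T phi f (h *: e i + xi) - T phi f xi) =
       - h^-1 * Int (fun x => phi (dot (h *: e i + xi) x) * f x -
        (phi (dot xi x) * f x) - h * (dphi (dot xi x) * (x 0 i * f x))).
      rewrite (IntB j4 (IntbleZ h j3)) (IntB j2 j1) (IntZ h j3).
      rewrite -/(T phi f (h *: e i + xi)) -/(T phi f xi).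
      by rewrite -/(T dphi (fun x => x 0 i * f x) xi) -/L /GRing.scale/=; field.
    rewrite normrM normrN normfV ler_pdivrMl ?normr_gt0// mulrA -normrM -expr2.
    rewrite [`|h ^+ 2|]ger0_norm ?sqr_ge0// /K -IntZ; last exact: Intble_norm.
    apply: norm_Int_le => // [|x]; first exact/IntbleZ/Intble_norm.
    rewrite dotDl dotZl dot_delta.
    have -> : phi (h * x 0 i + dot xi x) * f x - phi (dot xi x) * f x -
      h * (dphi (dot xi x) * (x 0 i * f x)) =
      (phi (dot xi x + h * x 0 i) - phi (dot xi x) - (h * x 0 i) * dphi (dot xi x)) * f x.
      by rewrite [dot xi x + _]addrC; ring.
    rewrite mulrA normrM -expr2 [`|x 0 i ^+ 2 * f x|]normrM mulrA ler_wpM2r//.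
    rewrite [`|x 0 i ^+ 2|]ger0_norm ?sqr_ge0// -exprMn.
    exact: taylor1_norm.
  apply: (@le_trans _ _ (`|h| * (K + 1))); first by rewrite ler_wpM2l// lerDl.
  rewrite -ler_pdivlMr ?ltr_wpDl//; apply: ltW; near: h.
  by apply: dnbhs0_lt; rewrite divr_gt0// ltr_wpDl.
by split; [exact: (cvgP _ H)|exact: (cvg_lim _ H)].
Unshelve. all: by end_near. Qed.

End kernel_transform.

Lemma C1_cosT f : Intble f -> (forall i, Intble (fun x => x 0 i * f x)) ->
  (forall i, Intble (fun x => x 0 i * (x 0 i * f x))) ->
  C1 (cosT f) /\ forall i, pd i (cosT f) = fun xi => - sinT (fun x => x 0 i * f x) xi.
Proof.
move=> f0 f1 f2.
have [] := C1_kernel_transform (phi := cos) (dphi := fun a => - sin a)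
  (fun a => is_derive_cos a) norm_cos_le1 _ _ f0 f1 f2.
- by move=> a; rewrite normrN norm_sin_le1.
- by move=> a b; rewrite -opprD normrN lipschitz_sin.
move=> Cc Hpd; split=> // i; rewrite Hpd; apply/funext => xi.
rewrite /sinT -[RHS]mulN1r -IntZ; last exact: Intble_sin.
by congr Int; apply/funext => x; ring.
Qed.

Lemma C1_sinT f : Intble f -> (forall i, Intble (fun x => x 0 i * f x)) ->
  (forall i, Intble (fun x => x 0 i * (x 0 i * f x))) ->
  C1 (sinT f) /\ forall i, pd i (sinT f) = cosT (fun x => x 0 i * f x).
Proof.
exact: (C1_kernel_transform (phi := sin) (dphi := cos)
  (fun a => is_derive_sin a) norm_sin_le1 norm_cos_le1 (@lipschitz_cos R)).
Qed.

Lemma rS_coord i f : rS f -> rS (fun x => x 0 i * f x).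
Proof. exact: OM_rS (OM_coord i). Qed.

(** The sign is kept under the transform, so that the derivative is literally a [sinT] of a function
    of $S$. *)
Lemma pd_cosT f i : rS f -> pd i (cosT f) = sinT (fun x => -1 * (x 0 i * f x)).
Proof.
move=> Sf; have H j := rS_Intble (rS_coord j Sf).
rewrite (C1_cosT (rS_Intble Sf) H _).2 => [|j]; last exact/rS_Intble/rS_coord/rS_coord.
by apply/funext => xi; rewrite sinTZ// mulN1r.
Qed.

Lemma pd_sinT f i : rS f -> pd i (sinT f) = cosT (fun x => x 0 i * f x).
Proof.
move=> Sf; have H j := rS_Intble (rS_coord j Sf).
by rewrite (C1_sinT (rS_Intble Sf) H _).2 => [//|j]; exact/rS_Intble/rS_coord/rS_coord.
Qed.

(** The functions [cosT g] and [sinT g] with [g] in $S$ form together a class stable under partial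
    derivatives, which multiply [g] by a coordinate up to sign. Its members decay rapidly because
    all derivatives of [g] are integrable. *)
Lemma rS_cosT_sinT f : rS f -> rS (cosT f) /\ rS (sinT f).
Proof.
pose P h := exists2 g : V -> R, rS g & h = cosT g \/ h = sinT g.
have HP h : P h -> C1 h /\ forall i, P (pd i h).
  move=> [g Sg hE].
  have H j := rS_Intble (rS_coord j Sg).
  have H2 j := rS_Intble (rS_coord j (rS_coord j Sg)).
  case: hE => ->; split.
  - exact: (C1_cosT (rS_Intble Sg) H H2).1.
  - move=> i; exists (fun x : V => -1 * (x 0 i * g x)); last by right; exact: pd_cosT.
    exact/rSZ/rS_coord.
  - exact: (C1_sinT (rS_Intble Sg) H H2).1.
  - move=> i; exists (fun x : V => x 0 i * g x); first exact: rS_coord.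
    by left; exact: pd_sinT.
have PrS h : P h -> rS h.
  move=> Ph; have [sh Psh] := smooth_ind HP Ph; split=> // s.
  have [g Sg [] ->] := Psh s; [apply: rapid_cosT|apply: rapid_sinT]; exact: rS_rD.
by move=> Sf; split; apply: PrS; exists f => //; [left|right].
Qed.

Lemma rS_cosT f : rS f -> rS (cosT f).
Proof. by case/rS_cosT_sinT. Qed.

Lemma rS_sinT f : rS f -> rS (sinT f).
Proof. by case/rS_cosT_sinT. Qed.

Lemma C1_line_norm f i (x : V) (h L : R) : C1 f ->
  (forall y, `|pd i f y| <= L) -> `|f (h *: e i + x) - f x| <= L * `|h|.
Proof.
move=> [_ df] HL.
have := @MVT_norm R (fun s : R => f (s *: e i + x)) (fun s => pd i f (s *: e i + x)) 0 h L.
rewrite scale0r add0r subr0; apply => [s|c _]; last exact: HL.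
by apply/is_derive_line/derivableP.
Qed.

(** The coordinates are moved from [x] to [y] one at a time, each by a mean value estimate along its
    axis. *)
Lemma C1_lipschitz f (L : 'I_m -> R) (x y : V) : C1 f ->
  (forall i z, `|pd i f z| <= L i) ->
  `|f y - f x| <= \sum_i L i * `|y 0 i - x 0 i|.
Proof.
move=> Cf HL.
have H (r : seq 'I_m) : `|f (\sum_(i <- r) (y 0 i - x 0 i) *: e i + x) - f x| <=
    \sum_(i <- r) L i * `|y 0 i - x 0 i|.
  elim: r => [|i r IH]; first by rewrite !big_nil add0r subrr normr0.
  rewrite !big_cons -addrA.
  set z := (\sum_(j <- r) _ + x).
  rewrite (_ : f _ - f x = (f ((y 0 i - x 0 i) *: e i + z) - f z) + (f z - f x)); last by ring.
  apply: (le_trans (ler_normD _ _)); apply: lerD => //.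
  exact: C1_line_norm.
have := H (index_enum 'I_m).
by rewrite (_ : \sum_(i <- _) _ + x = y)// -[RHS](addrNK x); congr (_ + _);
  rewrite [RHS]row_sum_delta; apply: eq_bigr => i _; rewrite !mxE.
Qed.

Lemma C1_pd0_cst f (x y : V) : C1 f -> (forall i z, pd i f z = 0) -> f y = f x.
Proof.
move=> Cf H0; apply/eqP; rewrite -subr_eq0 -normr_le0.
have := @C1_lipschitz f (fun=> 0) x y Cf.
under eq_bigr do rewrite mul0r.
by rewrite big1//; apply => i z; rewrite H0 normr0.
Qed.

End transform_derivatives.

(** * Gaussians and Fourier inversion *)

Lemma is_derive_expRM {R : realType} (c u : R) :
  is_derive u 1 (fun u => expR (c * u)) (c * expR (c * u)).
Proof.
rewrite (_ : (fun u => _) = expR \o (fun u => u * c + 0)); last first.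
  by apply/funext => v /=; rewrite addr0 mulrC.
rewrite (_ : c * expR _ = expR (u * c + 0) * c); last by rewrite addr0 mulrC [u * c]mulrC.
exact: (is_derive1_comp (is_derive_expR _) (is_derive_affine u c 0)).
Qed.

Section gaussian.
Context {R : realType} {m : nat}.
Local Notation V := 'rV[R]_m.
Implicit Types (f g : V -> R) (i : 'I_m) (a b : R).

Definition gauss a (x : V) : R := expR (- a * dot x x).

Lemma gauss_gt0 a x : 0 < gauss a x.
Proof. exact: expR_gt0. Qed.

Lemma gauss_ge0 a x : 0 <= gauss a x.
Proof. exact: expR_ge0. Qed.

Lemma pd_dot i : pd i (fun x : V => dot x x) = fun x => 2 * x 0 i.
Proof.
rewrite /dot pd_sum => [|j]; last by apply: C1M; exact: C1_coord.
apply/funext => x; rewrite (bigD1 i)//= big1 ?addr0 => [|j ji].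
  by rewrite (pdM i (C1_coord i) (C1_coord i)) pd_coord eqxx mul1r mulr1 mulrDl mul1r.
rewrite (pdM i (C1_coord j) (C1_coord j)) pd_coord eq_sym (negbTE ji).
by rewrite mul0r mulr0 addr0.
Qed.

Lemma C1_gauss a : C1 (gauss a) /\
  forall i, pd i (gauss a) = fun x => - (2 * a) * (x 0 i * gauss a x).
Proof.
have [H1 H2] := C1_comp (H' := fun u => - a * expR (- a * u)) (@C1_dot R m)
  (fun x => is_derive_expRM (- a) (dot x x)).
split=> // i; rewrite H2 pd_dot; apply/funext => x; rewrite /gauss; ring.
Qed.

Lemma pd_gauss a i : pd i (gauss a) = fun x => - (2 * a) * (x 0 i * gauss a x).
Proof. exact: (C1_gauss a).2. Qed.

Lemma rapid_gauss a : 0 < a -> rapid (gauss a).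
Proof.
(* From exp(u) >= u at u = a w/(N+1) follows w^(N+1) <= ((N+1)/a)^(N+1) exp(a w), and exp(a w) times
   the Gaussian is the constant exp(a). The exponent N+1 avoids a division by zero at N = 0. *)
move=> a0 N; set c := (N.+1%:R / a) ^+ N.+1 * expR a.
exists c => x; rewrite ger0_norm ?gauss_ge0// /gauss.
have w0 := w_gt0 x.
have H : w x <= N.+1%:R / a * expR (a * w x / N.+1%:R).
  have := expR_ge1Dx (a * w x / N.+1%:R).
  move=> /(le_trans (ler_wpDl ler01 (lexx _))) H.
  rewrite mulrC -ler_pdivrMr ?divr_gt0//; apply: le_trans H.
  by rewrite le_eqVlt; apply/orP; left; apply/eqP; field; rewrite !gt_eqF.
have H2 : w x ^+ N <= (N.+1%:R / a) ^+ N.+1 * expR (a * w x).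
  apply: (@le_trans _ _ (w x ^+ N.+1)); first by rewrite ler_weXn2l// w_ge1.
  have -> : expR (a * w x) = expR (a * w x / N.+1%:R) ^+ N.+1.
    by rewrite -expRM_natl; congr expR; field; rewrite gt_eqF.
  rewrite -exprMn lerXn2r ?nnegrE ?(ltW w0)//.
  by rewrite mulr_ge0 ?expR_ge0// divr_ge0// ltW.
apply: (@le_trans _ _ ((N.+1%:R / a) ^+ N.+1 * expR (a * w x) * expR (- a * dot x x))).
  by rewrite ler_wpM2r ?expR_ge0.
by rewrite -mulrA -expRD /w /c (_ : a * _ + _ = a)//; ring.
Qed.

Lemma rS_gauss a : 0 < a -> rS (gauss a).
Proof.
move=> a0; pose P h := exists2 g, OM g & h = fun x => g x * gauss a x.
have HP h : P h -> C1 h /\ forall i, P (pd i h).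
  move=> [g Og ->]; have Cg := smooth_C1 Og.1; have [Ca _] := C1_gauss a.
  split=> [|i]; first exact: C1M.
  exists (fun x => pd i g x + - (2 * a) * x 0 i * g x).
    apply: OMD; first exact: OM_pd.
    by apply: OMM => //; apply: OMM; [exact: OM_cst|exact: OM_coord].
  by rewrite pdM// pd_gauss; apply/funext => x; ring.
have [|sh Ph] := smooth_ind HP (f := gauss a).
  exists (fun=> 1); first exact: OM_cst.
  by apply/funext => x; rewrite mul1r.
split=> // s; have [g Og ->] := Ph s.
apply: slow_rapid; last exact: rapid_gauss.
exact: Og.2 [::].
Qed.

(** The parameter of [gauss] may be negative: [gauss (- a)] serves as integrating factor below. *)
Lemma gaussN a x : gauss a x * gauss (- a) x = 1.
Proof. by rewrite /gauss -expRD opprK mulNr addNr expR0. Qed.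

Lemma cosT0 f : cosT f 0 = Int f.
Proof. by rewrite /cosT; congr Int; apply/funext => x; rewrite dot0l cos0 mul1r. Qed.

Lemma sinT0 f : sinT f 0 = 0.
Proof.
rewrite /sinT (_ : (fun _ => _) = (fun=> 0)) ?Int0//.
by apply/funext => x; rewrite dot0l sin0 mul0r.
Qed.

Lemma coord_gauss a i : a != 0 ->
  (fun x : V => x 0 i * gauss a x) = fun x => - (2 * a)^-1 * pd i (gauss a) x.
Proof. by move=> a0; rewrite pd_gauss; apply/funext => x; field. Qed.

(** On a Gaussian, multiplication by a coordinate is proportional to differentiation, so the
    transform solves a first-order equation with integrating factor exp(|xi|^2/(4a)). The product
    has zero partial derivatives and equals its value at the origin. *)
Lemma cosT_gauss a (xi : V) : 0 < a ->
  cosT (gauss a) xi = Int (gauss a) * gauss (4 * a)^-1 xi.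
Proof.
move=> a0; have Sa := rS_gauss a0; have a0' := lt0r_neq0 a0.
have Da j : rD (pd j (gauss a)) by exact: rD_pd (rS_rD Sa).
set b := (4 * a)^-1.
have Cc := smooth_C1 (rS_cosT Sa).1.
have [Cb _] := C1_gauss (- b).
have := @C1_pd0_cst _ _ (fun x => cosT (gauss a) x * gauss (- b) x) 0 xi.
move=> /(_ (C1M Cc Cb)) H.
have : cosT (gauss a) xi * gauss (- b) xi = Int (gauss a).
  rewrite H => [|i z].
    by rewrite cosT0 /gauss dot0l mulr0 expR0 mulr1.
  rewrite pdM// pd_gauss pd_cosT// (sinTZ _ _ (rS_Intble (rS_coord i Sa))).
  rewrite (coord_gauss i a0') (sinTZ _ _ (rD_Intble (Da i))).
  rewrite sinT_pd; last exact: rS_rD.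
  by rewrite /b; field.
move=> <-; by rewrite -mulrA [gauss (- b) xi * _]mulrC gaussN mulr1.
Qed.

Lemma sinT_gauss a (xi : V) : 0 < a -> sinT (gauss a) xi = 0.
Proof.
move=> a0; have Sa := rS_gauss a0; have a0' := lt0r_neq0 a0.
have Da j : rD (pd j (gauss a)) by exact: rD_pd (rS_rD Sa).
set b := (4 * a)^-1.
have Cc := smooth_C1 (rS_sinT Sa).1.
have [Cb _] := C1_gauss (- b).
have := @C1_pd0_cst _ _ (fun x => sinT (gauss a) x * gauss (- b) x) 0 xi.
move=> /(_ (C1M Cc Cb)) H.
have : sinT (gauss a) xi * gauss (- b) xi = 0.
  rewrite H => [|i z]; first by rewrite sinT0 mul0r.
  rewrite pdM// pd_gauss pd_sinT// (coord_gauss i a0').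
  rewrite (cosTZ _ _ (rD_Intble (Da i))).
  rewrite cosT_pd; last exact: rS_rD.
  by rewrite /b; field.
by move=> /eqP; rewrite mulf_eq0 [X in _ || X]gt_eqF ?gauss_gt0// orbF => /eqP.
Qed.

(** On the unit cube, which has measure 1, the Gaussian is at least exp(-a m). *)
Lemma Int_gauss_gt0 a : 0 < a -> 0 < Int (gauss a).
Proof.
move=> a0.
pose A : set (m.-tuple (measurableTypeR R)) :=
  [set u | forall i, `[0%R, 1%R]%classic (tnth u i)].
have muA : lebesgue_tuple m A = 1%E.
  rewrite /A (tuple_measure_box (@lebesgue_measure R) (A := fun=> `[0, 1]%classic))//.
  by rewrite big1// => i _; rewrite /= lebesgue_measure_itv/= lte_fin ltr01 sube0.
have mA : measurable A.
  rewrite (_ : A = \bigcap_(i in [set: 'I_m]) ((fun u => tnth u i) @^-1` `[0%R, 1%R]%classic)).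
    apply: fin_bigcap_measurable => // i _; rewrite -[X in measurable X]setTI.
    by apply: measurable_tnth.
  by apply/seteqP; split=> u /= Hu i; [move=> _|]; exact: Hu.
pose c : R := expR (- a * m%:R).
rewrite -lte_fin -EFin_Int; last exact/rS_Intble/rS_gauss.
apply: (@lt_le_trans _ _ (\int[lebesgue_tuple m]_u (c * \1_A u)%:E)%E).
  under eq_integral do rewrite EFinM.
  rewrite ge0_integralZl//; last 2 first.
  - by apply/measurable_EFinP; exact: measurable_indic.
  - by rewrite lee_fin expR_ge0.
  have -> : (\int[lebesgue_tuple m]_u (\1_A u)%:E = 1)%E.
    by rewrite integral_indic// setIT; exact: muA.
  by rewrite mule1 lte_fin expR_gt0.
apply: ge0_le_integral => //.
- by move=> u _; rewrite lee_fin mulr_ge0// expR_ge0.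
- by apply/measurable_EFinP; apply: measurable_funM => //; exact: measurable_indic.
- by apply/measurable_EFinP; exact: (mble_continuous (C1_gauss a).1.1).
move=> u _; rewrite lee_fin indicE; case: (boolP (u \in A)) => [|_]; last by rewrite mulr0 gauss_ge0.
rewrite inE => Au; rewrite mulr1 ler_expR !mulNr lerN2 ler_pM2l//.
have -> : m%:R = \sum_(i < m) (1 : R) by rewrite sumr_const card_ord.
apply: ler_sum => i _; rewrite mxE.
have := Au i; rewrite /= in_itv/= => /andP[H0 H1].
by rewrite -[leRHS]mulr1 ler_pM.
Qed.

Lemma Int_sqr_coord_gauss a i : 0 < a ->
  Int (fun x : V => x 0 i * (x 0 i * gauss a x)) = (2 * a)^-1 * Int (gauss a).
Proof.
move=> a0; have Sa := rS_gauss a0.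
have := Int_pd_rD i (rS_rD (rS_coord i Sa)).
rewrite pdM; [|exact: C1_coord|exact: (C1_gauss a).1].
rewrite pd_coord eqxx pd_gauss.
rewrite (_ : (fun _ => _) = (fun x : V => gauss a x + - (2 * a) * (x 0 i * (x 0 i * gauss a x)))); last first.
  by apply/funext => x; rewrite mul1r mulrCA.
have i2 := rS_Intble (rS_coord i (rS_coord i Sa)).
rewrite IntD ?IntZ//; [|exact: rS_Intble|exact: IntbleZ].
move=> /eqP; rewrite mulNr subr_eq0 => /eqP ->.
by rewrite mulrA mulVf ?mul1r// gt_eqF// mulr_gt0.
Qed.

Lemma Int_norm_coord_gauss a i (d : R) : 0 < a -> 0 < d ->
  Intble (fun x : V => `|x 0 i| * gauss a x) /\
  Int (fun x : V => `|x 0 i| * gauss a x) <= (d + (2 * a * d)^-1) * Int (gauss a).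
Proof.
move=> a0 d0; have Sa := rS_gauss a0.
have i0 : Intble (fun x : V => `|x 0 i| * gauss a x).
  have := Intble_norm (rS_Intble (rS_coord i Sa)).
  by under eq_fun do rewrite normrM [`|gauss _ _|]ger0_norm ?gauss_ge0//.
have i2 := rS_Intble (rS_coord i (rS_coord i Sa)).
split=> //.
(* The majorant comes from d |x_i| <= d^2 + x_i^2 after division by d. *)
apply: (@le_trans _ _ (Int (fun x : V => d * gauss a x + d^-1 * (x 0 i * (x 0 i * gauss a x))))).
  apply: le_Int => // [|x]; first by apply: IntbleD; apply: IntbleZ => //; exact: rS_Intble.
  rewrite !mulrA -mulrDl ler_wpM2r ?gauss_ge0//.
  rewrite -(ler_pM2l d0) mulrDr mulrA mulrA mulfV ?gt_eqF// mul1r -expr2 -expr2.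
  rewrite -(real_normK (num_real (x 0 i))).
  have : 0 <= (d - `|x 0 i|) ^+ 2 by rewrite sqr_ge0.
  have := normr_ge0 (x 0 i); nra.
rewrite IntD ?IntZ ?Int_sqr_coord_gauss//; try exact: rS_Intble; last 2 first.
- by apply: IntbleZ; exact: rS_Intble.
- by apply: IntbleZ.
by rewrite le_eqVlt; apply/orP; left; apply/eqP; field; rewrite !gt_eqF.
Qed.

End gaussian.

(** * Fourier inversion on Schwartz functions *)

Section inversion.
Context {R : realType} {m : nat}.
Local Notation V := 'rV[R]_m.
Implicit Types (p q f g h : V -> R) (i : 'I_m).

Lemma eq0_of_small (X C d0 : R) : 0 < d0 ->
  (forall d, 0 < d -> d <= d0 -> `|X| <= C * d) -> X = 0.
Proof.
move=> d00 H; apply/eqP; rewrite -normr_le0; apply/ler_addgt0Pl => e e0; rewrite addr0.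
have C1 : 0 < `|C| + 1 by rewrite ltr_wpDl.
pose d := Num.min d0 (e / (`|C| + 1)).
have d_gt0 : 0 < d by rewrite lt_min d00 divr_gt0.
have dd0 : d <= d0 by rewrite ge_min lexx.
apply: (le_trans (H _ d_gt0 dd0)).
apply: (@le_trans _ _ ((`|C| + 1) * d)).
  by rewrite ler_pM2r// (le_trans (ler_norm _))// lerDl.
by rewrite mulrC -ler_pdivlMr// ge_min lexx orbT.
Qed.

Lemma gauss_near1 (a : R) (x : V) : 0 < a -> `|gauss a x - 1| <= a * dot x x.
Proof.
move=> a0; have q0 := dot_ge0 x.
have := expR_ge1Dx (- a * dot x x); rewrite -/(gauss a x) => H.
have : gauss a x <= 1 by rewrite /gauss -expR0 ler_expR mulNr oppr_le0 mulr_ge0// ltW.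
by move=> H1; rewrite ler0_norm ?subr_le0// opprB lerBlDl; lra.
Qed.

(** The price of a convergence factor [gauss a] in an inversion integral; [c] will be the cosine or
    the sine of that integral. *)
Lemma Int_gauss_near (c : V -> R) h (a : R) : 0 < a -> mble c ->
  (forall x, `|c x| <= 1) -> rS h ->
  `|Int (fun x => (c x * gauss a x) * h x) - Int (fun x => c x * h x)| <=
  a * Int (fun x => dot x x * `|h x|).
Proof.
move=> a0 mc c1 Sh.
have ih := rS_Intble Sh.
have i1 : Intble (fun x => c x * h x).
  apply: (Intble_dom _ (Intble_norm ih)) => [|x].
    by apply: mbleM => //; exact: Intble_mble.
  by rewrite normrM ler_piMl.
have i2 : Intble (fun x => (c x * gauss a x) * h x).
  apply: (Intble_dom _ (Intble_norm ih)) => [|x].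
    apply: mbleM; last exact: Intble_mble.
    by apply: mbleM => //; exact: (mble_continuous (C1_gauss a).1.1).
  rewrite normrM ler_piMl// normrM mulr_ile1//.
  rewrite ger0_norm ?gauss_ge0// /gauss -expR0 ler_expR mulNr oppr_le0.
  by rewrite mulr_ge0 ?dot_ge0// ltW.
have i3 : Intble (fun x => dot x x * `|h x|).
  have := Intble_norm (rS_Intble (OM_rS OM_dot Sh)).
  by under eq_fun do rewrite normrM [`|dot _ _|]ger0_norm ?dot_ge0//.
rewrite -IntB// -IntZ//; apply: norm_Int_le => [||x].
- exact: IntbleB.
- exact: IntbleZ.
rewrite (_ : _ - _ = c x * ((gauss a x - 1) * h x)); last by ring.
rewrite normrM -[leRHS]mul1r; apply: ler_pM => //.
by rewrite normrM mulrA ler_wpM2r// gauss_near1.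
Qed.

Lemma rS_bounded f : rS f -> exists2 B, 0 <= B & forall x, `|f x| <= B.
Proof.
move=> [_ /(_ [::] 0)[B HB]]; exists B.
  by apply: le_trans (HB 0); rewrite mulr_ge0.
by move=> x; have := HB x; rewrite expr0 mul1r.
Qed.

Lemma dot_subl (x y z : V) : dot (x - y) z = dot x z - dot y z.
Proof. by rewrite dotDl -scaleN1r dotZl mulN1r. Qed.

(** Real part of the rule that a modulation translates the transform; it makes the kernel of the
    damped double integral a function of y - x. *)
Lemma cosT_shift (G : V -> R) (x y : V) : Intble G ->
  cosT (fun z => cos (dot x z) * G z) y + sinT (fun z => sin (dot x z) * G z) y =
  cosT G (y - x).
Proof.
move=> iG; rewrite /cosT /sinT -IntD; last 2 first.
- exact/Intble_cos/Intble_cos.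
- exact/Intble_sin/Intble_sin.
by congr Int; apply/funext => z; rewrite dot_subl cosB; ring.
Qed.

Lemma sinT_shift (G : V -> R) (x y : V) : Intble G ->
  sinT (fun z => cos (dot x z) * G z) y - cosT (fun z => sin (dot x z) * G z) y =
  sinT G (y - x).
Proof.
move=> iG; rewrite /cosT /sinT -IntB; last 2 first.
- exact/Intble_sin/Intble_cos.
- exact/Intble_cos/Intble_sin.
by congr Int; apply/funext => z; rewrite dot_subl sinB; ring.
Qed.

Lemma Intble_mul_cosT p q : Intble p -> Intble q -> Intble (fun x => q x * cosT p x).
Proof.
by move=> ip iq; exact: (fubini_kernel measurable_cos_dot
  (fun x y => norm_cos_le1 (dot x y)) ip iq).1.
Qed.

Lemma Intble_mul_sinT p q : Intble p -> Intble q -> Intble (fun x => q x * sinT p x).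
Proof.
by move=> ip iq; exact: (fubini_kernel measurable_sin_dot
  (fun x y => norm_sin_le1 (dot x y)) ip iq).1.
Qed.

(** The imaginary part of inversion. With a Gaussian factor, Fubini gives the integral of [p]
    against [sinT] of a Gaussian taken at y - x, which is zero; then the parameter [a] of the factor
    tends to 0. *)
Lemma sin_cos_inversion p x : rS p -> sinT (cosT p) x - cosT (sinT p) x = 0.
Proof.
move=> Sp; have ip := rS_Intble Sp.
pose M := Int (fun xi => dot xi xi * `|cosT p xi|) +
          Int (fun xi => dot xi xi * `|sinT p xi|).
apply: (@eq0_of_small _ M 1) => // a a0 _.
have iG := rS_Intble (rS_gauss (m := m) a0).
pose X := Int (fun xi => (sin (dot x xi) * gauss a xi) * cosT p xi).
pose Z := Int (fun xi => (cos (dot x xi) * gauss a xi) * sinT p xi).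
have XZ : X = Z.
  apply/eqP; rewrite -subr_eq0; apply/eqP; rewrite /X /Z.
  rewrite (cosT_mul ip (Intble_sin x iG)) (sinT_mul ip (Intble_cos x iG)).
  rewrite -IntB; last 2 first.
  - exact: Intble_mul_cosT (Intble_sin x iG) ip.
  - exact: Intble_mul_sinT (Intble_cos x iG) ip.
  transitivity (Int (fun _ : V => 0 : R)); last exact: Int0.
  congr Int; apply/funext => y.
  by rewrite -mulrBr -opprB sinT_shift// sinT_gauss// oppr0 mulr0.
have H1 : `|X - sinT (cosT p) x| <= _ :=
  Int_gauss_near a0 (mble_continuous (C1_sin x).1.1)
  (fun y => norm_sin_le1 (dot x y)) (rS_cosT Sp).
have H2 : `|Z - cosT (sinT p) x| <= _ :=
  Int_gauss_near a0 (mble_continuous (C1_cos x).1.1)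
  (fun y => norm_cos_le1 (dot x y)) (rS_sinT Sp).
have -> : sinT (cosT p) x - cosT (sinT p) x =
  (Z - cosT (sinT p) x) - (X - sinT (cosT p) x) by rewrite XZ; ring.
apply: (le_trans (ler_normB _ _)); rewrite mulrC mulrDr.
by rewrite addrC; apply: lerD; [exact: H1|exact: H2].
Qed.

(* A factor [gauss (d^2)] in the outer integral becomes, by Fubini, convolution
   of [p] with a Gaussian of width comparable to [d]. *)
Lemma cos_inversion_gauss p x : rS p -> exists C L : R, [/\ 0 <= C, 0 <= L &
  forall d : R, 0 < d ->
  `|cosT (cosT p) x + sinT (sinT p) x -
    Int (@gauss R m (d ^+ 2)) * Int (@gauss R m (4 * d ^+ 2)^-1) * p x| <=
  C * d ^+ 2 + L * d * (Int (@gauss R m (d ^+ 2)) * Int (@gauss R m (4 * d ^+ 2)^-1))].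
Proof.
move=> Sp; have ip := rS_Intble Sp.
have /choice[l Hl] : forall i, exists l : R, 0 <= l /\ forall z, `|pd i p z| <= l.
  by move=> i; have [B B0 HB] := rS_bounded (rS_pd i Sp); exists B.
pose M := Int (fun xi => dot xi xi * `|cosT p xi|) +
          Int (fun xi => dot xi xi * `|sinT p xi|).
have M0 : 0 <= M.
  by rewrite addr_ge0//; apply: Int_ge0 => y; rewrite mulr_ge0// dot_ge0.
(* The factor 3 is that of d + 1/(2 b d) = 3 d at b = 1/(4 d^2), the bound on the mean of |x_i|
   under the Gaussian; [l i] bounds the i-th partial derivative of [p]. *)
exists M, (3 * \sum_i l i); split=> //.
  by rewrite mulr_ge0// sumr_ge0// => i _; have [] := Hl i.
move=> d d0; set a := d ^+ 2; have a0 : 0 < a by rewrite exprn_gt0.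
set b := (4 * a)^-1; have b0 : 0 < b by rewrite invr_gt0 mulr_gt0.
set ka := Int (gauss a); set kb := Int (gauss b).
have ka0 : 0 <= ka by rewrite ltW// Int_gauss_gt0.
have kb0 : 0 <= kb by rewrite ltW// Int_gauss_gt0.
have iG := rS_Intble (rS_gauss (m := m) a0).
have iB := rS_Intble (rS_gauss (m := m) b0).
pose A := Int (fun xi => (cos (dot x xi) * gauss a xi) * cosT p xi) +
    Int (fun xi => (sin (dot x xi) * gauss a xi) * sinT p xi).
have iBx : Intble (fun y => gauss b (y - x)) by exact: (Intble_shift (- x) iB).
have ipB : Intble (fun y => p y * gauss b (y - x)).
  have [B B0 HB] := rS_bounded Sp.
  apply: (Intble_dom _ (IntbleZ B iBx)) => [|y].
    by apply: mbleM; exact: Intble_mble.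
  by rewrite normrM [`|gauss _ _|]ger0_norm ?gauss_ge0// ler_wpM2r ?gauss_ge0.
have AE : A = ka * Int (fun y => p y * gauss b (y - x)).
  rewrite /A (cosT_mul ip (Intble_cos x iG)) (sinT_mul ip (Intble_sin x iG)).
  rewrite -IntD; last 2 first.
  - exact: Intble_mul_cosT (Intble_cos x iG) ip.
  - exact: Intble_mul_sinT (Intble_sin x iG) ip.
  rewrite -IntZ//; congr Int; apply/funext => y.
  by rewrite -mulrDr cosT_shift// cosT_gauss// mulrCA.
have H1 : `|A - (cosT (cosT p) x + sinT (sinT p) x)| <= M * a.
  have H1 := Int_gauss_near a0 (mble_continuous (C1_cos x).1.1)
    (fun y => norm_cos_le1 (dot x y)) (rS_cosT Sp).
  have H2 := Int_gauss_near a0 (mble_continuous (C1_sin x).1.1)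
    (fun y => norm_sin_le1 (dot x y)) (rS_sinT Sp).
  rewrite /A opprD addrACA; apply: (le_trans (ler_normD _ _)).
  by rewrite mulrC mulrDr; apply: lerD; [exact: H1|exact: H2].
have H2 : `|A - ka * kb * p x| <= ka * (3 * (\sum_i l i) * d * kb).
  have iM i : Intble (fun y => `|(y - x) 0 i| * gauss b (y - x)).
    exact: (Intble_shift (- x) (Int_norm_coord_gauss i b0 d0).1).
  have -> : A - ka * kb * p x = ka * (Int (fun y => (p y - p x) * gauss b (y - x))).
    rewrite AE -mulrA -mulrBr; congr (_ * _).
    rewrite /kb -(Int_shift (- x) iB) mulrC -IntZ// -IntB//; last exact: IntbleZ.
    by congr Int; apply/funext => y; rewrite mulrBl.
  rewrite normrM [`|ka|]ger0_norm//; apply: ler_wpM2l => //.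
  apply: (@le_trans _ _ (Int (fun y => \sum_i l i * (`|(y - x) 0 i| * gauss b (y - x))))).
    apply: norm_Int_le => [||y].
    - under eq_fun do rewrite mulrBl.
      by apply: IntbleB => //; exact: IntbleZ.
    - by apply: Intble_sum => i; exact: IntbleZ.
    rewrite normrM [`|gauss _ _|]ger0_norm ?gauss_ge0//.
    under eq_bigr do rewrite mulrA.
    rewrite -mulr_suml ler_wpM2r ?gauss_ge0//.
    under eq_bigr do rewrite !mxE.
    apply: C1_lipschitz; first exact: smooth_C1 Sp.1.
    by move=> i z; exact: (Hl i).2.
  rewrite Int_sum => [|i]; last exact: IntbleZ.
  rewrite mulr_sumr !mulr_suml; apply: ler_sum => i _.
  rewrite (IntZ _ (iM i)) (_ : 3 * l i * d * kb = l i * (3 * d * kb)); last by ring.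
  rewrite ler_wpM2l ?(Hl i).1//.
  rewrite (Int_shift (- x) (Int_norm_coord_gauss i b0 d0).1).
  apply: (le_trans (Int_norm_coord_gauss i b0 d0).2); rewrite ler_wpM2r//.
  rewrite le_eqVlt; apply/orP; left; apply/eqP; rewrite /b /a; field.
  by rewrite gt_eqF.
rewrite [X in `|X|](_ : _ = (A - ka * kb * p x) -
  (A - (cosT (cosT p) x + sinT (sinT p) x))); last by ring.
apply: (le_trans (ler_normB _ _)); rewrite addrC; apply: lerD => //.
by apply: (le_trans H2); rewrite mulrCA.
Qed.

(* The value is [(2 pi)^m], but only its positivity matters. *)
Definition kappa : R := Int (@gauss R m 1) * Int (@gauss R m 4^-1).

Lemma kappa_gt0 : 0 < kappa.
Proof. by apply: mulr_gt0; apply: Int_gauss_gt0 => //; rewrite invr_gt0. Qed.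

(** The constant [k d] attached to the width [d] is calibrated, not computed: the estimate for
    [gauss 1] at the origin, where the double transform equals [kappa], compares [k d] with [kappa].
    The estimate for [p] then passes to the limit. *)
Lemma cos_inversion p x : rS p -> cosT (cosT p) x + sinT (sinT p) x = kappa * p x.
Proof.
move=> Sp; apply/eqP; rewrite -subr_eq0; apply/eqP.
pose k (d : R) := Int (@gauss R m (d ^+ 2)) * Int (@gauss R m (4 * d ^+ 2)^-1).
have k0 d : 0 < d -> 0 <= k d.
  by move=> d0; apply: mulr_ge0; apply: Int_ge0 => y; exact: gauss_ge0.
have [C [L [C0 L0 H]]] := cos_inversion_gauss x Sp.
have [C' [L' [C0' L0' H']]] := cos_inversion_gauss 0 (rS_gauss (m := m) (@ltr01 R)).
have H1 d : 0 < d -> `|kappa - k d| <= C' * d ^+ 2 + L' * d * k d.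
  move=> d0; have := H' d d0; rewrite -/(k d).
  rewrite (_ : gauss 1 0 = 1); last by rewrite /gauss dot0l mulr0 expR0.
  rewrite mulr1 cosT0 sinT0 addr0 (_ : Int (cosT _) = kappa)//.
  rewrite /kappa -IntZ; last by apply/rS_Intble/rS_gauss; rewrite invr_gt0.
  by congr Int; apply/funext => y; rewrite cosT_gauss// mulr1.
(* For d <= [d0] one has L' d <= 1/2, so L' d k(d) is absorbed in the comparison of k(d) with
   [kappa], which leaves k(d) <= 2 (kappa + C'). *)
pose K := 2 * (kappa + C').
pose d0 : R := Num.min 1 (2 * (L' + 1))^-1.
have d00 : 0 < d0 by rewrite lt_min ltr01 invr_gt0 mulr_gt0// ltr_wpDl.
apply: (@eq0_of_small _ (C + L * K + `|p x| * (C' + L' * K)) d0) => // d d_gt0.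
rewrite le_min => /andP[d1 dL].
have dd : d ^+ 2 <= d by rewrite expr2 ler_piMl// ltW.
have d2 : 0 <= d ^+ 2 by rewrite sqr_ge0.
have kd := k0 d d_gt0.
have L'd : L' * d <= 2^-1.
  have : d * (2 * (L' + 1)) <= 1 by rewrite -ler_pdivlMr ?mul1r// mulr_gt0// ltr_wpDl.
  have := ltW d_gt0; nra.
have kK : k d <= K.
  have := ler_normr; have := H1 d d_gt0; rewrite ler_distlC => /andP[_ Hk] _.
  have : L' * d * k d <= 2^-1 * k d by rewrite ler_wpM2r.
  have : C' * d ^+ 2 <= C' by rewrite ler_piMr// (le_trans dd).
  by rewrite /K; lra.
have LK (l c : R) : 0 <= l -> 0 <= c -> c * d ^+ 2 + l * d * k d <= (c + l * K) * d.
  move=> l0 c0; rewrite mulrDl; apply: lerD; first exact: ler_wpM2l.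
  by rewrite mulrAC; apply: ler_wpM2r; [exact: ltW|exact: ler_wpM2l].
rewrite (_ : _ - _ = (cosT (cosT p) x + sinT (sinT p) x - k d * p x) +
  - ((kappa - k d) * p x)); last by ring.
apply: (le_trans (ler_normD _ _)); rewrite [leRHS]mulrDl; apply: lerD.
  exact: le_trans (H d d_gt0) (LK _ _ L0 C0).
rewrite normrN normrM mulrC -mulrA; apply: ler_wpM2l => //.
exact: le_trans (H1 d d_gt0) (LK _ _ L0' C0').
Qed.

End inversion.

(** * Functionals defined by a symbol *)

Section symbol_functionals.
Context {R : realType} {m : nat}.
Local Notation V := 'rV[R]_m.
Implicit Types (f g h mu : V -> R) (i : 'I_m) (s : seq 'I_m).

Lemma nrm_ge0 N f : 0 <= nrm N f.
Proof. by do 2 (apply: sumr_ge0 => ? _); apply: Int_ge0. Qed.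

(** If [mu] grows like w^M, the transforms are estimated with w^(M+m): M powers absorb [mu], the
    other m make the majorant integrable. *)
Lemma symbol_bound mu : mble mu -> slow mu -> exists N (B : R), 0 <= B /\
  forall f, rD f ->
   (Intble (fun x => mu x * cosT f x) /\
    `|Int (fun x => mu x * cosT f x)| <= B * nrm N f) /\
   (Intble (fun x => mu x * sinT f x) /\
    `|Int (fun x => mu x * sinT f x)| <= B * nrm N f).
Proof.
move=> mmu /slow_le[M [B [B0 HB]]]; pose W := Int (fun x : V => (w x ^+ m)^-1).
have W0 : 0 <= W by apply: Int_ge0 => x; rewrite ltW// wV_gt0.
pose K : R := m.+1%:R ^+ (M + m).
exists (2 * (M + m))%N, (B * K * W); split.
  by apply: mulr_ge0 => //; apply: mulr_ge0 => //; rewrite exprn_ge0.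
move=> f Df; have n0 := nrm_ge0 (2 * (M + m)) f.
have H h : mble h -> (forall xi, w xi ^+ (M + m) * `|h xi| <= K * nrm (2 * (M + m)) f) ->
    Intble (fun x => mu x * h x) /\
    `|Int (fun x => mu x * h x)| <= B * K * W * nrm (2 * (M + m)) f.
  move=> mh Hh; set c := B * K * nrm (2 * (M + m)) f.
  have Hc x : `|mu x * h x| <= c * (w x ^+ m)^-1.
    rewrite normrM; apply: (@le_trans _ _ (B * w x ^+ M * `|h x|)).
      exact: ler_wpM2r.
    rewrite ler_pdivlMr ?exprn_gt0 ?w_gt0// /c -mulrA -!mulrA ler_wpM2l//.
    rewrite mulrCA -exprD mulrC.
    exact: Hh.
  have iW := IntbleZ c (@Intble_wV R m).
  have ih := Intble_dom (mbleM mmu mh) iW Hc.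
  split=> //; rewrite (_ : _ * _ * _ * _ = Int (fun x : V => c * (w x ^+ m)^-1)).
    exact: norm_Int_le.
  by rewrite IntZ; [rewrite /c /W; ring|exact: Intble_wV].
split; apply: H.
- exact: (mble_cosT (rD_Intble Df)).
- by move=> xi; exact: wX_cosT.
- exact: (mble_sinT (rD_Intble Df)).
- by move=> xi; exact: wX_sinT.
Qed.

Definition one_minus_lap f : V -> R := fun x => f x + \sum_i -1 * pd i (pd i f) x.

Lemma OM_one_minus_lap mu : OM mu -> OM (one_minus_lap mu).
Proof.
move=> Omu; apply: OMD => //; apply: OM_sum => i.
by apply: OMM; [exact: OM_cst|exact/OM_pd/OM_pd].
Qed.

Lemma one_minus_lap_symm mu h : OM mu -> rS h ->
  Int (fun x => mu x * one_minus_lap h x) = Int (fun x => one_minus_lap mu x * h x).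
Proof.
move=> Omu Sh.
have i1 : Intble (fun x => mu x * h x) by exact/rS_Intble/OM_rS.
have i2 i : Intble (fun x => mu x * pd i (pd i h) x).
  by apply/rS_Intble/OM_rS => //; exact/rS_pd/rS_pd.
have i3 i : Intble (fun x => pd i (pd i mu) x * h x).
  by apply/rS_Intble/OM_rS => //; exact/OM_pd/OM_pd.
transitivity (Int (fun x => mu x * h x) +
    \sum_i -1 * Int (fun x => mu x * pd i (pd i h) x)).
  rewrite (_ : (fun x => _) = fun x => mu x * h x +
      \sum_i -1 * (mu x * pd i (pd i h) x)); last first.
    apply/funext => x; rewrite mulrDr mulr_sumr; congr (_ + _).
    by apply: eq_bigr => i _; rewrite mulrCA.
  rewrite IntD//; last by apply: Intble_sum => i; exact: IntbleZ.
  rewrite Int_sum => [|i]; last exact: IntbleZ.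
  by congr (_ + _); apply: eq_bigr => i _; rewrite IntZ.
transitivity (Int (fun x => mu x * h x) +
    \sum_i -1 * Int (fun x => pd i (pd i mu) x * h x)).
  congr (_ + _); apply: eq_bigr => i _; congr (_ * _).
  rewrite (Int_by_parts i Omu (rS_pd i Sh)) (Int_by_parts i (OM_pd i Omu) Sh).
  by rewrite opprK.
rewrite [RHS](_ : _ = Int (fun x => mu x * h x +
      \sum_i -1 * (pd i (pd i mu) x * h x))); last first.
  congr Int; apply/funext => x; rewrite mulrDl mulr_suml; congr (_ + _).
  by apply: eq_bigr => i _; rewrite mulrA.
rewrite IntD//; last by apply: Intble_sum => i; exact: IntbleZ.
rewrite Int_sum => [|i]; last exact: IntbleZ.
by congr (_ + _); apply: eq_bigr => i _; rewrite IntZ.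
Qed.

Lemma w_mulE f : (fun x : V => w x * f x) = fun x => f x + \sum_i x 0 i * (x 0 i * f x).
Proof.
apply/funext => x; rewrite /w mulrDl mul1r /dot mulr_suml; congr (_ + _).
by apply: eq_bigr => i _; rewrite mulrA.
Qed.

Lemma cosT_sum (F : 'I_m -> V -> R) xi : (forall i, Intble (F i)) ->
  cosT (fun x => \sum_i F i x) xi = \sum_i cosT (F i) xi.
Proof.
move=> iF; rewrite /cosT -Int_sum => [|i]; last exact: Intble_cos.
by congr Int; apply/funext => x; rewrite mulr_sumr.
Qed.

Lemma sinT_sum (F : 'I_m -> V -> R) xi : (forall i, Intble (F i)) ->
  sinT (fun x => \sum_i F i x) xi = \sum_i sinT (F i) xi.
Proof.
move=> iF; rewrite /sinT -Int_sum => [|i]; last exact: Intble_sin.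
by congr Int; apply/funext => x; rewrite mulr_sumr.
Qed.

Lemma cosT_w f : rS f -> cosT (fun x => w x * f x) = one_minus_lap (cosT f).
Proof.
move=> Sf; apply/funext => xi; rewrite w_mulE.
have i2 i := rS_Intble (rS_coord i (rS_coord i Sf)).
rewrite cosTD ?cosT_sum//; [|exact: rS_Intble|exact: Intble_sum].
congr (_ + _); apply: eq_bigr => i _.
rewrite (pd_cosT i Sf) pd_sinT; last exact/rSZ/rS_coord.
rewrite (_ : (fun x => _ * (-1 * _)) = fun x : V => -1 * (x 0 i * (x 0 i * f x))).
  by rewrite cosTZ// mulN1r mulN1r opprK.
by apply/funext => x; ring.
Qed.

Lemma sinT_w f : rS f -> sinT (fun x => w x * f x) = one_minus_lap (sinT f).
Proof.
move=> Sf; apply/funext => xi; rewrite w_mulE.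
have i2 i := rS_Intble (rS_coord i (rS_coord i Sf)).
rewrite sinTD ?sinT_sum//; [|exact: rS_Intble|exact: Intble_sum].
congr (_ + _); apply: eq_bigr => i _.
rewrite (pd_sinT i Sf) pd_cosT; last exact: rS_coord.
by rewrite sinTZ// mulN1r mulN1r opprK.
Qed.

Lemma cosT_wX k mu f : OM mu -> rS f ->
  Int (fun x => mu x * cosT (fun y => w y ^+ k * f y) x) =
  Int (fun x => iter k one_minus_lap mu x * cosT f x).
Proof.
elim: k mu => [|k IH] mu Omu Sf.
  by congr Int; apply/funext => x; congr (_ * cosT _ _); apply/funext => y; rewrite expr0 mul1r.
rewrite (_ : (fun y => w y ^+ k.+1 * f y) = fun y => w y * (w y ^+ k * f y)); last first.
  by apply/funext => y; rewrite exprS mulrA.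
have Sk : rS (fun y => w y ^+ k * f y) by apply: OM_rS => //; exact: OM_wX.
rewrite (cosT_w Sk) (one_minus_lap_symm Omu (rS_cosT Sk)).
by rewrite (IH _ (OM_one_minus_lap Omu) Sf) -iterSr.
Qed.

Lemma sinT_wX k mu f : OM mu -> rS f ->
  Int (fun x => mu x * sinT (fun y => w y ^+ k * f y) x) =
  Int (fun x => iter k one_minus_lap mu x * sinT f x).
Proof.
elim: k mu => [|k IH] mu Omu Sf.
  by congr Int; apply/funext => x; congr (_ * sinT _ _); apply/funext => y; rewrite expr0 mul1r.
rewrite (_ : (fun y => w y ^+ k.+1 * f y) = fun y => w y * (w y ^+ k * f y)); last first.
  by apply/funext => y; rewrite exprS mulrA.
have Sk : rS (fun y => w y ^+ k * f y) by apply: OM_rS => //; exact: OM_wX.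
rewrite (sinT_w Sk) (one_minus_lap_symm Omu (rS_sinT Sk)).
by rewrite (IH _ (OM_one_minus_lap Omu) Sf) -iterSr.
Qed.

Lemma OM_iter_lap k mu : OM mu -> OM (iter k one_minus_lap mu).
Proof. by move=> Omu; elim: k => //= k IH; exact: OM_one_minus_lap. Qed.

Definition BD f : Prop :=
  smooth f /\ forall s, exists B : R, forall x, `|derivs s f x| <= B.

Lemma BD_OM f : BD f -> OM f.
Proof.
move=> [sf bf]; split=> // s; have [B HB] := bf s.
by exists 0, B => x; rewrite expr0 mulr1.
Qed.

(** The constant is chosen before [f] and [N]; this uniformity makes multiplication by [b]
    continuous on $D_{L^1}$. *)
Lemma BD_rD_Int b : BD b -> forall s, exists2 C : R, 0 <= C & forall f N, rD f ->
  (size s <= N)%N ->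
  Intble (derivs s (fun x => b x * f x)) /\
  Int (fun x => `|derivs s (fun x => b x * f x) x|) <= C * nrm N f.
Proof.
move=> [sb bb] s; have [B HB] := choice bb.
have B0 t : 0 <= B t by apply: le_trans (HB t 0).
exists (\sum_(p <- splits s) B p.1); first by apply: sumr_ge0 => p _.
move=> f N [sf fi] sN; rewrite derivsM//.
have j p : Intble (fun x => derivs p.1 b x * derivs p.2 f x).
  apply: (Intble_dom _ (IntbleZ (B p.1) (Intble_norm (fi p.2)))) => [|x].
    by apply: mbleM; [exact: (mble_continuous (sb _).1)|exact: Intble_mble].
  by rewrite normrM ler_wpM2r.
split; first exact: Intble_sum.
apply: (@le_trans _ _ (Int (fun x => \sum_(p <- splits s) B p.1 * `|derivs p.2 f x|))).
  apply: le_Int; first exact/Intble_norm/Intble_sum.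
    by apply: Intble_sum => p; exact/IntbleZ/Intble_norm.
  move=> x; apply: (le_trans (ler_norm_sum _ _ _)); apply: ler_sum => p _.
  by rewrite normrM ler_wpM2r.
rewrite Int_sum => [|p]; last exact/IntbleZ/Intble_norm.
rewrite mulr_suml big_seq [leRHS]big_seq; apply: ler_sum => p ps.
rewrite IntZ; last exact: Intble_norm.
rewrite ler_wpM2l//; apply: Int_derivs_le_nrm; apply: leq_trans sN.
by rewrite -(splits_size ps) leq_addl.
Qed.

Lemma BD_rD b f : BD b -> rD f -> rD (fun x => b x * f x).
Proof.
move=> Bb Df; split; first exact: smoothM Bb.1 Df.1.
by move=> s; have [C _ H] := BD_rD_Int Bb s; exact: (H f (size s) Df (leqnn _)).1.
Qed.

Lemma BD_nrm b N : BD b -> exists2 C : R, 0 <= C & forall f, rD f ->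
  nrm N (fun x => b x * f x) <= C * nrm N f.
Proof.
move=> Bb.
have /choice[C HC] : forall s, exists C : R, 0 <= C /\ forall f N, rD f -> (size s <= N)%N ->
    Int (fun x => `|derivs s (fun x => b x * f x) x|) <= C * nrm N f.
  move=> s; have [C C0 H] := BD_rD_Int Bb s; exists C; split=> // f n Df sn.
  exact: (H f n Df sn).2.
exists (\sum_(k < N.+1) \sum_(s : k.-tuple 'I_m) C s).
  by do 2 (apply: sumr_ge0 => ? _); exact: (HC _).1.
move=> f Df; rewrite /nrm mulr_suml; apply: ler_sum => k _.
rewrite mulr_suml; apply: ler_sum => s _.
by apply: (HC s).2 => //; rewrite size_tuple -ltnS.
Qed.

Definition rho (x : V) : R := expR (- 2^-1 * ln (w x)).

Lemma rho_sqr x : rho x * rho x = (w x)^-1.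
Proof.
rewrite /rho -expRD -mulrDl (_ : - 2^-1 + - 2^-1 = -1); last by field.
by rewrite mulN1r expRN lnK// posrE w_gt0.
Qed.

Lemma rho_ge0 x : 0 <= rho x.
Proof. exact: expR_ge0. Qed.

Lemma pd_w i : pd i (w (m := m)) = fun x : V => 2 * x 0 i.
Proof.
rewrite (pdD i (C1_cst 1) C1_dot) pd_cst pd_dot.
by apply/funext => x; rewrite add0r.
Qed.

(** In d_i rho = - x_i rho^3 the cube is split so that the coordinate carries its own factor [rho]:
    all factors are then bounded. *)
Lemma C1_rho : C1 rho /\
  forall i, pd i rho = fun x => -1 * ((x 0 i * rho x) * (rho x * rho x)).
Proof.
have dH (x : V) : is_derive (w x) 1 (fun u : R => expR (- 2^-1 * ln u))
    ((- 2^-1 * expR (- 2^-1 * ln (w x))) * (w x)^-1).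
  exact: (@is_derive1_comp R (fun v => expR (- 2^-1 * v)) (@ln R) (w x) _ _
    (is_derive_expRM (- 2^-1) (ln (w x))) (is_derive1_ln (w_gt0 x))).
have [H1 H2] := C1_comp (H' := fun u => (- 2^-1 * expR (- 2^-1 * ln u)) * u^-1) (@C1_w R m) dH.
split=> // i; rewrite H2 pd_w; apply/funext => x.
rewrite rho_sqr /rho; field.
by rewrite gt_eqF// w_gt0.
Qed.

(* An algebra of bounded functions, closed under differentiation. *)
Inductive rho_alg : (V -> R) -> Prop :=
| rho_alg_cst c : rho_alg (fun=> c)
| rho_alg_rho : rho_alg rho
| rho_alg_coord i : rho_alg (fun x => x 0 i * rho x)
| rho_alg_add f g : rho_alg f -> rho_alg g -> rho_alg (fun x => f x + g x)
| rho_alg_mul f g : rho_alg f -> rho_alg g -> rho_alg (fun x => f x * g x).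

Lemma rho_alg_pd f : rho_alg f -> C1 f /\ forall i, rho_alg (pd i f).
Proof.
have [Cr pr] := C1_rho.
have Hr i : rho_alg (pd i rho).
  rewrite pr; apply: rho_alg_mul; first exact: rho_alg_cst.
  by apply: rho_alg_mul; [exact: rho_alg_coord|apply: rho_alg_mul; exact: rho_alg_rho].
elim=> [c||i|{}f g af [Cf pf] ag [Cg pg]|{}f g af [Cf pf] ag [Cg pg]].
- by split=> [|i]; [exact: C1_cst|rewrite pd_cst; exact: rho_alg_cst].
- by [].
- split=> [|j]; first exact: C1M (C1_coord i) Cr.
  rewrite (pdM j (C1_coord i) Cr) pd_coord pr.
  rewrite (_ : (fun _ => _) = fun x => (j == i)%:R * rho x +
      (-1 * ((x 0 i * rho x) * ((x 0 j * rho x) * rho x)))).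
    apply: rho_alg_add.
      by apply: rho_alg_mul; [exact: rho_alg_cst|exact: rho_alg_rho].
    apply: rho_alg_mul; first exact: rho_alg_cst.
    apply: rho_alg_mul; first exact: rho_alg_coord.
    by apply: rho_alg_mul; [exact: rho_alg_coord|exact: rho_alg_rho].
  by apply/funext => x; ring.
- split=> [|i]; first exact: C1D.
  by rewrite pdD//; exact: rho_alg_add.
- split=> [|i]; first exact: C1M.
  by rewrite pdM//; apply: rho_alg_add; apply: rho_alg_mul.
Qed.

Lemma rho_alg_bounded f : rho_alg f -> exists B : R, forall x, `|f x| <= B.
Proof.
elim=> [c||i|{}f g _ [B HB] _ [B' HB']|{}f g _ [B HB] _ [B' HB']].
- by exists `|c|.
- exists 1 => x; rewrite ger0_norm ?rho_ge0// -(@expr_le1 _ 2) ?rho_ge0//.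
  by rewrite expr2 rho_sqr invf_le1 ?w_gt0// w_ge1.
- exists 1 => x; rewrite -(@expr_le1 _ 2)// -normrX ger0_norm ?sqr_ge0//.
  rewrite exprMn [rho x ^+ 2]expr2 rho_sqr ler_pdivrMr ?w_gt0// mul1r.
  by apply: (le_trans (sqr_coord_le_dot x i)); rewrite lerDr.
- exists (B + B') => x; apply: (le_trans (ler_normD _ _)); exact: lerD.
- by exists (B * B') => x; rewrite normrM; exact: ler_pM.
Qed.

Lemma BD_rhoX k : BD (fun x => rho x ^+ k).
Proof.
have ak : rho_alg (fun x => rho x ^+ k).
  elim: k => [|k IH]; first exact: rho_alg_cst.
  by under eq_fun do rewrite exprS; apply: rho_alg_mul => //; exact: rho_alg_rho.
have [sm ad] := smooth_ind rho_alg_pd ak.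
by split=> // s; exact/rho_alg_bounded/ad.
Qed.

Lemma powR_wE k x : w x `^ (k%:R / 2) = w x ^+ k * rho x ^+ k.
Proof.
rewrite /powR gt_eqF ?w_gt0// /rho -expRM_natl -[w x in RHS]lnK ?posrE ?w_gt0//.
by rewrite expRK -expRM_natl -expRD; congr expR; field.
Qed.

End symbol_functionals.

(** * The symbols of the two equations *)

Section cardinal_sine.
Context {R : realType}.
Implicit Types (k n N : nat) (u x : R).

Definition sinc_coef k : R^nat :=
  iter k (@pseries_diffs R) (fun n => (-1) ^+ n / (n.*2.+1)`!%:R).

Arguments sinc_coef : simpl never.

(* The [k]-th derivative of [u |-> sin (sqrt u) / sqrt u]. *)
Definition sincd k u : R := limn (pseries (sinc_coef k) u).

Lemma sinc_coefS k n : sinc_coef k.+1 n = n.+1%:R * sinc_coef k n.+1.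
Proof. by []. Qed.

Lemma sinc_coef0 n : sinc_coef 0 n = (-1) ^+ n / (n.*2.+1)`!%:R.
Proof. by []. Qed.

Lemma fact_sinc_coef k n :
  n`!%:R * sinc_coef k n = (n + k)%N`!%:R * sinc_coef 0 (n + k)%N.
Proof.
elim: k n => [|k IH] n; first by rewrite addn0.
by rewrite sinc_coefS mulrA -natrM mulnC -factS IH addSnnS.
Qed.

(** After k differentiations the coefficient of u^n has absolute value (n+k)!/(n! (2(n+k)+1)!). The
    resulting bound, uniform in k, is the coefficient of the exponential series. *)
Lemma norm_sinc_coef k n : `|sinc_coef k n| <= (n`!%:R)^-1.
Proof.
rewrite -[leRHS]mul1r ler_pdivlMr ?ltr0n ?fact_gt0// mulrC.
rewrite -[X in X * _]ger0_norm// -normrM fact_sinc_coef sinc_coef0.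
rewrite !normrM normfV normrX normrN1 expr1n mul1r !normr_nat.
rewrite ler_pdivrMr ?ltr0n ?fact_gt0// mul1r ler_nat.
by apply: leq_fact; rewrite -addnn -addSn leq_addl.
Qed.

Lemma cvg_sincd k u : cvgn (pseries (sinc_coef k) u).
Proof.
apply: normed_cvg.
apply: series_le_cvg; last exact: (is_cvg_series_exp_coeff `|u|).
- by move=> n; rewrite normr_ge0.
- by move=> n; rewrite divr_ge0.
- move=> n /=; rewrite /exp_coeff /= normrM normrX mulrC.
  by apply: ler_wpM2l; [exact: exprn_ge0|exact: norm_sinc_coef].
Qed.

Lemma is_derive_sincd k u : is_derive u 1 (sincd k) (sincd k.+1 u).
Proof.
apply: (@pseries_snd_diffs _ (sinc_coef k) (`|u| + 1)).
- exact: cvg_sincd.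
- exact: (@cvg_sincd k.+1 _).
- exact: (@cvg_sincd k.+2 _).
- by rewrite [ltRHS]ger0_norm ?addr_ge0// ltrDl.
Qed.

(** This is the coefficient of u^n in the k-th derivative of 4 u s'' + 6 s' + s = 0, the equation of
    s(u) = sin(sqrt u)/sqrt u. *)
Lemma sinc_coef_rec k n :
  (4 * n%:R + (4 * k%:R + 6)) * sinc_coef k.+1 n + sinc_coef k n = 0.
Proof.
elim: k n => [|k IH] n.
  rewrite sinc_coefS !sinc_coef0 doubleS (factS n.*2.+2) (factS n.*2.+1) exprS.
  have F0 : (n.*2.+1)`!%:R != 0 :> R by rewrite pnatr_eq0 -lt0n fact_gt0.
  move: ((n.*2.+1)`!) F0 => F F0; rewrite !natrM.
  have E2 : n.*2.+2%:R = 2 * n%:R + 2 :> R by rewrite -mul2n -addn2 natrD natrM.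
  have E3 : n.*2.+3%:R = 2 * n%:R + 3 :> R by rewrite -mul2n -addn3 natrD natrM.
  have E1 : n.+1%:R = n%:R + 1 :> R by rewrite -addn1 natrD.
  have n0 : 0 <= n%:R :> R by [].
  rewrite E1 E2 E3; field; rewrite F0 !gt_eqF//; lra.
rewrite [sinc_coef k.+2 n]sinc_coefS [sinc_coef k.+1 n]sinc_coefS.
have E1 : n.+1%:R = n%:R + 1 :> R by rewrite -addn1 natrD.
have E2 : k.+1%:R = k%:R + 1 :> R by rewrite -addn1 natrD.
have := IH n.+1; rewrite E1 E2 => H.
rewrite (_ : _ + _ = (n%:R + 1) * ((4 * (n%:R + 1) + (4 * k%:R + 6)) *
  sinc_coef k.+1 n.+1 + sinc_coef k n.+1)); last by ring.
by rewrite H mulr0.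
Qed.

(** The factor u raises the degree by one, so the first partial sum exceeds the other two by a
    boundary term of degree N. *)
Lemma sincd_partial k u N :
  4 * u * pseries (sinc_coef k.+2) u N + (4 * k%:R + 6) * pseries (sinc_coef k.+1) u N +
  pseries (sinc_coef k) u N = 4 * N%:R * sinc_coef k.+1 N * u ^+ N.
Proof.
rewrite /pseries /series /=.
elim: N => [|N IH]; first by rewrite !big_geq//; ring.
rewrite !big_nat_recr//= [sinc_coef k.+2 N]sinc_coefS.
move: IH; set A := \sum_(0 <= i < N) _; set B := \sum_(0 <= i < N) _.
set D := \sum_(0 <= i < N) _ => IH.
have H : sinc_coef k N = - ((4 * N%:R + (4 * k%:R + 6)) * sinc_coef k.+1 N).
  by apply/eqP; rewrite -addr_eq0 addrC; apply/eqP/sinc_coef_rec.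
have E1 : N.+1%:R = N%:R + 1 :> R by rewrite -addn1 natrD.
transitivity ((4 * u * A + (4 * k%:R + 6) * B + D) +
  (4 * u * (N.+1%:R * sinc_coef k.+1 N.+1 * u ^+ N) +
   (4 * k%:R + 6) * (sinc_coef k.+1 N * u ^+ N) + sinc_coef k N * u ^+ N)).
  by ring.
by rewrite IH H E1 exprS; ring.
Qed.

Lemma sincd_ode k u :
  4 * u * sincd k.+2 u + (4 * k%:R + 6) * sincd k.+1 u + sincd k u = 0.
Proof.
pose S N := 4 * u * pseries (sinc_coef k.+2) u N +
  (4 * k%:R + 6) * pseries (sinc_coef k.+1) u N + pseries (sinc_coef k) u N.
have S1 : S @ \oo --> 4 * u * sincd k.+2 u + (4 * k%:R + 6) * sincd k.+1 u + sincd k u.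
  by apply: cvgD; [apply: cvgD; apply: cvgMr|]; exact: cvg_sincd.
have H : (fun n => 4 * u * (sinc_coef k.+2 n * u ^+ n)) @ \oo --> 4 * u * 0.
  by apply: cvgMr; exact: (cvg_series_cvg_0 (@cvg_sincd k.+2 u)).
rewrite mulr0 in H.
(* At N = n+1 the boundary term is 4 u times the n-th term of the convergent series of [sincd k.+2],
   hence tends to 0. *)
have E : (fun n => S n.+1) = fun n => 4 * u * (sinc_coef k.+2 n * u ^+ n).
  by apply/funext => n; rewrite /S sincd_partial [sinc_coef k.+2 n]sinc_coefS exprS; ring.
have S2 : S @ \oo --> (0 : R).
  by rewrite -cvg_shiftS; move: H; rewrite -E.
exact: cvg_unique S1 S2.
Qed.

(* With [s := sincd k], [sincd_ode] makes [4 u s'(u)^2 + s(u)^2] nonincreasing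
   on [u >= 0]. *)
Lemma sincd_bound k u : 0 <= u -> `|sincd k u| <= `|sincd k 0|.
Proof.
move=> u0.
pose E (v : R) := (4 * v) * sincd k.+1 v ^+ 2 + sincd k v ^+ 2.
have dE (v : R) : is_derive v 1 E (- (8 * k%:R + 8) * sincd k.+1 v ^+ 2).
  have d1 := is_derive_sincd k v; have d2 := is_derive_sincd k.+1 v.
  have H := is_deriveD (is_deriveM (is_derive_affine v 4 0) (is_deriveX 2 d2))
    (is_deriveX 2 d1).
  have -> : E = (fun h : R => h * 4 + 0) * (sincd k.+1 ^+ 2) + (sincd k ^+ 2).
    apply/funext => h; rewrite -[RHS]/((h * 4 + 0) * sincd k.+1 h ^+ 2 + sincd k h ^+ 2).
    by rewrite /E addr0 [4 * h]mulrC.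
  apply: (is_derive_eq H).
  rewrite -[(sincd k.+1 ^+ 2) v]/(sincd k.+1 v ^+ 2) /GRing.scale/=.
  (* Eliminating s by the differential equation cancels the products s' s'' and leaves -(8k + 8)
     s'^2. *)
  have -> : sincd k v = - (4 * v * sincd k.+2 v + (4 * k%:R + 6) * sincd k.+1 v).
    by apply/eqP; rewrite -addr_eq0 addrC; apply/eqP/sincd_ode.
  by ring.
have cE : continuous E.
  by move=> v; have [/derivable1_diffP/differentiable_continuous] := dE v.
have H : E u <= E 0.
  apply: (@ler0_derive1_nincr _ E 0 u) => //.
  - move=> v _; rewrite derive1E; case: (dE v) => _ ->.
    by rewrite mulNr oppr_le0 mulr_ge0// ?sqr_ge0// addr_ge0// mulr_ge0.
  - exact: continuous_subspaceT.
rewrite -ler_sqr ?nnegrE// !real_normK ?num_real//.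
have <- : E 0 = sincd k 0 ^+ 2 by rewrite /E mulr0 mul0r add0r.
apply: le_trans H; rewrite /E lerDr mulr_ge0// ?sqr_ge0//.
by rewrite mulr_ge0.
Qed.

Lemma sin_sincd x : sin x = x * sincd 0 (x ^+ 2).
Proof.
have H : (fun N => x * pseries (sinc_coef 0) (x ^+ 2) N) @ \oo --> x * sincd 0 (x ^+ 2).
  by apply: cvgMr; exact: cvg_sincd.
have E : (fun N => x * pseries (sinc_coef 0) (x ^+ 2) N) = series (sin_coeff' x).
  apply/funext => N; rewrite /pseries /series/= mulr_sumr; apply: eq_bigr => i _.
  have Ex : x ^+ i.*2.+1 = x * (x ^+ 2) ^+ i by rewrite exprS -exprM mul2n.
  rewrite /sin_coeff' sinc_coef0 Ex -exprnP.
  by move: (_`!%:R^-1) => F; ring.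
rewrite E in H.
exact: cvg_unique (@cvg_sin_coeff' R x) H.
Qed.

End cardinal_sine.

Local Open Scope complex_scope.

(** * Compositions that stay in $O_M$ *)

Section symbols.
Context {R : realType} {m : nat}.
Local Notation V := 'rV[R]_m.
Implicit Types (f g q : V -> R) (i : 'I_m).

(** The product rule creates sums, so the base class has to be closed under addition to be stable
    under derivation. *)
Inductive sums_of (B : (V -> R) -> Prop) : (V -> R) -> Prop :=
| sums_of_base f : B f -> sums_of B f
| sums_of_add f g : sums_of B f -> sums_of B g -> sums_of B (fun x => f x + g x).

(** The derivatives of the composite are sums of terms h_k(q) g with [g] in $O_M$. Bounds are asked
    on the range of [q] alone: exp(-c u) and [sincd] are bounded for u >= 0, in general not for u <
    0. *)
Lemma OM_comp_family (h : nat -> R -> R) q : OM q ->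
  (forall k (u : R), is_derive u 1 (h k) (h k.+1 u)) ->
  (forall k, exists B : R, forall x, `|h k (q x)| <= B) ->
  OM (fun x => h 0%N (q x)).
Proof.
move=> Oq dh bh; pose Q k x := h k (q x).
have CQ k : C1 (Q k) /\ forall i, pd i (Q k) = fun x => Q k.+1 x * pd i q x.
  exact: (C1_comp (H' := h k.+1) (smooth_C1 Oq.1) (fun x => dh k (q x))).
pose B f := exists k g, OM g /\ f = fun x => Q k x * g x.
have BC f : sums_of B f -> C1 f /\ forall i, sums_of B (pd i f).
  elim=> [_ [k [g [Og ->]]]|{}f g _ [Cf pf] _ [Cg pg]].
    have Cg := smooth_C1 Og.1; have [Ck pk] := CQ k.
    split=> [|i]; first exact: C1M.
    rewrite (pdM i Ck Cg) pk; apply: sums_of_add; apply: sums_of_base.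
      exists k.+1, (fun x => pd i q x * g x); split; last by apply/funext => x; rewrite mulrA.
      by apply: OMM => //; exact: OM_pd.
    by exists k, (pd i g); split=> //; exact: OM_pd.
  split=> [|i]; first exact: C1D.
  by rewrite pdD//; exact: sums_of_add.
have [|sf Pd] := smooth_ind BC (f := fun x => h 0%N (q x)).
  apply: sums_of_base; exists 0%N, (fun=> 1); split; first exact: OM_cst.
  by apply/funext => x; rewrite mulr1.
split=> // s; elim: (Pd s) => [_ [k [g [Og ->]]]|f g _ sf' _ sg]; last exact: slowD.
apply: slowM; last exact: (Og.2 [::]).
by have [C HC] := bh k; exists 0%N, C => x; rewrite expr0 mulr1; exact: HC.
Qed.

Lemma OM_cos_sin q : OM q -> OM (fun x => cos (q x)) /\ OM (fun x => sin (q x)).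
Proof.
move=> Oq; have Cq := smooth_C1 Oq.1.
have [Cc pc] := C1_comp (H := cos) (H' := fun a => - sin a) Cq (fun x => is_derive_cos (q x)).
have [Cs ps] := C1_comp (H := sin) (H' := cos) Cq (fun x => is_derive_sin (q x)).
pose P f := exists a b : V -> R, [/\ OM a, OM b &
  f = fun x => a x * cos (q x) + b x * sin (q x)].
have PC f : P f -> C1 f /\ forall i, P (pd i f).
  move=> [a [b [Oa Ob ->]]].
  have Ca := smooth_C1 Oa.1; have Cb := smooth_C1 Ob.1.
  split=> [|i]; first by apply: C1D; exact: C1M.
  exists (fun x => pd i a x + b x * pd i q x), (fun x => pd i b x + -1 * (a x * pd i q x)).
  split.
  - by apply: OMD; [exact: OM_pd|apply: OMM => //; exact: OM_pd].
  - apply: OMD; first exact: OM_pd.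
    by apply: OMM; [exact: OM_cst|apply: OMM => //; exact: OM_pd].
  - rewrite (pdD i (C1M Ca Cc) (C1M Cb Cs)) (pdM i Ca Cc) (pdM i Cb Cs) pc ps.
    by apply/funext => x; ring.
have POM f : P f -> OM f.
  move=> Pf; have [sf Pd] := smooth_ind PC Pf; split=> // s.
  have [a [b [Oa Ob ->]]] := Pd s.
  apply: slowD; apply: slowM.
  - exact: (Oa.2 [::]).
  - by exists 0%N, 1 => x; rewrite expr0 mulr1 norm_cos_le1.
  - exact: (Ob.2 [::]).
  - by exists 0%N, 1 => x; rewrite expr0 mulr1 norm_sin_le1.
split; apply: POM.
- exists (fun=> 1), (fun=> 0); split; [exact: OM_cst|exact: OM_cst|].
  by apply/funext => x; rewrite mul1r mul0r addr0.
- exists (fun=> 0), (fun=> 1); split; [exact: OM_cst|exact: OM_cst|].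
  by apply/funext => x; rewrite mul1r mul0r add0r.
Qed.

Lemma OM_prod (I : Type) (r : seq I) (F : I -> V -> R) :
  (forall k, OM (F k)) -> OM (fun x => \prod_(k <- r) F k x).
Proof.
move=> CF; elim: r => [|k r IH].
  under eq_fun do rewrite big_nil; exact: OM_cst.
by under eq_fun do rewrite big_cons; exact: OMM.
Qed.

Lemma OM_sum_cond (I : Type) (r : seq I) (P : pred I) (F : I -> V -> R) :
  (forall k, OM (F k)) -> OM (fun x => \sum_(k <- r | P k) F k x).
Proof.
move=> CF; under eq_fun do rewrite big_mkcond.
by apply: OM_sum => k; case: (P k) => //; exact: OM_cst.
Qed.

Lemma OM_expRM (c : R) q : OM q -> (forall x, 0 <= q x) -> 0 <= c ->
  OM (fun x => expR (- c * q x)).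
Proof.
move=> Oq q0 c0.
have := @OM_comp_family (fun k u => (- c) ^+ k * expR (- c * u)) q Oq _ _.
under eq_fun do rewrite expr0 mul1r; apply.
- move=> k u.
  have H := is_deriveM (is_derive_cst ((- c) ^+ k) u 1) (is_derive_expRM (- c) u).
  by apply: (is_derive_eq H); rewrite /GRing.scale/= mulr0 addr0 exprSr mulrA.
- move=> k; exists (c ^+ k) => x; rewrite normrM normrX normrN [`|c|]ger0_norm//.
  rewrite ler_piMr ?exprn_ge0// ger0_norm ?expR_ge0// -expR0 ler_expR mulNr oppr_le0.
  exact: mulr_ge0.
Qed.

Lemma OM_sincd (c : R) q : OM q -> (forall x, 0 <= q x) -> 0 <= c ->
  OM (fun x => sincd 0 (c * q x)).
Proof.
move=> Oq q0 c0.
apply: (@OM_comp_family sincd (fun x => c * q x)).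
- by apply: OMM => //; exact: OM_cst.
- exact: is_derive_sincd.
- by move=> k; exists `|sincd k (0 : R)| => x; apply: sincd_bound; exact: mulr_ge0.
Qed.

End symbols.

Lemma enorm_sqr {R : realType} m (x : 'rV[R]_m) : enorm x ^+ 2 = dot x x.
Proof. by rewrite /enorm sqr_sqrtr// dot_ge0. Qed.

Lemma sincd00 {R : realType} : sincd 0 (0 : R) = 1.
Proof.
apply: cvg_lim => //; rewrite -cvg_shiftS.
rewrite (_ : (fun n => _) = fun=> 1); first exact: cvg_cst.
apply/funext => n; rewrite /pseries /series/= big_nat_recl//= big1 => [|i _].
  by rewrite addr0 /= !expr0 mulr1 divr1.
by rewrite expr0n mulr0.
Qed.

(** Written in |x|^2, the symbol involves neither the norm nor a separate case at the origin. *)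
Lemma wave_symbolE {R : realType} m (s : R) (x : 'rV[R]_m) :
  wave_symbol s (enorm x) = s * sincd 0 (s ^+ 2 * dot x x).
Proof.
rewrite /wave_symbol -enorm_sqr; case: eqVneq => [->|r0].
  by rewrite expr0n mulr0 sincd00 mulr1.
by rewrite sin_sincd exprMn; field.
Qed.

Lemma heat_kernelE {R : realType} m (t : R) (x : 'rV[R]_m) :
  heat_kernel t x = (2 * pi * t) `^ (- (m%:R / 2)) * gauss (2 * t)^-1 x.
Proof. by rewrite /heat_kernel enorm_sqr /gauss mulNr [dot x x / _]mulrC. Qed.

Lemma Re_mulc {R : realType} (y z : R[i]) :
  complex.Re (y * z) = complex.Re y * complex.Re z - complex.Im y * complex.Im z.
Proof. by case: y; case: z. Qed.

Lemma Im_mulc {R : realType} (y z : R[i]) :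
  complex.Im (y * z) = complex.Re y * complex.Im z + complex.Im y * complex.Re z.
Proof. by case: y; case: z. Qed.

Lemma Re_addc {R : realType} (y z : R[i]) :
  complex.Re (y + z) = complex.Re y + complex.Re z.
Proof. by case: y; case: z. Qed.

Lemma Im_addc {R : realType} (y z : R[i]) :
  complex.Im (y + z) = complex.Im y + complex.Im z.
Proof. by case: y; case: z. Qed.

Lemma cintegralE {R : realType} m (f : 'rV[R]_m -> R[i]) : cintegral f =
  Int (fun x => complex.Re (f x)) +i* Int (fun x => complex.Im (f x)).
Proof. by []. Qed.

Lemma fourierE {R : realType} m (f : 'rV[R]_m -> R[i]) xi :
  Intble (fun x => complex.Re (f x)) -> Intble (fun x => complex.Im (f x)) ->
  fourier f xi =
  (cosT (fun x => complex.Re (f x)) xi + sinT (fun x => complex.Im (f x)) xi) +i*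
  (cosT (fun x => complex.Im (f x)) xi - sinT (fun x => complex.Re (f x)) xi).
Proof.
move=> ir ii; rewrite /fourier cintegralE /cosT /sinT.
rewrite -IntD; [|exact: Intble_cos|exact: Intble_sin].
rewrite -IntB; [|exact: Intble_cos|exact: Intble_sin].
congr (_ +i* _); congr Int; apply/funext => x.
  by rewrite Re_mulc /= cosN sinN mulNr opprK.
by rewrite Im_mulc /= cosN sinN mulNr.
Qed.

(** The constant in front, whose value is 1, stays unevaluated: membership in $O_M$ does not depend
    on it. *)
Lemma fourier_heat_kernel {R : realType} m (t : R) (xi : 'rV[R]_m) : 0 < t ->
  fourier (fun x => (heat_kernel t x)%:C) xi =
  ((2 * pi * t) `^ (- (m%:R / 2)) * Int (@gauss R m (2 * t)^-1) *
    expR (- (t / 2) * dot xi xi))%:C.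
Proof.
move=> t0; set c := _ `^ _; set a := (2 * t)^-1.
have a0 : 0 < a by rewrite invr_gt0 mulr_gt0.
have iG := rS_Intble (rS_gauss (m := m) a0).
have iH : Intble (fun x : 'rV[R]_m => complex.Re (heat_kernel t x)%:C).
  by rewrite /=; under eq_fun do rewrite heat_kernelE; exact: IntbleZ.
rewrite fourierE//; last exact: Intble0.
rewrite /=; under eq_fun do rewrite heat_kernelE.
rewrite cosTZ// sinTZ// cosT_gauss// sinT_gauss// mulr0 subr0.
rewrite (_ : sinT _ xi = 0); last first.
  by rewrite /sinT; under eq_fun do rewrite mulr0; exact: Int0.
rewrite (_ : cosT _ xi = 0); last first.
  by rewrite /cosT; under eq_fun do rewrite mulr0; exact: Int0.
rewrite addr0 /gauss mulrA (_ : (4 * a)^-1 = t / 2)//.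
by rewrite /a; field; rewrite gt_eqF.
Qed.

(** * The symbol of $f_n$ *)

Section fn_symbol.
Context {R : realType} {n d : nat}.
Implicit Types (xi : 'rV[R]_(n * d)).

Lemma OM_block (j : 'I_n) (a : 'I_d) : OM (fun xi => block xi j 0 a).
Proof.
rewrite (_ : (fun _ => _) = fun xi => xi 0 (mxvec_index j a)); first exact: OM_coord.
by apply/funext => xi; rewrite /block mxE -mxvecE vec_mxK.
Qed.

Lemma OM_sum_block (P : pred 'I_n) (a : 'I_d) :
  OM (fun xi => (\sum_(i < n | P i) block xi i) 0 a).
Proof.
under eq_fun do rewrite summxE.
by apply: OM_sum_cond => i; exact: OM_block.
Qed.

Lemma OM_dot_sum_block (P : pred 'I_n) :
  OM (fun xi => dot (\sum_(i < n | P i) block xi i) (\sum_(i < n | P i) block xi i)).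
Proof. by apply: OM_sum => a; apply: OMM; exact: OM_sum_block. Qed.

Lemma simplex_step (t : R) (ts : n.-tuple R) (j : 'I_n) : simplex t ts ->
  0 < nth t ts j.+1 - nth t ts j.
Proof.
(* The path starts at 0, so its step of index [j.+1] compares the entries [j] and [j.+1] of
   [rcons ts t]. *)
rewrite /simplex => /(pathP t) /(_ j.+1).
rewrite size_rcons size_tuple ltnS ltn_ord /= => /(_ isT).
have E k : nth t (rcons ts t) k = nth t ts k.
  rewrite nth_rcons; case: ltnP => // tk; rewrite nth_default//.
  by case: eqP.
by rewrite !E subr_gt0.
Qed.

Lemma OM_fn_symbol (G : R -> distr d) (FG : R -> 'rV[R]_d -> R[i])
    (t : R) (x : 'rV[R]_d) (ts : n.-tuple R) :
  heat_solution G FG \/ wave_solution G FG -> simplex t ts ->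
  OM (fun xi => complex.Re (fn_symbol FG ts t x xi)) /\
  OM (fun xi => complex.Im (fn_symbol FG ts t x xi)).
Proof.
move=> hG hts.
(* Both equations have real transforms at the positive times that occur, so conjugation fixes each
   factor and the product is real. *)
have /choice[g Hg] : forall j : 'I_n, exists g : 'rV[R]_(n * d) -> R,
    OM g /\ forall xi, FG (nth t ts j.+1 - nth t ts j)
      (\sum_(i < n | (i <= j)%N) block xi i) = (g xi)%:C.
  move=> j; have s0 := simplex_step j hts; set s := _ - _ in s0 *.
  have Oq := OM_dot_sum_block (fun i : 'I_n => (i <= j)%N).
  have q0 xi := dot_ge0 (\sum_(i < n | (i <= j)%N) block xi i).
  case: hG => hG.
    eexists; split; last by move=> xi; rewrite (hG _ s0).2 fourier_heat_kernel.
    apply: OMM; first exact: OM_cst.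
    by apply: OM_expRM => //; rewrite divr_ge0// ltW.
  eexists; split; last first.
    by move=> xi; case: (hG _ s0) => _ _ _ ->; rewrite wave_symbolE.
  apply: OMM; first exact: OM_cst.
  by apply: OM_sincd => //; exact: sqr_ge0.
have Ol : OM (fun xi => - dot (\sum_(j < n) block xi j) x).
  under eq_fun do rewrite -mulN1r.
  apply: OMM; first exact: OM_cst.
  by apply: OM_sum => a; apply: OMM; [exact: OM_sum_block|exact: OM_cst].
have [Oc Os] := OM_cos_sin Ol.
have Op : OM (fun xi => \prod_(j < n) g j xi) by apply: OM_prod => j; exact: (Hg j).1.
have E xi : fn_symbol FG ts t x xi =
    cexpi (- dot (\sum_(j < n) block xi j) x) * (\prod_(j < n) g j xi)%:C.
  rewrite /fn_symbol; congr (_ * _); rewrite rmorph_prod; apply: eq_bigr => j _.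
  by rewrite (Hg j).2; exact: conjc_real.
split.
  under eq_fun do rewrite E Re_mulc /= mulr0 subr0.
  exact: OMM.
under eq_fun do rewrite E Im_mulc /= mulr0 add0r.
exact: OMM.
Qed.

End fn_symbol.

(** * Tempered distributions and [O_C'] *)

Section complex_functions.
Context {R : realType} {m : nat}.
Local Notation V := 'rV[R]_m.
Implicit Types (phi psi mu : V -> R[i]) (f : V -> R) (s : seq 'I_m).

Definition re phi : V -> R := fun x => complex.Re (phi x).
Definition im phi : V -> R := fun x => complex.Im (phi x).

Lemma norm_Re_le (z : R[i]) : `|complex.Re z| <= Normc.normc z.
Proof.
case: z => a b /=; rewrite -sqrtr_sqr ler_wsqrtr// lerDl; exact: sqr_ge0.
Qed.

Lemma norm_Im_le (z : R[i]) : `|complex.Im z| <= Normc.normc z.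
Proof.
case: z => a b /=; rewrite -sqrtr_sqr ler_wsqrtr// lerDr; exact: sqr_ge0.
Qed.

Lemma normc_le (z : R[i]) : Normc.normc z <= `|complex.Re z| + `|complex.Im z|.
Proof.
case: z => a b /=.
rewrite -[leRHS]ger0_norm ?addr_ge0// -sqrtr_sqr ler_wsqrtr//.
rewrite sqrrD !real_normK ?num_real// -addrA [X in _ <= _ + X]addrC addrA lerDl.
by rewrite mulrn_wge0// mulr_ge0.
Qed.

Lemma normc_real (r : R) : Normc.normc r%:C = `|r|.
Proof. by rewrite /= expr0n addr0 sqrtr_sqr. Qed.

Lemma normc_ge0 (z : R[i]) : 0 <= Normc.normc z.
Proof. exact: le_trans (normr_ge0 _) (norm_Re_le z). Qed.

Lemma schwartzP phi : schwartz phi <-> rS (re phi) /\ rS (im phi).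
Proof.
split.
  move=> [[sr si] H]; split; split=> // s N; have [B HB] := H N s; exists B => x;
    apply: le_trans (HB x); (apply: ler_wpM2l; first exact: wX_ge0).
    exact: (norm_Re_le (cderivs s phi x)).
  exact: (norm_Im_le (cderivs s phi x)).
move=> [[sr Hr] [si Hi]]; split=> // N s.
have [B HB] := Hr s N; have [B' HB'] := Hi s N; exists (B + B') => x.
apply: le_trans (lerD (HB x) (HB' x)); rewrite -mulrDr; apply: ler_wpM2l; first exact: wX_ge0.
exact: (normc_le (cderivs s phi x)).
Qed.

Lemma DL1P phi : DL1 phi <-> rD (re phi) /\ rD (im phi).
Proof.
split=> [[[sr si] H]|[[sr Hr] [si Hi]]].
  by split; split=> // s; have [] := H s.
by split=> // s; split; [exact: Hr|exact: Hi].
Qed.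

Lemma nrm_le_DL1_norm N phi : DL1 phi ->
  nrm N (re phi) <= DL1_norm N phi /\ nrm N (im phi) <= DL1_norm N phi.
Proof.
move=> /DL1P[[sr Hr] [si Hi]].
have ic s : Intble (fun x => Normc.normc (cderivs s phi x)).
  apply: (Intble_dom _ (IntbleD (Intble_norm (Hr s)) (Intble_norm (Hi s)))) => [|x].
    apply: mble_continuous => x.
    apply: (@continuous_comp _ _ _ (fun x => derivs s (re phi) x * derivs s (re phi) x +
      derivs s (im phi) x * derivs s (im phi) x) (@Num.sqrt R)).
      exact: (C1D (C1M (sr s) (sr s)) (C1M (si s) (si s))).1.
    exact: sqrt_continuous.
  by rewrite ger0_norm ?normc_ge0// normc_le.
split; apply: ler_sum => k _; apply: ler_sum => s _;
  apply: (le_Int (Intble_norm _) (ic s)) => // x.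
  exact: (norm_Re_le (cderivs s phi x)).
exact: (norm_Im_le (cderivs s phi x)).
Qed.

(** [sup] bounds its set only if that set is bounded, which is what [schwartz] provides for every
    term of the norm; the other terms are nonnegative. *)
Lemma le_schwartz_norm N s phi (x : V) : schwartz phi -> (size s <= N)%N ->
  w x ^+ N * Normc.normc (cderivs s phi x) <= schwartz_norm N phi.
Proof.
move=> [_ H] sN; have Hk : (size s < N.+1)%N by [].
have hs t y : w y ^+ N * Normc.normc (cderivs t phi y) <=
    sup [set (1 + dot x x) ^+ N * Normc.normc (cderivs t phi x) | x in [set: V]].
  apply: sup_upper_bound; last by exists y.
  split; first by exists (w y ^+ N * Normc.normc (cderivs t phi y)), y.
  by have [B HB] := H N t; exists B => _ [z _ <-]; exact: HB.
have hs0 t : 0 <= sup [set (1 + dot x x) ^+ N * Normc.normc (cderivs t phi x) | x in [set: V]].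
  by apply: le_trans (hs t 0); apply: mulr_ge0; [exact: wX_ge0|exact: normc_ge0].
rewrite /schwartz_norm (bigD1 (Ordinal Hk))//= (bigD1 (in_tuple s))//= -addrA.
apply: (le_trans (hs s x)); rewrite lerDl.
apply: addr_ge0; apply: sumr_ge0 => ? _; first exact: hs0.
by apply: sumr_ge0 => ? _; exact: hs0.
Qed.

(** Passing from sup norms to L^1 norms costs m more powers of the weight, spent on the
    integrability of w^(-m). *)
Lemma nrm_le_schwartz_norm N : exists2 C : R, 0 <= C & forall phi, schwartz phi ->
  nrm N (re phi) <= C * schwartz_norm (N + m) phi /\
  nrm N (im phi) <= C * schwartz_norm (N + m) phi.
Proof.
pose W := Int (fun x : V => (w x ^+ m)^-1).
have W0 : 0 <= W by apply: Int_ge0 => x; rewrite ltW// wV_gt0.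
exists (\sum_(k < N.+1) \sum_(s : k.-tuple 'I_m) W).
  by do 2 (apply: sumr_ge0 => ? _).
move=> phi Sphi; have [Sr Si] := (schwartzP phi).1 Sphi.
set S := schwartz_norm _ _.
have H f : rS f -> (forall s x, `|derivs s f x| <= Normc.normc (cderivs s phi x)) ->
    nrm N f <= (\sum_(k < N.+1) \sum_(s : k.-tuple 'I_m) W) * S.
  move=> Sf Hf; rewrite mulr_suml; apply: ler_sum => k _.
  rewrite mulr_suml; apply: ler_sum => s _.
  rewrite mulrC /W -IntZ; last exact: Intble_wV.
  apply: le_Int => [||x].
  - exact/Intble_norm/((rS_rD Sf).2 s).
  - exact/IntbleZ/Intble_wV.
  rewrite ler_pdivlMr ?exprn_gt0 ?w_gt0//.
  have sN : (size s <= N + m)%N.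
    by rewrite size_tuple (leq_trans _ (leq_addr _ _))// -ltnS.
  apply: le_trans (le_schwartz_norm x Sphi sN); rewrite mulrC.
  apply: ler_pM => //; first exact: wX_ge0.
  by rewrite ler_weXn2l ?w_ge1// leq_addl.
split; apply: H => // s x.
  exact: (norm_Re_le (cderivs s phi x)).
exact: (norm_Im_le (cderivs s phi x)).
Qed.

Lemma nrm_mono N N' f : (N <= N')%N -> nrm N f <= nrm N' f.
Proof.
move=> NN; rewrite /nrm -!(big_mkord xpredT (fun k => \sum_(s : k.-tuple 'I_m) Int (fun x => `|derivs s f x|))).
rewrite [leRHS](big_cat_nat _ (n := N.+1))//= lerDl.
by do 2 (apply: sumr_ge0 => ? _); apply: Int_ge0.
Qed.

(* The inverse transform without its factor [(2 pi)^-m]. *)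
Definition ifourier psi (x : V) : R[i] :=
  (cosT (re psi) x - sinT (im psi) x) +i* (cosT (im psi) x + sinT (re psi) x).

Definition symbol_form (mu psi : V -> R[i]) : R[i] :=
  cintegral (fun x => mu x * ifourier psi x).

Section form.
Variable mu : V -> R[i].
Hypotheses (Or : OM (re mu)) (Oi : OM (im mu)).

Let mbleOM f : OM f -> mble f.
Proof. by move=> [sf _]; exact: (mble_continuous (smooth_C1 sf).1). Qed.

Lemma symbol_formE psi : rD (re psi) -> rD (im psi) ->
  (Intble (fun x => complex.Re (mu x * ifourier psi x)) /\
   Intble (fun x => complex.Im (mu x * ifourier psi x))) /\
  symbol_form mu psi =
    (Int (fun x => re mu x * cosT (re psi) x) - Int (fun x => re mu x * sinT (im psi) x) -
     (Int (fun x => im mu x * cosT (im psi) x) + Int (fun x => im mu x * sinT (re psi) x))) +i*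
    (Int (fun x => re mu x * cosT (im psi) x) + Int (fun x => re mu x * sinT (re psi) x) +
     (Int (fun x => im mu x * cosT (re psi) x) - Int (fun x => im mu x * sinT (im psi) x))).
Proof.
have [N1 [B1 [_ H1]]] := symbol_bound (mbleOM Or) (Or.2 [::]).
have [N2 [B2 [_ H2]]] := symbol_bound (mbleOM Oi) (Oi.2 [::]).
move=> Dp Dq.
have [[a1 _] [b1 _]] := H1 _ Dp; have [[a2 _] [b2 _]] := H1 _ Dq.
have [[c1 _] [d1 _]] := H2 _ Dp; have [[c2 _] [d2 _]] := H2 _ Dq.
have E1 : (fun x => complex.Re (mu x * ifourier psi x)) =
  fun x => (re mu x * cosT (re psi) x - re mu x * sinT (im psi) x) -
   (im mu x * cosT (im psi) x + im mu x * sinT (re psi) x).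
  by apply/funext => x; rewrite Re_mulc /= mulrBr mulrDr.
have E2 : (fun x => complex.Im (mu x * ifourier psi x)) =
  fun x => (re mu x * cosT (im psi) x + re mu x * sinT (re psi) x) +
   (im mu x * cosT (re psi) x - im mu x * sinT (im psi) x).
  by apply/funext => x; rewrite Im_mulc /= mulrBr mulrDr.
split; last first.
  rewrite /symbol_form cintegralE E1 E2.
  rewrite (IntB (IntbleB a1 b2) (IntbleD c2 d1)) (IntB a1 b2) (IntD c2 d1).
  by rewrite (IntD (IntbleD a2 b1) (IntbleB c1 d2)) (IntD a2 b1) (IntB c1 d2).
split.
  by rewrite E1; apply: IntbleB; [exact: IntbleB|exact: IntbleD].
by rewrite E2; apply: IntbleD; [exact: IntbleD|exact: IntbleB].
Qed.

Lemma symbol_form_bound : exists N (B : R), 0 <= B /\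
  forall psi, rD (re psi) -> rD (im psi) ->
  Normc.normc (symbol_form mu psi) <= B * (nrm N (re psi) + nrm N (im psi)).
Proof.
have [N1 [B1 [B10 H1]]] := symbol_bound (mbleOM Or) (Or.2 [::]).
have [N2 [B2 [B20 H2]]] := symbol_bound (mbleOM Oi) (Oi.2 [::]).
(* Of the eight real integrals, each of [B1] and [B2] bounds two containing [re psi] and two
   containing [im psi]; hence the factor 2. *)
exists (N1 + N2)%N, (2 * (B1 + B2)); split; first by rewrite mulr_ge0// addr_ge0.
move=> psi Dp Dq; apply: (le_trans (normc_le _)).
have [[_ a1] [_ b1]] := H1 _ Dp; have [[_ a2] [_ b2]] := H1 _ Dq.
have [[_ c1] [_ d1]] := H2 _ Dp; have [[_ c2] [_ d2]] := H2 _ Dq.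
have n1 := nrm_mono (re psi) (leq_addr N2 N1).
have n2 := nrm_mono (im psi) (leq_addr N2 N1).
have n3 := nrm_mono (re psi) (leq_addl N1 N2).
have n4 := nrm_mono (im psi) (leq_addl N1 N2).
have {n1}[m1 m1'] := (le_trans a1 (ler_wpM2l B10 n1), le_trans b1 (ler_wpM2l B10 n1)).
have {n2}[m2 m2'] := (le_trans a2 (ler_wpM2l B10 n2), le_trans b2 (ler_wpM2l B10 n2)).
have {n3}[m3 m3'] := (le_trans c1 (ler_wpM2l B20 n3), le_trans d1 (ler_wpM2l B20 n3)).
have {n4}[m4 m4'] := (le_trans c2 (ler_wpM2l B20 n4), le_trans d2 (ler_wpM2l B20 n4)).
rewrite (symbol_formE Dp Dq).2 /=.
apply: (le_trans (lerD (ler_normB _ _) (ler_normD _ _))).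
apply: (le_trans (lerD (lerD (ler_normB _ _) (ler_normD _ _)) (lerD (ler_normD _ _) (ler_normB _ _)))).
apply: (le_trans (lerD (lerD (lerD m1 m2') (lerD m4 m3')) (lerD (lerD m2 m1') (lerD m3 m4')))).
by rewrite le_eqVlt; apply/orP; left; apply/eqP; ring.
Qed.

Lemma symbol_form_linear (a : R[i]) phi psi :
  rD (re phi) -> rD (im phi) -> rD (re psi) -> rD (im psi) ->
  symbol_form mu (fun x => a * phi x + psi x) =
  a * symbol_form mu phi + symbol_form mu psi.
Proof.
move=> Dr Di Dr' Di'; have [[r1 i1] _] := symbol_formE Dr Di; have [[r2 i2] _] := symbol_formE Dr' Di'.
have ir := rD_Intble Dr; have ii := rD_Intble Di.
have ir' := rD_Intble Dr'; have ii' := rD_Intble Di'.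
have Er : re (fun x => a * phi x + psi x) =
    fun x => (complex.Re a * re phi x + - complex.Im a * im phi x) + re psi x.
  by apply/funext => x; rewrite /re Re_addc Re_mulc mulNr.
have Ei : im (fun x => a * phi x + psi x) =
    fun x => (complex.Re a * im phi x + complex.Im a * re phi x) + im psi x.
  by apply/funext => x; rewrite /im Im_addc Im_mulc.
have EF x : ifourier (fun x => a * phi x + psi x) x = a * ifourier phi x + ifourier psi x.
  rewrite /ifourier Er Ei.
  have iz (c : R) f := @IntbleZ R m c f.
  rewrite !cosTD ?sinTD ?cosTZ ?sinTZ//;
    try (by apply: IntbleD; exact: IntbleZ); try exact: IntbleZ.
  apply/eqP; rewrite eq_complex Re_addc Im_addc Re_mulc Im_mulc /=.
  by apply/andP; split; apply/eqP; ring.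
rewrite /symbol_form.
rewrite (_ : (fun x => mu x * _) = fun x => a * (mu x * ifourier phi x) + mu x * ifourier psi x); last first.
  by apply/funext => x; rewrite EF mulrDr mulrCA.
rewrite !cintegralE; apply/eqP; rewrite eq_complex Re_addc Im_addc Re_mulc Im_mulc /=.
apply/andP; split; apply/eqP.
- rewrite -IntZ// -IntZ// -IntB; [|exact: IntbleZ|exact: IntbleZ].
  rewrite -IntD//; last by apply: IntbleB; exact: IntbleZ.
  by congr Int; apply/funext => x; rewrite Re_addc Re_mulc.
- rewrite -IntZ// -IntZ// -IntD; [|exact: IntbleZ|exact: IntbleZ].
  rewrite -IntD//; last by apply: IntbleD; exact: IntbleZ.
  by congr Int; apply/funext => x; rewrite Im_addc Im_mulc.
Qed.

End form.
Lemma re_mulC (b : V -> R) psi : re (fun x => (b x)%:C * psi x) = fun x => b x * re psi x.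
Proof. by apply/funext => x; rewrite /re Re_mulc /= mul0r subr0. Qed.

Lemma im_mulC (b : V -> R) psi : im (fun x => (b x)%:C * psi x) = fun x => b x * im psi x.
Proof. by apply/funext => x; rewrite /im Im_mulc /= mul0r addr0. Qed.

Lemma schwartz_mulC (b : V -> R) psi : OM b -> schwartz psi ->
  schwartz (fun x => (b x)%:C * psi x).
Proof.
move=> Ob /schwartzP[Sr Si]; apply/schwartzP; rewrite re_mulC im_mulC.
by split; exact: OM_rS.
Qed.

Definition clap k mu : V -> R[i] := fun x =>
  iter k one_minus_lap (re mu) x +i* iter k one_minus_lap (im mu) x.

Lemma symbol_form_wX k mu psi : OM (re mu) -> OM (im mu) -> schwartz psi ->
  symbol_form mu (fun x => (w x ^+ k)%:C * psi x) = symbol_form (clap k mu) psi.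
Proof.
move=> Or Oi Sp; have [Sr Si] := (schwartzP psi).1 Sp.
have [Swr Swi] := (schwartzP _).1 (schwartz_mulC (OM_wX k) Sp).
have Olr : OM (re (clap k mu)) by exact: OM_iter_lap.
have Oli : OM (im (clap k mu)) by exact: OM_iter_lap.
rewrite (symbol_formE Or Oi (rS_rD Swr) (rS_rD Swi)).2.
rewrite (symbol_formE Olr Oli (rS_rD Sr) (rS_rD Si)).2.
rewrite re_mulC im_mulC (cosT_wX k Or Sr) (cosT_wX k Or Si) (sinT_wX k Or Sr) (sinT_wX k Or Si).
by rewrite (cosT_wX k Oi Sr) (cosT_wX k Oi Si) (sinT_wX k Oi Sr) (sinT_wX k Oi Si).
Qed.

Lemma schwartz_ifourier psi : schwartz psi -> schwartz (ifourier psi).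
Proof.
move=> /schwartzP[Sr Si]; apply/schwartzP; split; last exact: rSD (rS_cosT Si) (rS_sinT Sr).
rewrite (_ : re _ = fun x => cosT (re psi) x + -1 * sinT (im psi) x).
  exact: rSD (rS_cosT Sr) (rSZ (-1) (rS_sinT Si)).
by apply/funext => x; rewrite mulN1r.
Qed.

Lemma ifourier_fourier phi : schwartz phi ->
  ifourier (fourier phi) = fun x => (@kappa R m)%:C * phi x.
Proof.
move=> Sphi; have [Sr Si] := (schwartzP phi).1 Sphi.
have ir := rS_Intble Sr; have ii := rS_Intble Si.
have Er : re (fourier phi) = fun xi => cosT (re phi) xi + sinT (im phi) xi.
  by apply/funext => xi; rewrite /re fourierE.
have Ei : im (fourier phi) = fun xi => cosT (im phi) xi + -1 * sinT (re phi) xi.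
  by apply/funext => xi; rewrite /im fourierE//= mulN1r.
have [iCr iSr] := (rS_Intble (rS_cosT Sr), rS_Intble (rS_sinT Sr)).
have [iCi iSi] := (rS_Intble (rS_cosT Si), rS_Intble (rS_sinT Si)).
have iSr' := IntbleZ (-1) iSr.
apply/funext => x; rewrite /ifourier Er Ei !cosTD// !sinTD// cosTZ// sinTZ//.
have c1 := cos_inversion x Sr; have c2 := cos_inversion x Si.
have s1 := subr0_eq (sin_cos_inversion x Sr); have s2 := subr0_eq (sin_cos_inversion x Si).
apply/eqP; rewrite eq_complex Re_mulc Im_mulc /= -/(re phi x) -/(im phi x).
rewrite !mul0r subr0 addr0 -c1 -c2.
rewrite s1 s2 !mulN1r; apply/andP; split; apply/eqP.
  by rewrite opprD opprK addrA addrK.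
by rewrite addrA subrK.
Qed.

Lemma fourier_ifourier psi : schwartz psi ->
  fourier (fun x => (@kappa R m)^-1%:C * ifourier psi x) = psi.
Proof.
move=> Spsi; have [Sr Si] := (schwartzP psi).1 Spsi.
have SF := schwartz_ifourier Spsi; have [SFr SFi] := (schwartzP _).1 SF.
have [iFr iFi] := (rS_Intble SFr, rS_Intble SFi).
have ir := rS_Intble Sr; have ii := rS_Intble Si.
have [iCr iSr] := (rS_Intble (rS_cosT Sr), rS_Intble (rS_sinT Sr)).
have [iCi iSi] := (rS_Intble (rS_cosT Si), rS_Intble (rS_sinT Si)).
have iSi' := IntbleZ (-1) iSi.
have Er : re (ifourier psi) = fun xi => cosT (re psi) xi + -1 * sinT (im psi) xi.
  by apply/funext => xi; rewrite mulN1r.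
have Ei : im (ifourier psi) = fun xi => cosT (im psi) xi + sinT (re psi) xi by [].
have k0 := @kappa_gt0 R m.
apply/funext => x; rewrite fourierE -/(re _) -/(im _) ?re_mulC ?im_mulC; try exact: IntbleZ.
rewrite !cosTZ// !sinTZ// Er Ei !cosTD// !sinTD// cosTZ// sinTZ//.
have c1 := cos_inversion x Sr; have c2 := cos_inversion x Si.
have s1 := subr0_eq (sin_cos_inversion x Sr); have s2 := subr0_eq (sin_cos_inversion x Si).
apply/eqP; rewrite eq_complex /= -/(re psi x) -/(im psi x).
have {}c1 : re psi x = (@kappa R m)^-1 * (cosT (cosT (re psi)) x + sinT (sinT (re psi)) x).
  by rewrite c1 mulKf ?gt_eqF.
have {}c2 : im psi x = (@kappa R m)^-1 * (cosT (cosT (im psi)) x + sinT (sinT (im psi)) x).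
  by rewrite c2 mulKf ?gt_eqF.
rewrite c1 c2 s1 s2 !mulN1r -mulrDr -mulrBr; apply/andP; split; apply/eqP; congr (_ * _).
  by rewrite addrA subrK.
by rewrite opprD opprK addrA addrK.
Qed.

Lemma kappaVK (z : R[i]) : (@kappa R m)^-1%:C * ((@kappa R m)%:C * z) = z.
Proof.
rewrite mulrA -rmorphM mulVf ?mul1r// gt_eqF//; exact: kappa_gt0.
Qed.

Lemma symbol_form_fourier mu phi : OM (re mu) -> OM (im mu) -> schwartz phi ->
  symbol_form mu (fourier phi) = (@kappa R m)%:C * distr_of_fun mu phi.
Proof.
move=> Or Oi Sphi; have [Sr Si] := (schwartzP phi).1 Sphi.
rewrite /symbol_form ifourier_fourier// /distr_of_fun !cintegralE.
have Er : (fun x => complex.Re (mu x * phi x)) =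
    fun x => re mu x * re phi x + -1 * (im mu x * im phi x).
  by apply/funext => x; rewrite Re_mulc mulN1r.
have Ei : (fun x => complex.Im (mu x * phi x)) =
    fun x => re mu x * im phi x + im mu x * re phi x.
  by apply/funext => x; rewrite Im_mulc.
have ir : Intble (fun x => complex.Re (mu x * phi x)).
  by rewrite Er; apply/rS_Intble/rSD; [|apply: rSZ]; exact: OM_rS.
have ii : Intble (fun x => complex.Im (mu x * phi x)).
  by rewrite Ei; apply/rS_Intble/rSD; exact: OM_rS.
apply/eqP; rewrite eq_complex Re_mulc Im_mulc /= !mul0r subr0 addr0 -!IntZ//.
by apply/andP; split; apply/eqP; congr Int; apply/funext => x;
  rewrite mulrCA ?Re_mulc ?Im_mulc /=; ring.
Qed.

Section distribution.
Variables (mu : V -> R[i]) (Or : OM (re mu)) (Oi : OM (im mu)).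

Definition symbol_distr : distr m := fun psi => (@kappa R m)^-1%:C * symbol_form mu psi.

Lemma symbol_distr_linear (a : R[i]) phi psi :
  rD (re phi) -> rD (im phi) -> rD (re psi) -> rD (im psi) ->
  symbol_distr (fun x => a * phi x + psi x) = a * symbol_distr phi + symbol_distr psi.
Proof.
by move=> *; rewrite /symbol_distr symbol_form_linear// mulrDr mulrCA.
Qed.

Lemma symbol_distr_bound : exists N (B : R), 0 <= B /\
  forall psi, rD (re psi) -> rD (im psi) ->
  Normc.normc (symbol_distr psi) <= B * (nrm N (re psi) + nrm N (im psi)).
Proof.
have [N [B [B0 H]]] := symbol_form_bound Or Oi.
exists N, ((@kappa R m)^-1 * B); have k0 : 0 <= (@kappa R m)^-1.
  by rewrite invr_ge0 ltW// kappa_gt0.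
split=> [|psi Dr Di]; first exact: mulr_ge0.
by rewrite /symbol_distr Normc.normcM normc_real ger0_norm// -mulrA ler_wpM2l// H.
Qed.

Lemma tempered_symbol_distr : tempered symbol_distr.
Proof.
split.
  move=> a phi psi /schwartzP[Sr Si] /schwartzP[Sr' Si'].
  by apply: symbol_distr_linear; exact: rS_rD.
have [N [B [B0 H]]] := symbol_distr_bound; have [C C0 HC] := nrm_le_schwartz_norm N.
exists (N + m)%N, (B * (C + C)) => phi Sphi.
have [Sr Si] := (schwartzP phi).1 Sphi; have [nr ni] := HC phi Sphi.
apply: (le_trans (H phi (rS_rD Sr) (rS_rD Si))); rewrite -mulrA ler_wpM2l// mulrDl.
exact: lerD.
Qed.

Lemma symbol_distr_fourier : distr_eq (distr_fourier symbol_distr) (distr_of_fun mu).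
Proof.
by move=> phi Sphi; rewrite /distr_fourier /symbol_distr symbol_form_fourier// kappaVK.
Qed.

(** The hypothesis gives [f] on transforms of Schwartz functions; by inversion these exhaust $S$, so
    any [psi] can be written as such a transform. *)
Lemma symbol_distr_unique (f : distr m) :
  distr_eq (distr_fourier f) (distr_of_fun mu) -> distr_eq f symbol_distr.
Proof.
move=> Hf psi Spsi; have SF := schwartz_ifourier Spsi.
have Sphi : schwartz (fun x => (@kappa R m)^-1%:C * ifourier psi x).
  exact: (schwartz_mulC (OM_cst _) SF).
rewrite -[in LHS](fourier_ifourier Spsi) -[LHS]/(distr_fourier f _) Hf//.
rewrite -(symbol_distr_fourier Sphi); congr symbol_distr.
exact: fourier_ifourier.
Qed.

End distribution.

Lemma DL1_mulC (b : V -> R) phi : BD b -> DL1 phi -> DL1 (fun x => (b x)%:C * phi x).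
Proof.
move=> Bb /DL1P[Dr Di]; apply/DL1P; rewrite re_mulC im_mulC.
by split; exact: BD_rD.
Qed.

Lemma OC'_of_fourier mu (f : distr m) : OM (re mu) -> OM (im mu) ->
  tempered f -> distr_eq (distr_fourier f) (distr_of_fun mu) -> OC' f.
Proof.
move=> Or Oi Tf Hf; split=> // k; have Br := @BD_rhoX R m k.
have Olr : OM (re (clap k mu)) by exact: OM_iter_lap.
have Oli : OM (im (clap k mu)) by exact: OM_iter_lap.
(* On $S$ this is the weighted [f], the factor [w ^+ k] having become [clap k]. It extends to
   $D_{L^1}$ because the only multiplier left on [phi] is [rho ^+ k]. *)
exists (fun phi => symbol_distr (clap k mu) (fun x => (rho x ^+ k)%:C * phi x)).
  split.
    move=> a phi psi Dphi Dpsi.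
    have [Dr Di] := (DL1P _).1 (DL1_mulC Br Dphi).
    have [Dr' Di'] := (DL1P _).1 (DL1_mulC Br Dpsi).
    rewrite -(symbol_distr_linear Olr Oli a Dr Di Dr' Di'); congr symbol_distr.
    by apply/funext => x; rewrite mulrDr mulrCA.
  have [N [B [B0 H]]] := symbol_distr_bound Olr Oli.
  have [C C0 HC] := BD_nrm N Br.
  exists N, (B * (C + C)) => phi Dphi.
  have [Dr Di] := (DL1P _).1 Dphi; have [Er Ei] := (DL1P _).1 (DL1_mulC Br Dphi).
  apply: (le_trans (H _ Er Ei)); rewrite re_mulC im_mulC -mulrA ler_wpM2l// mulrDl.
  have [nr ni] := nrm_le_DL1_norm N Dphi.
  by apply: lerD; (apply: (le_trans (HC _ _)) => //; exact: ler_wpM2l).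
move=> phi Sphi.
have Srho := schwartz_mulC (BD_OM Br) Sphi.
rewrite /distr_mul (_ : (fun x => _) = fun x => (w x ^+ k)%:C * ((rho x ^+ k)%:C * phi x)).
  rewrite (symbol_distr_unique Or Oi Hf (schwartz_mulC (OM_wX k) Srho)).
  by rewrite /symbol_distr (symbol_form_wX k Or Oi Srho).
by apply/funext => x; rewrite enorm_sqr -/(w x) powR_wE rmorphM mulrA.
Qed.

End complex_functions.

Theorem lemma4p3 (R : realType) (d n : nat) (hd : (1 <= d)%N) (hn : (1 <= n)%N)
    (G : R -> @distr R d) (FG : R -> 'rV[R]_d -> R[i])
    (hG : heat_solution G FG \/ wave_solution G FG)
    (t : R) (ht : 0 <= t) (x : 'rV[R]_d)
    (ts : n.-tuple R) (hts : simplex t ts) :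
  (exists f : @distr R (n * d), is_fn FG ts t x f) /\
  (forall f : @distr R (n * d), is_fn FG ts t x f -> OC' f).
Proof.
have [Or Oi] := OM_fn_symbol x hG hts; split; last first.
  by move=> f [Tf Hf]; exact: (OC'_of_fourier Or Oi).
(* The functional built from the symbol has the prescribed transform, so the claim on every [f] is
   not vacuous. *)
exists (symbol_distr (fn_symbol FG ts t x)); split; first exact: tempered_symbol_distr.
exact: symbol_distr_fourier.
Qed.
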